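(* Let $z\in\mathcal Z_{\mathrm{ad}}$ be the solution of the continuous control problem, $j(z)=\min_{y\in\mathcal Z_{\mathrm{ad}}}j(y)$, and let $z_h\in\mathcal Z_{\mathrm{ad}}^h$ be the solution of the semidiscrete control problem, $j_h(z_h)=\min_{y\in\mathcal Z_{\mathrm{ad}}^h}j_h(y)$. Let $\beta=R(Sz-\mathbf u_d)$. Then $$\|z-z_h\|_{\mathcal Z}\le C\Big(\|z-\Pi_hz\|_{\mathcal Z}+\|(S-S_h)z\|_{\mathcal U}+\|(R-R_h)(Sz-\mathbf u_d)\|_{\mathcal X}+\|\beta-\Pi_h\beta\|_{\mathcal X}\Big),$$ where the constant $C$ is independent of $h$ (i.e. of the choice of the discrete spaces $\mathbf V_h$, $W_h$ and the partition $\Gamma_h$) and behaves as $1/\alpha$ as $\alpha\to0$ (i.e. $C=O(1/\alpha)$).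
   Context: Setting. $\Omega\subset\mathbb R^d$ is a bounded Lipschitz domain with boundary $\Gamma$ and outward unit normal $\boldsymbol\nu$, $\Gamma$ being partitioned into two non-overlapping relatively open sets $\Gamma_D,\Gamma_N$ ($\Gamma_D=\emptyset$ is allowed), and $T>0$. $A:B$ is the Frobenius product of matrices and $\mathbb R^{d\times d}_{\mathrm{sym}}$ the symmetric matrices. The coefficients $\mathcal C\in L^\infty(\Omega;\mathbb R^{(d\times d)\times(d\times d)})$, $\mathcal E\in L^\infty(\Omega;\mathbb R^{(d\times d)\times d})$, $\boldsymbol\kappa\in L^\infty(\Omega;\mathbb R^{d\times d}_{\mathrm{sym}})$ satisfy, a.e. in $\Omega$ and with constants $c_0,k_0>0$: $\mathcal CA\in\mathbb R^{d\times d}_{\mathrm{sym}}$ and $(\mathcal CA):B=A:(\mathcal CB)$ for all $A,B\in\mathbb R^{d\times d}$; $(\mathcal CA):A\ge c_0A:A$ for $A\in\mathbb R^{d\times d}_{\mathrm{sym}}$; $\mathcal E\mathbf b\in\mathbb R^{d\times d}_{\mathrm{sym}}$ and $(\boldsymbol\kappa\mathbf b)\cdot\mathbf b\ge k_0|\mathbf b|^2$ for $\mathbf b\in\mathbb R^d$. $\mathcal E^\top$ is defined by $(\mathcal E^\top A)\cdot\mathbf b=A:(\mathcal E\mathbf b)$. The density $\rho\in L^\infty(\Omega)$ is strictly positive ($\rho\ge\rho_0>0$ a.e.). $\boldsymbol\varepsilon(\mathbf u)=\frac12(\nabla\mathbf u+\nabla\mathbf u^\top)$, $\sigma(\mathbf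 u,\psi)=\mathcal C\boldsymbol\varepsilon(\mathbf u)+\mathcal E\nabla\psi$, $\mathbf d(\mathbf u,\psi)=\mathcal E^\top\boldsymbol\varepsilon(\mathbf u)-\boldsymbol\kappa\nabla\psi$, $a((\mathbf u,\psi),(\mathbf w,\varphi))=(\sigma(\mathbf u,\psi),\boldsymbol\varepsilon(\mathbf w))_\Omega-(\mathbf d(\mathbf u,\psi),\nabla\varphi)_\Omega$. Spaces. $(\cdot,\cdot)_\Omega$, $\|\cdot\|_\Omega$, $\|\cdot\|_\Gamma$ are $L^2$ inner product/norms on $\Omega$, $\Gamma$; $\|\cdot\|_{1,\Omega}$ is the $H^1(\Omega)$ norm; $\gamma$ is the trace operator to $\Gamma$, $\gamma_D$ its restriction to $\Gamma_D$; $\langle\cdot,\cdot\rangle_\Gamma$ is the $H^{-1/2}(\Gamma)\times H^{1/2}(\Gamma)$ duality, equal to the $L^2(\Gamma)$ product on $L^2(\Gamma)$ functions. $\mathbf H^1_D(\Omega)=\{\mathbf u\in H^1(\Omega)^d:\gamma_D\mathbf u=\mathbf 0\}$ (all of $H^1(\Omega)^d$ if $\Gamma_D=\emptyset$). For symmetric matrix fields $\mathrm S\in L^2$ with row-wise divergence $\mathrm{div}\,\mathrm S\in L^2(\Omega)^d$, the normal trace $\gamma_N\mathrm S$ on $\Gamma_N$ is the functional on $\{\gamma\mathbf v:\mathbf v\in\mathbf H^1_D(\Omega)\}$ given by $\langle\gamma_N\mathrm S,\gamma\mathbf v\rangle_N=(\mathrm S,\boldsymbol\varepsilon(\mathbf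 v))_\Omega+(\mathrm{div}\,\mathrm S,\mathbf v)_\Omega$; $\mathbf q\cdot\boldsymbol\nu$ is the usual normal trace of $\mathbf q\in\mathbf H(\mathrm{div},\Omega)$. $\mathbf L^2_\rho(\Omega)$ is $L^2(\Omega)^d$ with inner product $(\cdot,\cdot)_\rho=(\rho\,\cdot,\cdot)_\Omega$ and norm $\|\cdot\|_\rho$; $\mathbf H^{-1}_D(\Omega)$ is the dual of $\mathbf H^1_D(\Omega)$ when $\mathbf L^2_\rho(\Omega)$ is identified with its dual, and $\langle\cdot,\cdot\rangle_\rho$ is the corresponding duality product. $G:H^1(\Omega)\to\mathbb R$ is linear, bounded, with $G1\ne0$; $H^1_G(\Omega)=\{\psi\in H^1(\Omega):G\psi=0\}$. $L^2_0(\Gamma)=\{z\in L^2(\Gamma):\int_\Gamma z=0\}$. $\mathcal Z=\{z\in H^1(0,T;L^2_0(\Gamma)):z(0)=0\}$ with norm $\|z\|_{\mathcal Z}=\left(\int_0^T\|\dot z(\tau)\|_\Gamma^2\,\mathrm d\tau\right)^{1/2}$. $\mathcal U=C^0([0,T];\mathbf H^1_D(\Omega))$ with norm $\|\mathbf u\|_{\mathcal U}=\left(\int_0^T\|\mathbf u(\tau)\|_{1,\Omega}^2\,\mathrm d\tau\right)^{1/2}$. $\mathcal X=L^2(0,T;L^2(\Gamma))$ with norm $\|y\|_{\mathcal X}=\left(\int_0^T\|y(t)\|_\Gamma^2\,\mathrm dt\right)^{1/2}$. $S$: for $z\in\mathcal Z$ let $\mathbf u\in C^0([0,T];\mathbf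 H^1_D(\Omega))\cap C^1([0,T];\mathbf L^2_\rho(\Omega))\cap C^2([0,T];\mathbf H^{-1}_D(\Omega))$, $\psi\in C^0([0,T];H^1_G(\Omega))$ be the unique solution of $\langle\ddot{\mathbf u}(t),\mathbf w\rangle_\rho+a((\mathbf u(t),\psi(t)),(\mathbf w,\varphi))=-\langle z(t),\gamma\varphi\rangle_\Gamma$ for all $(\mathbf w,\varphi)\in\mathbf H^1_D(\Omega)\times H^1_G(\Omega)$ and all $t\in[0,T]$, with $\mathbf u(0)=\dot{\mathbf u}(0)=\mathbf 0$; $Sz=\mathbf u\in\mathcal U$. $R$: for $\mathbf f\in\mathcal U$ let $\mathbf p\in C^2([0,T];\mathbf L^2_\rho(\Omega))\cap C^1([0,T];\mathbf H^1_D(\Omega))$ and $\xi\in C^1([0,T];H^1(\Omega))$ be the unique solution of $$\rho\ddot{\mathbf p}(t)=\mathrm{div}\,\sigma(\mathbf p(t),\xi(t))+\rho\,\mathbf f(t),\qquad 0=\nabla\cdot\mathbf d(\mathbf p(t),\xi(t)),$$ $$\gamma_D\mathbf p(t)=\mathbf 0,\quad\gamma_N\sigma(\mathbf p(t),\xi(t))=\mathbf 0,\quad G\xi(t)=0,\quad\mathbf d(\mathbf p(t),\xi(t))\cdot\boldsymbol\nu=0$$ for all $t\in[0,T]$, with $\mathbf p(T)=\dot{\mathbf p}(T)=\mathbf 0$; $R\mathbf f=\gamma\xi\in\mathcal X$. Discrete spaces. $\mathbf V_h\subset\mathbf H^1_D(\Omega)$ and $W_h\subset H^1(\Omega)$ are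 finite-dimensional subspaces, $W_h$ contains the constant functions, and $W_h^G=W_h\cap H^1_G(\Omega)$. $\Gamma_h$ is a (finite) partition of $\Gamma$, $\mathcal P_0(\Gamma_h)$ the space of piecewise constant functions on $\Gamma_h$, and $\Pi_h:L^2(\Gamma)\to\mathcal P_0(\Gamma_h)$ the $L^2(\Gamma)$-orthogonal projection, applied pointwise in time to functions of $t$. $S_h$: for $z\in\mathcal Z$ let $(\mathbf u_h,\psi_h)\in C^2([0,T];\mathbf V_h)\times C^0([0,T];W_h^G)$ be the unique solution of $(\rho\ddot{\mathbf u}_h(t),\mathbf w)_\Omega+a((\mathbf u_h(t),\psi_h(t)),(\mathbf w,\varphi))=-\langle z(t),\gamma\varphi\rangle_\Gamma$ for all $(\mathbf w,\varphi)\in\mathbf V_h\times W_h^G$ and all $t\in[0,T]$, with $\mathbf u_h(0)=\dot{\mathbf u}_h(0)=\mathbf 0$; $S_hz=\mathbf u_h\in\mathcal U$. $R_h$: for $\mathbf f\in\mathcal U$ let $(\mathbf p_h,\xi_h)\in C^2([0,T];\mathbf V_h)\times C^0([0,T];W_h^G)$ be the unique solution of $(\rho\ddot{\mathbf p}_h(t),\mathbf w)_\Omega+a((\mathbf p_h(t),\xi_h(t)),(\mathbf w,\varphi))=(\rho\,\mathbf f(t),\mathbf w)_\Omega$ for all $(\mathbf w,\varphi)\in\mathbf V_h\times W_h^G$ and all $t\in[0,T]$, with $\mathbf p_h(T)=\dot{\mathbf p}_h(T)=\mathbf 0$; $R_h\mathbf f=\gamma\xi_h\in\mathcal X$. Control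 problems. $\mathcal Z_{\mathrm{ad}}=\{z\in\mathcal Z:z_a\le z(t)\le z_b\text{ a.e. on }\Gamma,\ \forall t\in[0,T]\}$ with constants $z_a\le0\le z_b$; $\mathcal Z_h=\{z\in\mathcal Z:z(t)\in\mathcal P_0(\Gamma_h)\ \forall t\}$; $\mathcal Z_{\mathrm{ad}}^h=\mathcal Z_h\cap\mathcal Z_{\mathrm{ad}}$. $\mathbf u_d\in\mathcal U$ is given with $\mathbf u_d(0)=\mathbf 0$, $\alpha>0$, and $$j(z)=\frac12\int_0^T\|Sz(t)-\mathbf u_d(t)\|_\rho^2\,\mathrm dt+\frac\alpha2\|z\|_{\mathcal Z}^2,\qquad j_h(z)=\frac12\int_0^T\|S_hz(t)-\mathbf u_d(t)\|_\rho^2\,\mathrm dt+\frac\alpha2\|z\|_{\mathcal Z}^2.$$ Both minimization problems have a unique solution. *)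

(* Defs.v *)
From HB Require Import structures.
From mathcomp Require Import all_boot all_order all_algebra.
From mathcomp Require Import all_classical all_reals all_analysis.
Set Implicit Arguments.
Unset Strict Implicit.
Unset Printing Implicit Defensive.
Import Order.TTheory GRing.Theory Num.Theory.
Import numFieldNormedType.Exports.
Local Open Scope classical_set_scope.
Local Open Scope ring_scope.

(* Borel sigma-algebra on matrices, hence on R^d = 'rV[R]_d. *)
HB.instance Definition _ (R : realType) (m n : nat) :=
  @isMeasurable.Build (sigma_display (@open 'M[R]_(m, n))) 'M[R]_(m, n)
    <<s @open 'M[R]_(m, n) >> (@sigma_algebra0 _ setT _) (@sigma_algebraC _ _)
    (@sigma_algebra_bigcup _ setT _).

Section Euclid.
Context {R : realType}.

Definition dot d (u v : 'rV[R]_d) : R := \sum_i u 0 i * v 0 i.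
Definition frob d (A B : 'M[R]_d) : R := \sum_i \sum_j A i j * B i j.
Definition enorm d (u : 'rV[R]_d) : R := Num.sqrt (dot u u).

Definition is_lebesgue d (mu : {measure set 'rV[R]_d -> \bar R}) :=
  forall a b : 'rV[R]_d, (forall i, a 0 i <= b 0 i) ->
    mu [set x | forall i, a 0 i <= x 0 i <= b 0 i] =
      (\prod_i (b 0 i - a 0 i))%:E.

(* Volume of the unit ball of R^n: w_(n+2) = (2 pi / (n+2)) w_n. *)
Fixpoint ball_vol (n : nat) : R :=
  match n with
  | 0 => 1
  | 1 => 2
  | (m.+1 as k).+1 => 2 * pi / (k.+1)%:R * ball_vol m
  end.

Definition diam d (A : set 'rV[R]_d) : R :=
  sup [set r | exists x y, [/\ A x, A y & r = enorm (x - y)]].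

(* The empty set does not count, which matters for s = 0 since 0 ^+ 0 = 1. *)
Definition hausdorff_gauge d (s : nat) (A : set 'rV[R]_d) : \bar R :=
  if `[< A = set0 >] then 0%E else (ball_vol s * (diam A / 2) ^+ s)%:E.

Definition hausdorff_delta d (s : nat) (delta : R) (A : set 'rV[R]_d) : \bar R :=
  ereal_inf [set (\sum_(0 <= k <oo) hausdorff_gauge s (U k))%E | U in
    [set U : nat -> set 'rV[R]_d | A `<=` \bigcup_k U k /\
      forall k x y, U k x -> U k y -> enorm (x - y) <= delta]].

Definition hausdorff d (s : nat) (A : set 'rV[R]_d) : \bar R :=
  ereal_sup [set hausdorff_delta s delta A | delta in [set r : R | 0 < r]].

(* The boundary of an open set. *)
Definition bdry d (Om : set 'rV[R]_d) : set 'rV[R]_d := closure Om `\` Om.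

(* (d-1)-dimensional Hausdorff measure on the boundary, on Borel sets. *)
Definition is_surface d (Om : set 'rV[R]_d)
    (sg : {measure set 'rV[R]_d -> \bar R}) :=
  forall A, measurable A -> sg A = hausdorff d.-1 (A `&` bdry Om).

(* Locally, in a rotated frame with last axis e, the domain lies strictly below
   the graph of a Lipschitz function g on the hyperplane orthogonal to e. *)
Definition bounded_lipschitz_domain d (Om : set 'rV[R]_d) :=
  [/\ open Om, connected Om, Om !=set0, bounded_set Om &
    forall x, bdry Om x ->
      exists (e : 'rV[R]_d) (g : 'rV[R]_d -> R) (r L : R),
      [/\ dot e e = 1, 0 < r,
          forall y y', `|g y - g y'| <= L * enorm (y - y') &
          forall y, enorm (y - x) < r ->
            (Om y <-> dot y e < g (y - dot y e *: e))]].

Definition rel_open d (B A : set 'rV[R]_d) :=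
  exists2 O : set 'rV[R]_d, open O & A = O `&` B.

End Euclid.

Section Sobolev.
Context {R : realType} {d : nat}.
Local Notation X := 'rV[R]_d.
Implicit Types (mu : {measure set X -> \bar R}) (D : set X).

Definition L2 mu D (f : X -> R) :=
  measurable_fun D f /\ mu.-integrable D (fun x => (f x ^+ 2)%:E).
Definition L2v mu D (u : X -> 'rV[R]_d) := forall i, L2 mu D (fun x => u x 0 i).

Definition Linf mu D (f : X -> R) :=
  measurable_fun D f /\ exists M, {ae mu, forall x, D x -> `|f x| <= M}.

Definition ip mu D (f g : X -> R) : R := \int[mu]_(x in D) (f x * g x).
Definition ipv mu D (u v : X -> 'rV[R]_d) : R :=
  \int[mu]_(x in D) dot (u x) (v x).
Definition ipm mu D (A B : X -> 'M[R]_d) : R :=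
  \int[mu]_(x in D) frob (A x) (B x).
Definition nrm mu D (f : X -> R) : R := Num.sqrt (ip mu D f f).

Definition partial (i : 'I_d) (f : X -> R) : X -> R :=
  fun x => 'D_(delta_mx 0 i) f x.
Definition smooth (f : X -> R) := forall s : seq 'I_d,
  continuous (foldr partial f s) /\
  forall i x, derivable (foldr partial f s) x (delta_mx 0 i).
Definition test_function D (phi : X -> R) := smooth phi /\
  exists K, [/\ compact K, K `<=` D & forall x, ~ K x -> phi x = 0].

Definition weak_grad mu D (v : X -> R) (g : X -> 'rV[R]_d) :=
  forall phi, test_function D phi -> forall i,
    ip mu D v (partial i phi) = - ip mu D (fun x => g x 0 i) phi.
Definition weak_div mu D (q : X -> 'rV[R]_d) (f : X -> R) :=
  forall phi, test_function D phi ->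
    ipv mu D q (fun x => \row_i partial i phi x) = - ip mu D f phi.

(* An element of H^1 is represented by the pair (v, grad v) of the function and
   its weak gradient, and an element of (H^1)^d by (u, Du), where
   Du i j = d_j u_i.  Everything is invariant under a.e. modification of either
   component; equality in H^1 is "the norm of the difference is 0".  The regular
   module R^o gives pointwise scaling on functions. *)
Definition sfield : Type := ((X -> R^o) * (X -> 'rV[R]_d))%type.
Definition vfield : Type := ((X -> 'rV[R]_d) * (X -> 'M[R]_d))%type.

Definition vcomp (i : 'I_d) (u : vfield) : sfield :=
  (fun x => u.1 x 0 i, fun x => row i (u.2 x)).
Definition cstf (c : R) : sfield := (fun=> c, fun=> 0).

Definition H1 mu D (v : sfield) :=
  [/\ L2 mu D v.1, L2v mu D v.2 & weak_grad mu D v.1 v.2].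
Definition H1v mu D (u : vfield) := forall i, H1 mu D (vcomp i u).

Definition normH1 mu D (v : sfield) : R :=
  Num.sqrt (ip mu D v.1 v.1 + ipv mu D v.2 v.2).
Definition normH1v mu D (u : vfield) : R :=
  Num.sqrt (ipv mu D u.1 u.1 + ipm mu D u.2 u.2).

(* The trace: the bounded linear extension to H^1 of the restriction to the
   boundary of functions continuous up to the boundary. *)
Definition is_trace mu D (sg : {measure set X -> \bar R})
    (tr : sfield -> X -> R^o) :=
  [/\ forall v, H1 mu D v -> L2 sg (bdry D) (tr v),
      forall a v w, H1 mu D v -> H1 mu D w ->
        {ae sg, forall x, bdry D x -> tr (a *: v + w) x = a * tr v x + tr w x},
      exists c, forall v, H1 mu D v ->
        nrm sg (bdry D) (tr v) <= c * normH1 mu D v &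
      forall v, H1 mu D v -> {within closure D, continuous v.1} ->
        {ae sg, forall x, bdry D x -> tr v x = v.1 x}].

End Sobolev.
Arguments sfield : clear implicits.
Arguments vfield : clear implicits.

(* Spaces C^k([0,T]; B) for a subspace B of V with (semi)norm N; the derivatives
   are derivatives of V-valued functions in the sense of N. *)
Section TimeRegularity.
Context {R : realType} {V : lmodType R}.
Variables (T : R) (B : set V) (N : V -> R).

Definition is_C0 (u : R -> V) := forall t, t \in `[0, T] ->
  B (u t) /\ N (u s - u t) @[s --> within `[0, T] (nbhs t)] --> (0 : R).
Definition has_tderiv (u u' : R -> V) := forall t, t \in `[0, T] ->
  N ((s - t)^-1 *: (u s - u t) - u' t)
    @[s --> within (`[0, T] `\ t) (nbhs t)] --> (0 : R).
Definition is_C1 (u u' : R -> V) := [/\ is_C0 u, is_C0 u' & has_tderiv u u'].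
Definition is_C2 (u u' u'' : R -> V) := is_C1 u u' /\ is_C1 u' u''.

Definition finite_dim_subspace := (exists n (b : 'I_n -> V),
  B = [set v | exists c : 'I_n -> R, v = \sum_i c i *: b i]).

End TimeRegularity.

(* L^2(0,T; L^2(D)) and H^1(0,T; L^2(D)), Bochner sense. *)
Section Bochner.
Context {R : realType} {d : nat}.
Local Notation X := 'rV[R]_d.
Variables (T : R) (sg : {measure set X -> \bar R}) (D : set X).

Definition simple_L2 (s : R -> X -> R^o) :=
  exists n (A : 'I_n -> set R) (g : 'I_n -> X -> R^o),
  [/\ forall i, measurable (A i), forall i, L2 sg D (g i) &
      forall t, s t = \sum_i \1_(A i) t *: g i].
Definition strongly_measurable (y : R -> X -> R^o) :=
  exists s : nat -> R -> X -> R^o, (forall k, simple_L2 (s k)) /\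
  {ae lebesgue_measure, forall t, t \in `[0, T] ->
    nrm sg D (s k t - y t) @[k --> \oo] --> (0 : R)}.
Definition bochner_L2 (B : set (X -> R^o)) (y : R -> X -> R^o) :=
  [/\ strongly_measurable y,
      {ae lebesgue_measure, forall t, t \in `[0, T] -> B (y t)} &
      lebesgue_measure.-integrable `[0, T]
        (fun t => (nrm sg D (y t) ^+ 2)%:E)].

Definition L20 (f : X -> R^o) :=
  L2 sg D f /\ \int[sg]_(x in D) f x = 0.

(* z(t) = z(0) + \int_0^t z'(tau) d tau in L^2(D); the Bochner integral is
   identified by its scalar products with the elements of L^2(D). *)
Definition is_tderivative (z z' : R -> X -> R^o) :=
  bochner_L2 L20 z' /\
  forall t, t \in `[0, T] -> forall v, L2 sg D v ->
    ip sg D (z t) v =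
    ip sg D (z 0) v + \int[lebesgue_measure]_(tau in `[0, t]) ip sg D (z' tau) v.
Definition H1t_L20 (z : R -> X -> R^o) :=
  (forall t, t \in `[0, T] -> L20 (z t)) /\ exists z', is_tderivative z z'.
Definition dtime (z : R -> X -> R^o) : R -> X -> R^o :=
  xget 0 [set z' | is_tderivative z z'].

Definition Zspace (z : R -> X -> R^o) := H1t_L20 z /\ nrm sg D (z 0) = 0.
Definition normZ (z : R -> X -> R^o) : R :=
  Num.sqrt (\int[lebesgue_measure]_(t in `[0, T]) (nrm sg D (dtime z t) ^+ 2)).
Definition normX (y : R -> X -> R^o) : R :=
  Num.sqrt (\int[lebesgue_measure]_(t in `[0, T]) (nrm sg D (y t) ^+ 2)).

End Bochner.

(* Action of the coefficient tensors at a point: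
   (C A)_ij = sum_kl C_ijkl A_kl, (E b)_ij = sum_k E_ijk b_k. *)
Section Tensors.
Context {R : realType} {d : nat}.
Definition appC (c : 'I_d -> 'I_d -> 'M[R]_d) (A : 'M[R]_d) : 'M[R]_d :=
  \matrix_(i, j) frob (c i j) A.
Definition appE (e : 'I_d -> 'I_d -> 'rV[R]_d) (b : 'rV[R]_d) : 'M[R]_d :=
  \matrix_(i, j) dot (e i j) b.
Definition appEt (e : 'I_d -> 'I_d -> 'rV[R]_d) (A : 'M[R]_d) : 'rV[R]_d :=
  \sum_i \sum_j A i j *: e i j.
Definition appK (k : 'M[R]_d) (b : 'rV[R]_d) : 'rV[R]_d := b *m k^T.
Definition symp (A : 'M[R]_d) : 'M[R]_d := 2^-1 *: (A + A^T).

Lemma appEtP e A b : dot (appEt e A) b = frob A (appE e b).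
Proof.
rewrite /dot /frob /appEt.
under eq_bigr => k _ do rewrite summxE mulr_suml.
rewrite exchange_big; apply: eq_bigr => i _ /=.
under eq_bigr => k _ do rewrite summxE mulr_suml.
rewrite exchange_big; apply: eq_bigr => j _ /=.
by rewrite mxE /dot mulr_sumr; apply: eq_bigr => k _; rewrite mxE mulrA.
Qed.

End Tensors.

Record piezo (R : realType) (d : nat) := Piezo {
  pz_mu : {measure set 'rV[R]_d -> \bar R};
  pz_Om : set 'rV[R]_d;
  pz_sg : {measure set 'rV[R]_d -> \bar R};
  pz_GamD : set 'rV[R]_d;
  pz_GamN : set 'rV[R]_d;
  pz_tr : sfield R d -> 'rV[R]_d -> R^o;
  pz_T : R;
  pz_Cc : 'rV[R]_d -> 'I_d -> 'I_d -> 'M[R]_d;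
  pz_Ec : 'rV[R]_d -> 'I_d -> 'I_d -> 'rV[R]_d;
  pz_Kc : 'rV[R]_d -> 'M[R]_d;
  pz_rho : 'rV[R]_d -> R;
  pz_G : sfield R d -> R;
  pz_d_gt0 : (0 < d)%N;
  pz_mu_lebesgue : is_lebesgue pz_mu;
  pz_Om_domain : bounded_lipschitz_domain pz_Om;
  pz_sg_surface : is_surface pz_Om pz_sg;
  pz_GamD_open : rel_open (bdry pz_Om) pz_GamD;
  pz_GamN_open : rel_open (bdry pz_Om) pz_GamN;
  pz_Gam_disjoint : pz_GamD `&` pz_GamN = set0;
  pz_Gam_cover : bdry pz_Om = closure pz_GamD `|` closure pz_GamN;
  pz_tr_trace : is_trace pz_mu pz_Om pz_sg pz_tr;
  pz_T_gt0 : 0 < pz_T;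
  pz_Cc_Linf : forall i j k l, Linf pz_mu pz_Om (fun x => pz_Cc x i j k l);
  pz_Ec_Linf : forall i j k, Linf pz_mu pz_Om (fun x => pz_Ec x i j 0 k);
  pz_Kc_Linf : forall i j, Linf pz_mu pz_Om (fun x => pz_Kc x i j);
  pz_Kc_sym : {ae pz_mu, forall x, pz_Om x -> (pz_Kc x)^T = pz_Kc x};
  pz_Cc_sym : {ae pz_mu, forall x, pz_Om x -> forall A B,
    (appC (pz_Cc x) A)^T = appC (pz_Cc x) A /\
    frob (appC (pz_Cc x) A) B = frob A (appC (pz_Cc x) B)};
  pz_Cc_pos : exists2 c0, 0 < c0 & {ae pz_mu, forall x, pz_Om x -> forall A, A^T = A ->
    c0 * frob A A <= frob (appC (pz_Cc x) A) A};
  pz_Ec_sym : {ae pz_mu, forall x, pz_Om x -> forall b,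
    (appE (pz_Ec x) b)^T = appE (pz_Ec x) b};
  pz_Kc_pos : exists2 k0, 0 < k0 & {ae pz_mu, forall x, pz_Om x -> forall b,
    k0 * enorm b ^+ 2 <= dot (appK (pz_Kc x) b) b};
  pz_rho_Linf : Linf pz_mu pz_Om pz_rho;
  pz_rho_pos : exists2 rho0, 0 < rho0 & {ae pz_mu, forall x, pz_Om x -> rho0 <= pz_rho x};
  pz_G_linear : forall a v w, H1 pz_mu pz_Om v -> H1 pz_mu pz_Om w ->
    pz_G (a *: v + w) = a * pz_G v + pz_G w;
  pz_G_bounded : exists c, forall v, H1 pz_mu pz_Om v -> `|pz_G v| <= c * normH1 pz_mu pz_Om v;
  pz_G_one : pz_G (cstf 1) != 0
}.

Section Problem.
Context {R : realType} {d : nat}.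
Variable P : piezo R d.
Local Notation X := 'rV[R]_d.
Local Notation mu := (pz_mu P).
Local Notation Om := (pz_Om P).
Local Notation sg := (pz_sg P).
Local Notation tr := (pz_tr P).
Local Notation T := (pz_T P).
Local Notation Gam := (bdry Om).
Local Notation N1 := (normH1 mu Om).
Local Notation N1v := (normH1v mu Om).
Local Notation Zs := (Zspace T sg Gam).

Definition H1D (u : vfield R d) := H1v mu Om u /\
  {ae sg, forall x, pz_GamD P x -> forall i, tr (vcomp i u) x = 0}.
Definition H1G (v : sfield R d) := H1 mu Om v /\ pz_G P v = 0.

Definition sigma (u : vfield R d) (psi : sfield R d) : X -> 'M[R]_d :=
  fun x => appC (pz_Cc P x) (symp (u.2 x)) + appE (pz_Ec P x) (psi.2 x).
Definition dfield (u : vfield R d) (psi : sfield R d) : X -> 'rV[R]_d :=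
  fun x => appEt (pz_Ec P x) (symp (u.2 x)) - appK (pz_Kc P x) (psi.2 x).
Definition aform (u : vfield R d) (psi : sfield R d)
    (w : vfield R d) (phi : sfield R d) : R :=
  ipm mu Om (sigma u psi) (fun x => symp (w.2 x)) - ipv mu Om (dfield u psi) phi.2.

Definition ip_rho (u v : X -> 'rV[R]_d) : R :=
  ipv mu Om (fun x => pz_rho P x *: u x) v.
Definition norm_rho (u : X -> 'rV[R]_d) : R := Num.sqrt (ip_rho u u).

(* H^{-1}_D: bounded linear functionals on H^1_D; only their values on H^1_D
   matter.  L^2_rho embeds by v |-> (v, _)_rho. *)
Definition HmD (F : vfield R d -> R^o) :=
  (forall a v w, H1D v -> H1D w -> F (a *: v + w) = a * F v + F w) /\
  exists c, forall w, H1D w -> `|F w| <= c * N1v w.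
Definition norm_HmD (F : vfield R d -> R^o) : R :=
  sup [set `|F w| | w in [set w | H1D w /\ N1v w <= 1]].
Definition emb (v : X -> 'rV[R]_d) : vfield R d -> R^o := fun w => ip_rho v w.1.

Definition Uspace (u : R -> vfield R d) := is_C0 T H1D N1v u.
Definition normU (u : R -> vfield R d) : R :=
  Num.sqrt (\int[lebesgue_measure]_(t in `[0, T]) (N1v (u t) ^+ 2)).

Definition sol_S (z : R -> X -> R^o) (u : R -> vfield R d)
    (psi : R -> sfield R d) :=
  exists (u' : R -> X -> 'rV[R]_d) (u'' : R -> vfield R d -> R^o),
  [/\ is_C0 T H1D N1v u,
      is_C1 T (L2v mu Om) norm_rho (fun t => (u t).1) u',
      is_C2 T HmD norm_HmD (fun t => emb (u t).1) (fun t => emb (u' t)) u'' &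
      is_C0 T H1G N1 psi] /\
  [/\ forall t, t \in `[0, T] -> forall w phi, H1D w -> H1G phi ->
        u'' t w + aform (u t) (psi t) w phi = - ip sg Gam (z t) (tr phi),
      N1v (u 0) = 0 & norm_rho (u' 0) = 0].

(* Two fields with time as parameter are equal as elements of the space. *)
Definition same_sol (u u2 : R -> vfield R d) (psi psi2 : R -> sfield R d) :=
  forall t, t \in `[0, T] ->
    N1v (u t - u2 t) = 0 /\ N1 (psi t - psi2 t) = 0.

Definition is_S (S : (R -> X -> R^o) -> R -> vfield R d) :=
  forall z, Zs z -> exists psi, sol_S z (S z) psi /\
    forall u2 psi2, sol_S z u2 psi2 -> same_sol (S z) u2 psi psi2.

(* Normal traces as functionals on traces of H^1 functions; D and q0 are the
   divergences of M and q. *)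
Definition normal_trace_m (M : X -> 'M[R]_d) (D : X -> 'rV[R]_d)
    (v : vfield R d) : R :=
  ipm mu Om M (fun x => symp (v.2 x)) + ipv mu Om D v.1.
Definition normal_trace_v (q : X -> 'rV[R]_d) (q0 : X -> R)
    (phi : sfield R d) : R :=
  ipv mu Om q phi.2 + ip mu Om q0 phi.1.

(* gamma_D p(t) = 0 is part of p(t) in H^1_D. *)
Definition sol_R (f p : R -> vfield R d) (xi : R -> sfield R d) :=
  exists (p' : R -> vfield R d) (p'' : R -> X -> 'rV[R]_d)
         (xi' : R -> sfield R d),
  [/\ is_C2 T (L2v mu Om) norm_rho (fun t => (p t).1) (fun t => (p' t).1) p'',
      is_C1 T H1D N1v p p',
      is_C1 T (H1 mu Om) N1 xi xi',
      forall t, t \in `[0, T] ->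
        [/\ exists D : X -> 'rV[R]_d,
            [/\ L2v mu Om D,
                forall i, weak_div mu Om (fun x => row i (sigma (p t) (xi t) x))
                            (fun x => D x 0 i),
                {ae mu, forall x, Om x ->
                  pz_rho P x *: p'' t x = D x + pz_rho P x *: (f t).1 x} &
                forall v, H1D v -> normal_trace_m (sigma (p t) (xi t)) D v = 0],
            weak_div mu Om (dfield (p t) (xi t)) (fun=> 0),
            pz_G P (xi t) = 0 &
            forall phi, H1 mu Om phi ->
              normal_trace_v (dfield (p t) (xi t)) (fun=> 0) phi = 0] &
      N1v (p T) = 0 /\ N1v (p' T) = 0].

Definition is_R (Rop : (R -> vfield R d) -> R -> X -> R^o) :=
  forall f, Uspace f -> exists p xi, [/\ sol_R f p xi,
    forall t, t \in `[0, T] -> Rop f t = tr (xi t) &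
    forall p2 xi2, sol_R f p2 xi2 -> same_sol p p2 xi xi2].

Section Discrete.
Variables (Vh : set (vfield R d)) (Wh : set (sfield R d)).
Variables (n : nat) (K : 'I_n -> set X).

Definition galerkin_spaces :=
  [/\ finite_dim_subspace Vh, Vh `<=` H1D, finite_dim_subspace Wh,
      Wh `<=` H1 mu Om & forall c, Wh (cstf c)].

Definition boundary_mesh := (forall i, measurable (K i)) /\
  partition setT K Gam.
Definition P0 (f : X -> R^o) := L2 sg Gam f /\
  exists c : 'I_n -> R, {ae sg, forall x, forall i, K i x -> f x = c i}.
Definition is_L2proj (Pi : (X -> R^o) -> X -> R^o) :=
  forall f, L2 sg Gam f -> P0 (Pi f) /\
    forall q, P0 q -> ip sg Gam (f - Pi f) q = 0.

Definition sol_Sh (z : R -> X -> R^o) (u : R -> vfield R d)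
    (psi : R -> sfield R d) :=
  exists u' u'' : R -> vfield R d,
  [/\ is_C2 T Vh N1v u u' u'', is_C0 T (Wh `&` H1G) N1 psi,
      forall t, t \in `[0, T] -> forall w phi, Vh w -> (Wh `&` H1G) phi ->
        ip_rho (u'' t).1 w.1 + aform (u t) (psi t) w phi =
        - ip sg Gam (z t) (tr phi) &
      N1v (u 0) = 0 /\ N1v (u' 0) = 0].
Definition is_Sh (Sh : (R -> X -> R^o) -> R -> vfield R d) :=
  forall z, Zs z -> exists psi, sol_Sh z (Sh z) psi /\
    forall u2 psi2, sol_Sh z u2 psi2 -> same_sol (Sh z) u2 psi psi2.

Definition sol_Rh (f p : R -> vfield R d) (xi : R -> sfield R d) :=
  exists p' p'' : R -> vfield R d,
  [/\ is_C2 T Vh N1v p p' p'', is_C0 T (Wh `&` H1G) N1 xi,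
      forall t, t \in `[0, T] -> forall w phi, Vh w -> (Wh `&` H1G) phi ->
        ip_rho (p'' t).1 w.1 + aform (p t) (xi t) w phi =
        ip_rho (f t).1 w.1 &
      N1v (p T) = 0 /\ N1v (p' T) = 0].
Definition is_Rh (Rh : (R -> vfield R d) -> R -> X -> R^o) :=
  forall f, Uspace f -> exists p xi, [/\ sol_Rh f p xi,
    forall t, t \in `[0, T] -> Rh f t = tr (xi t) &
    forall p2 xi2, sol_Rh f p2 xi2 -> same_sol p p2 xi xi2].

End Discrete.

Definition Zad (za zb : R) (z : R -> X -> R^o) := Zs z /\
  forall t, t \in `[0, T] -> {ae sg, forall x, Gam x -> za <= z t x <= zb}.
Definition Zh n (K : 'I_n -> set X) (z : R -> X -> R^o) := Zs z /\
  forall t, t \in `[0, T] -> P0 K (z t).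

(* j for St = S, and j_h for St = S_h. *)
Definition cost (St : (R -> X -> R^o) -> R -> vfield R d)
    (ud : R -> vfield R d) (alpha : R) (z : R -> X -> R^o) : R :=
  2^-1 * \int[lebesgue_measure]_(t in `[0, T])
           (norm_rho ((St z t).1 - (ud t).1) ^+ 2)
  + alpha / 2 * normZ T sg Gam z ^+ 2.

Definition is_minimizer (A : set (R -> X -> R^o))
    (j : (R -> X -> R^o) -> R) (z : R -> X -> R^o) :=
  A z /\ forall y, A y -> j z <= j y.

End Problem.

(* Main.v *)
(* Integrating by parts twice in time, and by the symmetry of a up to the sign of
   the potentials, (f, S z) = (z, R f) and (f, S_h z) = (z, R_h f), the products
   being those of L^2(0,T; L^2_rho) and of X.  Add the variational inequality for z
   tested with z_h to the one for z_h tested with Pi_h z.  As (z_h, Pi_h z - z)_Z = 0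
   and beta can be replaced by beta - Pi_h beta against Pi_h z - z, the adjoint
   identities give alpha e^2 <= c (s^2 + s e), where e = |z - z_h|_Z and s is the sum
   on the right-hand side of the claim; hence e <= (1 + 2 c / alpha) s.

   The constant c depends on a bound of S_h uniform in h.  It follows from
   |S_h z|^2 = (z, R_h S_h z) and the energy estimate for R_h, which controls the
   gradient of xi_h by |S_h z|.  What remains is |(g, tr xi)| <= C |g| |grad xi| for
   g of zero mean and G xi = 0.  For a fixed g this follows from the solvability of
   the state equation with the data t g, and Banach-Steinhaus in L^2(Gamma) makes C
   independent of g. *)
Require Import Defs.
From HB Require Import structures.
From mathcomp Require Import all_boot all_order all_algebra.
From mathcomp Require Import all_classical all_reals all_analysis.
From mathcomp Require Import measurable_realfun ring lra zify.
Set Implicit Arguments.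
Unset Strict Implicit.
Unset Printing Implicit Defensive.
Import Order.TTheory GRing.Theory Num.Theory.
Import numFieldNormedType.Exports.
Local Open Scope classical_set_scope.
Local Open Scope ring_scope.

(** Functions stand for their classes modulo null sets, so every norm is only a seminorm, and the
    trace, the projection and the solution operators are linear at best up to null elements. Hence
    the functional analysis is done for semi-inner products on subsets of modules, and the adjoint
    identity takes over the role of linearity of the control-to-state maps.

    The detour through R_h for the bound of S_h has this reason: the control acts in the equation
    for the potential, so an energy estimate for S_h would pair z with the time derivative of the
    trace of psi_h. The load of R_h sits in the equation of motion, where testing with the velocity
    suffices.

    Time derivatives of controls are determined only almost everywhere and are picked by a choice
    operator. They are replaced by representatives that are limits of simple functions at every
    time, so that sums, products and projections stay measurable. *)

(** * Semi-inner products and bounded bilinear forms on subspaces *)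

Definition linsub (R : realType) (V : lmodType R) (B : set V) :=
  B 0 /\ forall a u v, B u -> B v -> B (a *: u + v).

(** Linearity is asked only on [B], since an integral product is additive only on integrable
    arguments. There is no definiteness because functions are not identified almost everywhere. *)
Record semi_ip (R : realType) (V : lmodType R) (B : set V) (b : V -> V -> R) :=
  SemiIp {
  sip_sub : linsub B;
  sip_linl : forall a u v w, B u -> B v -> B w ->
    b (a *: u + v) w = a * b u w + b v w;
  sip_sym : forall u v, B u -> B v -> b u v = b v u;
  sip_ge0 : forall u, B u -> 0 <= b u u }.

Arguments sip_sym {R V B b} _ u v _ _.

Section Subspace.
Context {R : realType} {V : lmodType R} {B : set V}.
Hypothesis sB : linsub B.
Lemma subspace0 : B 0. Proof. exact: sB.1. Qed.
Lemma subspaceD u v : B u -> B v -> B (u + v).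
Proof. by move=> Bu Bv; rewrite -[u]scale1r; apply: sB.2. Qed.
Lemma subspaceZ a u : B u -> B (a *: u).
Proof. by move=> Bu; rewrite -[_ *: _]addr0; apply: sB.2 => //; apply: sB.1. Qed.
Lemma subspaceN u : B u -> B (- u).
Proof. by rewrite -scaleN1r; apply: subspaceZ. Qed.
Lemma subspaceB u v : B u -> B v -> B (u - v).
Proof. by move=> Bu Bv; apply: subspaceD => //; apply: subspaceN. Qed.
Lemma subspace_sum n (u : 'I_n -> V) : (forall i, B (u i)) -> B (\sum_i u i).
Proof. by move=> Bu; apply: (big_ind B) => //; [apply: subspace0|apply: subspaceD]. Qed.
End Subspace.

Section SemiIp.
Context {R : realType} {V : lmodType R} {B : set V} {b : V -> V -> R}.
Hypothesis bP : semi_ip B b.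
Let sB := sip_sub bP.

Lemma sipDl u v w : B u -> B v -> B w -> b (u + v) w = b u w + b v w.
Proof.
by move=> Bu Bv Bw; rewrite -[u in LHS]scale1r (sip_linl bP)// mul1r.
Qed.
Lemma sip0l w : B w -> b 0 w = 0.
Proof.
move=> Bw; have B0 := subspace0 sB.
have := sipDl B0 B0 Bw; rewrite addr0 => /eqP.
by rewrite -{1}[b 0 w]addr0 (inj_eq (addrI _)) eq_sym => /eqP.
Qed.
Lemma sipZl a u w : B u -> B w -> b (a *: u) w = a * b u w.
Proof.
move=> Bu Bw; rewrite -[_ *: _]addr0 (sip_linl bP)//; last exact: subspace0.
by rewrite sip0l// addr0.
Qed.
Lemma sipNl u w : B u -> B w -> b (- u) w = - b u w.
Proof. by move=> Bu Bw; rewrite -scaleN1r sipZl// mulN1r. Qed.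
Lemma sipBl u v w : B u -> B v -> B w -> b (u - v) w = b u w - b v w.
Proof. by move=> *; rewrite sipDl ?sipNl//; apply: subspaceN. Qed.
Lemma sipDr u v w : B u -> B v -> B w -> b w (u + v) = b w u + b w v.
Proof.
move=> *; rewrite !(sip_sym bP w)//; last exact: subspaceD.
exact: sipDl.
Qed.
Lemma sipZr a u w : B u -> B w -> b w (a *: u) = a * b w u.
Proof.
move=> *; rewrite !(sip_sym bP w)//; last exact: subspaceZ.
exact: sipZl.
Qed.
Lemma sipNr u w : B u -> B w -> b w (- u) = - b w u.
Proof. by move=> Bu Bw; rewrite -scaleN1r sipZr// mulN1r. Qed.
Lemma sipBr u v w : B u -> B v -> B w -> b w (u - v) = b w u - b w v.
Proof. by move=> *; rewrite sipDr ?sipNr//; apply: subspaceN. Qed.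

Definition snorm u : R := Num.sqrt (b u u).

Lemma snorm_ge0 u : 0 <= snorm u. Proof. exact: sqrtr_ge0. Qed.
Lemma sqr_snorm u : B u -> snorm u ^+ 2 = b u u.
Proof. by move=> Bu; rewrite sqr_sqrtr// (sip_ge0 bP). Qed.

Lemma sip_sqr_CS u v : B u -> B v -> b u v ^+ 2 <= b u u * b v v.
Proof.
move=> Bu Bv.
have key (l : R) : 0 <= b u u - 2 * l * b u v + l ^+ 2 * b v v.
  have Bw : B (u - l *: v) by apply: subspaceB => //; apply: subspaceZ.
  have Blv : B (l *: v) by apply: subspaceZ.
  have := sip_ge0 bP Bw.
  rewrite sipBl// !sipBr// !sipZl// !sipZr// (sip_sym bP v u)//.
  by move=> h; apply: le_trans h _; rewrite le_eqVlt; apply/orP; left; apply/eqP; ring.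
have b0 := sip_ge0 bP Bv.
have [bv0|bv0] := eqVneq (b v v) 0.
  have [->|buv] := eqVneq (b u v) 0; first by rewrite bv0 mulr0 expr0n.
  (* With [b v v = 0] the quadratic is affine in [l], and this [l] gives it the value -1. *)
  have := key ((b u u + 1) / (2 * b u v)); rewrite bv0 mulr0 addr0.
  have -> : 2 * ((b u u + 1) / (2 * b u v)) * b u v = b u u + 1 by field.
  by rewrite opprD addNKr oppr_ge0 ler10.
have bp : 0 < b v v by rewrite lt_neqAle eq_sym bv0.
have := key (b u v / b v v).
have -> : b u u - 2 * (b u v / b v v) * b u v + (b u v / b v v) ^+ 2 * b v v
   = b u u - b u v ^+ 2 / b v v by field.
by rewrite subr_ge0 ler_pdivrMr.
Qed.

Lemma sip_CS u v : B u -> B v -> `|b u v| <= snorm u * snorm v.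
Proof.
move=> Bu Bv; rewrite /snorm -sqrtrM ?(sip_ge0 bP)// -sqrtr_sqr.
by rewrite ler_sqrt ?sip_sqr_CS// mulr_ge0// (sip_ge0 bP).
Qed.
Lemma sip_CSr u v : B u -> B v -> b u v <= snorm u * snorm v.
Proof. by move=> Bu Bv; apply: le_trans (ler_norm _) _; apply: sip_CS. Qed.

Lemma snorm0 : snorm 0 = 0.
Proof. by rewrite /snorm sip0l ?sqrtr0//; exact: subspace0. Qed.
Lemma snormZ a u : B u -> snorm (a *: u) = `|a| * snorm u.
Proof.
move=> Bu; rewrite /snorm sipZl ?sipZr//; last exact: subspaceZ.
by rewrite mulrA -expr2 sqrtrM ?sqr_ge0// sqrtr_sqr.
Qed.
Lemma snormN u : B u -> snorm (- u) = snorm u.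
Proof. by move=> Bu; rewrite -scaleN1r snormZ// normrN normr1 mul1r. Qed.
Lemma snormD u v : B u -> B v -> snorm (u + v) <= snorm u + snorm v.
Proof.
move=> Bu Bv; rewrite -(@ler_pXn2r _ 2)// ?nnegrE ?addr_ge0 ?snorm_ge0//.
rewrite sqrrD !sqr_snorm//; last exact: subspaceD.
rewrite sipDl ?sipDr//; last exact: subspaceD.
rewrite (sip_sym bP v u)// -addrA -[leRHS]addrA lerD2l addrA lerD2r.
by have := sip_CSr Bu Bv; rewrite mulr2n => h; apply: lerD.
Qed.
Lemma snorm_distC u v : B u -> B v -> snorm (u - v) = snorm (v - u).
Proof. by move=> *; rewrite -snormN ?opprB//; exact: subspaceB. Qed.
Lemma snorm_dist u v : B u -> B v -> `|snorm u - snorm v| <= snorm (u - v).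
Proof.
move=> Bu Bv.
have Buv := subspaceB sB Bu Bv; have Bvu := subspaceB sB Bv Bu.
have := snormD Buv Bv; have := snormD Bvu Bu; rewrite !subrK.
by rewrite (snorm_distC Bv Bu) => h1 h2; rewrite ler_norml; apply/andP; split; lra.
Qed.
(** Cauchy-Schwarz in place of definiteness: an element of seminorm 0 is invisible to the form.
    Initial and terminal conditions and a.e. identities are used in this way. *)
Lemma snorm0P u v : B u -> B v -> snorm u = 0 -> b u v = 0.
Proof.
by move=> Bu Bv u0; have := sip_CS Bu Bv; rewrite u0 mul0r normr_le0 => /eqP.
Qed.
End SemiIp.
Arguments snorm {R V} b u.

(** Two separate spaces accommodate the trace pairing and the duality of H^{-1}_D with H^1_D. [N1]
    and [N2] are arbitrary functions without a sign, hence the absolute values in the estimates that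
    use [bb_bound]. *)
Record bdd_bilin (R : realType) (V W : lmodType R) (B1 : set V) (N1 : V -> R)
    (B2 : set W) (N2 : W -> R) (b : V -> W -> R) := BddBilin {
  bb_sub1 : linsub B1;
  bb_sub2 : linsub B2;
  bb_linl : forall a u v w, B1 u -> B1 v -> B2 w ->
    b (a *: u + v) w = a * b u w + b v w;
  bb_linr : forall a u v w, B2 u -> B2 v -> B1 w ->
    b w (a *: u + v) = a * b w u + b w v;
  bb_bound : exists c, forall u v, B1 u -> B2 v -> `|b u v| <= c * (N1 u * N2 v) }.

Section BddBilin.
Context {R : realType} {V W : lmodType R} {B1 : set V} {N1 : V -> R}
  {B2 : set W} {N2 : W -> R} {b : V -> W -> R}.
Hypothesis bP : bdd_bilin B1 N1 B2 N2 b.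
Let s1 := bb_sub1 bP.
Let s2 := bb_sub2 bP.
Lemma bbDl u v w : B1 u -> B1 v -> B2 w -> b (u + v) w = b u w + b v w.
Proof.
by move=> Bu Bv Bw; rewrite -[u in LHS]scale1r (bb_linl bP)// mul1r.
Qed.
Lemma bb0l w : B2 w -> b 0 w = 0.
Proof.
move=> Bw; have B0 := subspace0 s1.
have := bbDl B0 B0 Bw; rewrite addr0 => /eqP.
by rewrite -{1}[b 0 w]addr0 (inj_eq (addrI _)) eq_sym => /eqP.
Qed.
Lemma bbZl a u w : B1 u -> B2 w -> b (a *: u) w = a * b u w.
Proof.
move=> Bu Bw; rewrite -[_ *: _]addr0 (bb_linl bP)//; last exact: subspace0.
by rewrite bb0l// addr0.
Qed.
Lemma bbBl u v w : B1 u -> B1 v -> B2 w -> b (u - v) w = b u w - b v w.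
Proof.
move=> Bu Bv Bw; rewrite bbDl//; last exact: subspaceN.
by rewrite -scaleN1r bbZl// mulN1r.
Qed.
Lemma bbDr u v w : B2 u -> B2 v -> B1 w -> b w (u + v) = b w u + b w v.
Proof.
by move=> Bu Bv Bw; rewrite -[u in LHS]scale1r (bb_linr bP)// mul1r.
Qed.
Lemma bb0r w : B1 w -> b w 0 = 0.
Proof.
move=> Bw; have B0 := subspace0 s2.
have := bbDr B0 B0 Bw; rewrite addr0 => /eqP.
by rewrite -{1}[b w 0]addr0 (inj_eq (addrI _)) eq_sym => /eqP.
Qed.
Lemma bbZr a u w : B2 u -> B1 w -> b w (a *: u) = a * b w u.
Proof.
move=> Bu Bw; rewrite -[_ *: _]addr0 (bb_linr bP)//; last exact: subspace0.
by rewrite bb0r// addr0.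
Qed.
Lemma bbBr u v w : B2 u -> B2 v -> B1 w -> b w (u - v) = b w u - b w v.
Proof.
move=> Bu Bv Bw; rewrite bbDr//; last exact: subspaceN.
by rewrite -scaleN1r bbZr// mulN1r.
Qed.
End BddBilin.

Lemma semi_ip_bdd (R : realType) (V : lmodType R) (B : set V) b :
  semi_ip B b -> bdd_bilin B (snorm b) B (snorm b) b.
Proof.
move=> bP; split; try exact: (sip_sub bP).
- exact: (sip_linl bP).
- move=> a u v w Bu Bv Bw; rewrite (sipDr bP) ?(sipZr bP)//.
  exact: subspaceZ (sip_sub bP) _ _ _.
- by exists 1 => u v Bu Bv; rewrite mul1r; apply: (sip_CS bP).
Qed.

(** * Limits and derivatives in time of bilinear expressions *)

Section BilinearLimits.
Context {R : realType}.
Variable T : R.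
Local Notation I := (`[0, T]%classic : set R).

(** Expansion around [t] leaves three terms, each with a factor [u s - u t] or [v s - v t]; [g] is
    the sum of their bounds. *)
Lemma bilin_cvg (V W : lmodType R) (B1 : set V) N1 (B2 : set W) N2 b u v t :
  bdd_bilin B1 N1 B2 N2 b -> is_C0 T B1 N1 u -> is_C0 T B2 N2 v -> I t ->
  b (u s) (v s) @[s --> within I (nbhs t)] --> b (u t) (v t).
Proof.
move=> bP uC vC It; have [c cP] := bb_bound bP.
have [But ut] := uC _ It; have [Bvt vt] := vC _ It.
have sI : \forall s \near within I (nbhs t), I s by apply: withinT; exact: filter0.
apply/cvgrPdist_le => e e0.
set g := fun s => `|c| * (`|N1 (u s - u t)| * `|N2 (v s - v t)| +
   (`|N1 (u s - u t)| * `|N2 (v t)| + `|N1 (u t)| * `|N2 (v s - v t)|)).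
have gc : g s @[s --> within I (nbhs t)] --> `|c| * (0 * 0 + (0 * `|N2 (v t)| + `|N1 (u t)| * 0)).
  have nu (h : R -> R) : h s @[s --> within I (nbhs t)] --> (0 : R) ->
      `|h s| @[s --> within I (nbhs t)] --> (0 : R).
    by move=> /cvg_norm; rewrite normr0.
  have n1 : `|N1 (u s - u t)| @[s --> within I (nbhs t)] --> (0 : R).
    exact: nu.
  have n2 : `|N2 (v s - v t)| @[s --> within I (nbhs t)] --> (0 : R).
    exact: nu.
  apply: cvgMr; apply: cvgD; first exact: cvgM.
  by apply: cvgD; [apply: cvgMl|apply: cvgMr].
rewrite !(mulr0, mul0r, addr0) in gc.
have : \forall s \near within I (nbhs t), `|0 - g s| <= e by move/cvgrPdist_le: gc; apply.
apply: filterS2 sI => s Is; rewrite sub0r normrN.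
have [Bus _] := uC _ Is; have [Bvs _] := vC _ Is.
move=> h; apply: le_trans h; rewrite distrC.
have D1 := subspaceB (bb_sub1 bP) Bus But; have D2 := subspaceB (bb_sub2 bP) Bvs Bvt.
have -> : b (u s) (v s) - b (u t) (v t) =
   b (u s - u t) (v s - v t) + (b (u s - u t) (v t) + b (u t) (v s - v t)).
  rewrite !(bbBl bP)// !(bbBr bP)//; ring.
apply: le_trans (ler_normD _ _) _.
have cb x y : B1 x -> B2 y -> `|b x y| <= `|c| * (`|N1 x| * `|N2 y|).
  move=> Bx By; apply: le_trans (cP _ _ Bx By) _.
  by rewrite -!normrM ler_norm.
apply: le_trans _ (ler_norm _); rewrite /g !mulrDr.
apply: lerD; first exact: cb.
by apply: le_trans (ler_normD _ _) _; apply: lerD; exact: cb.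
Qed.
End BilinearLimits.

Section TimeCalculus.
Context {R : realType}.
Variable T : R.
Local Notation I := (`[0, T]%classic : set R).

Definition contI (f : R -> R) := {within I, continuous f}.
(** One-sided at 0 and at [T]. The point [t] is removed because the quotient takes the value 0 there
    by the convention for inverses. *)
Definition derI (F g : R -> R) := forall t, I t ->
  (s - t)^-1 * (F s - F t) @[s --> within (I `\ t) (nbhs t)] --> g t.

Lemma contIP f : contI f <->
  forall t, I t -> f s @[s --> within I (nbhs t)] --> f t.
Proof. exact: subspace_continuousP. Qed.

Lemma contI_bilin (V W : lmodType R) (B1 : set V) N1 (B2 : set W) N2 b u v :
  bdd_bilin B1 N1 B2 N2 b -> is_C0 T B1 N1 u -> is_C0 T B2 N2 v ->
  contI (fun s => b (u s) (v s)).
Proof. by move=> bP uC vC; apply/contIP => t It; apply: bilin_cvg bP uC vC It. Qed.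

Lemma contID f g : contI f -> contI g -> contI (fun s => f s + g s).
Proof. by move=> /contIP fC /contIP gC; apply/contIP => t It; apply: cvgD; [exact: fC|exact: gC]. Qed.
Lemma contIN f : contI f -> contI (fun s => - f s).
Proof. by move=> /contIP fC; apply/contIP => t It; apply: cvgN; exact: fC. Qed.
Lemma contIM f g : contI f -> contI g -> contI (fun s => f s * g s).
Proof. by move=> /contIP fC /contIP gC; apply/contIP => t It; apply: cvgM; [exact: fC|exact: gC]. Qed.
Lemma contI_cst (c : R) : contI (fun=> c).
Proof. by apply/contIP => t It; exact: cvg_cst. Qed.
Lemma contIZ c f : contI f -> contI (fun s => c * f s).
Proof. by move=> fC; apply: contIM => //; exact: contI_cst. Qed.
Lemma contI_ext f g : (forall t, I t -> f t = g t) -> contI f -> contI g.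
Proof.
move=> fg /contIP fC; apply/contIP => t It; rewrite -fg//.
have := fC t It; apply: cvg_trans; apply: near_eq_cvg.
by near=> s; apply: fg; near: s; apply: withinT; exact: nbhs_filter.
Unshelve. all: by end_near. Qed.

Lemma contI_integrable f a b : 0 <= a -> b <= T -> contI f ->
  lebesgue_measure.-integrable `[a, b] (EFin \o f).
Proof.
move=> a0 bT fC; apply: continuous_compact_integrable; first exact: segment_compact.
by apply: continuous_subspaceW fC; apply: subset_itv; rewrite bnd_simp.
Qed.

(** At interior points the limit relative to [I] is two-sided, which is the form of derivative that
    the fundamental theorem of calculus uses. *)
Lemma derI_cvg_itv F g t : derI F g -> 0 < t < T ->
  h^-1 *: ((F \o shift t) (h *: 1) - F t) @[h --> (0 : R)^'] --> g t.
Proof.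
move=> dF /andP[t0 tT].
have It : I t by rewrite /= in_itv/= !ltW.
have H : (h *: 1 + t) @[h --> (0 : R)^'] --> within (I `\ t) (nbhs t).
  move=> A [e /= e0 eA].
  have : \forall h \near (0 : R)^', `|h| < Num.min e (Num.min t (T - t)).
    have m0 : 0 < Num.min e (Num.min t (T - t)) by rewrite !lt_min e0 t0 subr_gt0.
    by apply: dnbhs0_lt.
  have : \forall h \near (0 : R)^', h != 0 by apply: nbhs_dnbhs_neq.
  apply: filterS2 => h h0 /=; rewrite !lt_min => /and3P[he ht hT].
  have h1 : (h *: 1 : R) = h by rewrite [LHS]mulr1.
  apply: eA => /=.
    by rewrite h1 opprD addrCA subrr addr0 normrN.
  rewrite h1; split.
    rewrite in_itv/=; apply/andP; split.
      by have := ler_norm (- h); rewrite normrN; lra.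
    by have := ler_norm h; lra.
  by move/eqP; rewrite -subr_eq0 addrK (negPf h0).
have /= := cvg_comp _ _ H (dF t It).
apply: cvg_trans; apply: near_eq_cvg; near=> h => /=.
by rewrite addrK /GRing.scale /= mulr1.
Unshelve. all: by end_near. Qed.

Lemma FTC_I F g a b : contI F -> contI g -> derI F g ->
  0 <= a -> a <= b -> b <= T ->
  \int[lebesgue_measure]_(t in `[a, b]) g t = F b - F a.
Proof.
move=> cF cg dF a0; rewrite le_eqVlt => /predU1P[->|ab] bT.
  by rewrite set_itv1 Rintegral_set1 subrr.
have sab : `[a, b] `<=` I by apply: subset_itv; rewrite bnd_simp.
have sub x : x \in `]a, b[ -> 0 < x < T.
  by rewrite in_itv/= => /andP[ax xb]; rewrite (le_lt_trans a0 ax) (lt_le_trans xb bT).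
rewrite /Rintegral (@continuous_FTC2 _ g F a b)//.
- exact: continuous_subspaceW cg.
- have /(continuous_within_itvP _ ab)[_ Fa Fb] : {within `[a, b], continuous F}.
    exact: continuous_subspaceW cF.
  split => // x /sub xab; apply/cvg_ex; exists (g x); exact: derI_cvg_itv.
- move=> x /sub xab; rewrite derive1E; apply/cvg_lim; first exact: Rhausdorff.
  exact: derI_cvg_itv.
Qed.

(** Product rule. In terms of the errors [qu] and [qv] of the difference quotients, the total error
    is a sum of four products, each with a factor that tends to 0. *)
Lemma derI_bilin (V W : lmodType R) (B1 : set V) N1 (B2 : set W) N2 b u u' v v' :
  bdd_bilin B1 N1 B2 N2 b ->
  is_C0 T B1 N1 u -> is_C0 T B1 N1 u' -> has_tderiv T N1 u u' ->
  is_C0 T B2 N2 v -> is_C0 T B2 N2 v' -> has_tderiv T N2 v v' ->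
  derI (fun s => b (u s) (v s)) (fun s => b (u' s) (v s) + b (u s) (v' s)).
Proof.
move=> bP uC u'C du vC v'C dv t It.
have [s1 s2] := (bb_sub1 bP, bb_sub2 bP).
have [Bu uct] := uC _ It; have [Bu' _] := u'C _ It.
have [Bv vct] := vC _ It; have [Bv' _] := v'C _ It.
have [c cP] := bb_bound bP.
have cb x y : B1 x -> B2 y -> `|b x y| <= `|c| * (`|N1 x| * `|N2 y|).
  move=> Bx By; apply: le_trans (cP _ _ Bx By) _.
  by rewrite -!normrM ler_norm.
pose J := within (I `\ t) (nbhs t).
have FJ : Filter J by exact: within_filter.
have sJ : \forall s \near J, (I `\ t) s by apply: withinT.
have nu (h : R -> R) : h s @[s --> J] --> (0 : R) -> `|h s| @[s --> J] --> (0 : R).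
  by move=> /cvg_norm; rewrite normr0.
have JI (h : R -> R) : h s @[s --> within I (nbhs t)] --> (0 : R) -> h s @[s --> J] --> (0 : R).
  by apply: cvg_trans; apply: cvg_app; apply: within_subset => x [].
have du0 := nu _ (du _ It); have dv0 := nu _ (dv _ It).
have uc0 := nu _ (JI _ uct); have vc0 := nu _ (JI _ vct).
set qu := fun s => (s - t)^-1 *: (u s - u t) - u' t.
set qv := fun s => (s - t)^-1 *: (v s - v t) - v' t.
pose g s := `|c| * (`|N1 (qu s)| * `|N2 (v s - v t)| + (`|N1 (qu s)| * `|N2 (v t)|
   + (`|N1 (u' t)| * `|N2 (v s - v t)| + `|N1 (u t)| * `|N2 (qv s)|))).
have gc : g s @[s --> J] --> `|c| * (0 * 0 + (0 * `|N2 (v t)| + (`|N1 (u' t)| * 0 + `|N1 (u t)| * 0))).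
  apply: cvgMr; apply: cvgD; first exact: cvgM.
  apply: cvgD; first exact: cvgMl.
  by apply: cvgD; apply: cvgMr.
rewrite !(mulr0, mul0r, addr0) in gc.
apply/cvgrPdist_le => e e0.
have : \forall s \near J, `|0 - g s| <= e by move/cvgrPdist_le: gc; apply.
apply: filterS2 sJ => s [Is /eqP st]; rewrite sub0r normrN => h; apply: le_trans h.
have [Bus _] := uC _ Is; have [Bvs _] := vC _ Is.
have Du := subspaceB s1 Bus Bu; have Dv := subspaceB s2 Bvs Bv.
have Bqu : B1 (qu s) by apply: subspaceB => //; exact: subspaceZ.
have Bqv : B2 (qv s) by apply: subspaceB => //; exact: subspaceZ.
have st0 : s - t != 0 by rewrite subr_eq0.
rewrite distrC.
have -> : (s - t)^-1 * (b (u s) (v s) - b (u t) (v t)) -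
    (b (u' t) (v t) + b (u t) (v' t)) =
   b (qu s) (v s - v t) + (b (qu s) (v t) + (b (u' t) (v s - v t) + b (u t) (qv s))).
  rewrite !(bbBl bP) ?(bbZl bP) ?(bbBl bP) ?(bbBr bP) ?(bbZr bP) ?(bbBr bP) ?(bbBl bP)//;
   try exact: subspaceZ.
  by field.
apply: le_trans _ (ler_norm _); rewrite /g !mulrDr.
do 3 (apply: le_trans (ler_normD _ _) _; apply: lerD; first exact: cb).
exact: cb.
Qed.

Lemma is_C0_sub (V : lmodType R) (B B' : set V) N u :
  (forall t, I t -> B (u t) -> B' (u t)) -> is_C0 T B N u -> is_C0 T B' N u.
Proof. by move=> BB uC t It; have [? ?] := uC t It; split=> //; apply: BB. Qed.

End TimeCalculus.

(** * Integrals under hypotheses that hold almost everywhere *)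

Section RealIntegral.
Context {dd : measure_display} {Y : measurableType dd} {R : realType}.
Variables (mu : {measure set Y -> \bar R}) (D : set Y).
Hypothesis mD : measurable D.

Lemma Rint_ae_eq (f g : Y -> R) : measurable_fun D f -> measurable_fun D g ->
  {ae mu, forall x, D x -> f x = g x} ->
  \int[mu]_(x in D) f x = \int[mu]_(x in D) g x.
Proof.
move=> mf mg fg; congr fine; apply: ae_eq_integral => //.
- exact/measurable_EFinP.
- exact/measurable_EFinP.
- by apply: filterS fg => x /= fg Dx; rewrite fg.
Qed.

(** The positive part of [f] has the same integral and is non-negative everywhere. *)
Lemma Rint_ae_ge0 (f : Y -> R) : measurable_fun D f ->
  {ae mu, forall x, D x -> 0 <= f x} -> 0 <= \int[mu]_(x in D) f x.
Proof.
move=> mf f0; rewrite (@Rint_ae_eq f (fun x => Num.max (f x) 0))//.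
- by apply: Rintegral_ge0 => x _; rewrite le_max lexx orbT.
- by apply: measurable_maxr => //; exact: measurable_cst.
- by apply: filterS f0 => x /= f0 Dx; rewrite max_l// f0.
Qed.

Lemma Rint_ae_le (f g : Y -> R) : mu.-integrable D (EFin \o f) ->
  mu.-integrable D (EFin \o g) -> {ae mu, forall x, D x -> f x <= g x} ->
  \int[mu]_(x in D) f x <= \int[mu]_(x in D) g x.
Proof.
move=> fi gi fg; rewrite -subr_ge0 -RintegralB//; apply: Rint_ae_ge0.
  have /measurable_EFinP mf := measurable_int mu fi.
  have /measurable_EFinP mg := measurable_int mu gi.
  exact: measurable_funB.
by apply: filterS fg => x /= fg Dx; rewrite subr_ge0 fg.
Qed.

Lemma integrable_ae_le (f g : Y -> R) : measurable_fun D f ->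
  mu.-integrable D (EFin \o g) -> {ae mu, forall x, D x -> `|f x| <= g x} ->
  mu.-integrable D (EFin \o f).
Proof.
move=> mf gi fg; apply/integrableP; split; first exact/measurable_EFinP.
have /integrableP[mg glt] := gi.
apply: le_lt_trans glt.
apply: (@ae_ge0_le_integral _ _ _ mu D mD (fun x => `|(f x)%:E|%E) (fun x => `|(g x)%:E|%E)).
- by move=> x Dx; exact: abse_ge0.
- by apply: measurableT_comp => //; exact/measurable_EFinP.
- by move=> x Dx; exact: abse_ge0.
- exact: measurableT_comp.
- by apply: filterS fg => x /= fg Dx; rewrite lee_fin (le_trans (fg Dx))// ler_norm.
Qed.

Lemma integrable_le (f g : Y -> R) : measurable_fun D f ->
  mu.-integrable D (EFin \o g) -> (forall x, D x -> `|f x| <= g x) ->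
  mu.-integrable D (EFin \o f).
Proof. by move=> mf gi fg; apply: integrable_ae_le gi _ => //; exact: aeW. Qed.

Lemma integrable_mulr_sqr (f g : Y -> R) : measurable_fun D f -> measurable_fun D g ->
  mu.-integrable D (EFin \o (fun x => f x ^+ 2)) ->
  mu.-integrable D (EFin \o (fun x => g x ^+ 2)) ->
  mu.-integrable D (EFin \o (fun x => f x * g x)).
Proof.
move=> mf mg fi gi; apply: (@integrable_le _ (fun x => f x ^+ 2 + g x ^+ 2)).
- exact: measurable_funM.
- exact: (integrableD mD fi gi).
- move=> x _; rewrite ler_norml; apply/andP; split; nra.
Qed.
End RealIntegral.

(** * L^2 products of scalar, vector and matrix fields *)

Section SemiIpConstructions.
Context {R : realType}.

(** The products of vector and matrix fields are finite sums of pull-backs of the scalar L^2 product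
    along the components. *)
Lemma semi_ip_pull (V W : lmodType R) (B : set V) (B' : set W) (b : W -> W -> R)
    (f : V -> W) : linsub B -> (forall u, B u -> B' (f u)) ->
  (forall a u v, f (a *: u + v) = a *: f u + f v) -> semi_ip B' b ->
  semi_ip B (fun u v => b (f u) (f v)).
Proof.
move=> sB fB fl bP; split; first exact: sB.
- by move=> a u v w Bu Bv Bw; rewrite fl (sip_linl bP)//; exact: fB.
- by move=> u v Bu Bv; apply: (sip_sym bP); exact: fB.
- by move=> u Bu; apply: (sip_ge0 bP); exact: fB.
Qed.

Lemma semi_ip_sum (V : lmodType R) (B : set V) n (b : 'I_n -> V -> V -> R) :
  linsub B -> (forall i, semi_ip B (b i)) -> semi_ip B (fun u v => \sum_i b i u v).
Proof.
move=> sB bP; split; first exact: sB.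
- move=> a u v w Bu Bv Bw; rewrite mulr_sumr -big_split/=; apply: eq_bigr => i _.
  exact: (sip_linl (bP i)).
- by move=> u v Bu Bv; apply: eq_bigr => i _; exact: (sip_sym (bP i)).
- by move=> u Bu; apply: sumr_ge0 => i _; exact: (sip_ge0 (bP i)).
Qed.

(** Agreement is asked on [B] only: the integral of a sum over components splits only if these are
    square integrable. *)
Lemma semi_ip_ext (V : lmodType R) (B : set V) (b b' : V -> V -> R) :
  (forall u v, B u -> B v -> b u v = b' u v) -> semi_ip B b -> semi_ip B b'.
Proof.
move=> bb bP; have sB := sip_sub bP; split; first exact: sB.
- move=> a u v w Bu Bv Bw; rewrite -!bb//; first exact: (sip_linl bP).
  exact: sB.2.
- by move=> u v Bu Bv; rewrite -!bb//; exact: (sip_sym bP).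
- by move=> u Bu; rewrite -!bb//; exact: (sip_ge0 bP).
Qed.

Lemma semi_ipD (V : lmodType R) (B : set V) (b b' : V -> V -> R) :
  semi_ip B b -> semi_ip B b' -> semi_ip B (fun u v => b u v + b' u v).
Proof.
move=> bP bP'; split; first exact: (sip_sub bP).
- move=> a u v w Bu Bv Bw; rewrite (sip_linl bP)// (sip_linl bP')//; ring.
- by move=> u v Bu Bv; rewrite (sip_sym bP)// (sip_sym bP').
- by move=> u Bu; apply: addr_ge0; [exact: (sip_ge0 bP)|exact: (sip_ge0 bP')].
Qed.
End SemiIpConstructions.

Section L2.
Context {R : realType} {d : nat}.
Local Notation X := 'rV[R]_d.
Variables (mu : {measure set X -> \bar R}) (D : set X).
Hypothesis mD : measurable D.
Local Notation L2 := (L2 mu D).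
Local Notation ip := (ip mu D).

Lemma L2_mul (f g : X -> R) : L2 f -> L2 g ->
  mu.-integrable D (EFin \o (fun x => f x * g x)).
Proof. by move=> [mf fi] [mg gi]; exact: integrable_mulr_sqr. Qed.

Lemma L2_measurable (f : X -> R) : L2 f -> measurable_fun D f. Proof. by case. Qed.

Lemma L2_linsub : linsub (L2 : set (X -> R^o)).
Proof.
split.
  split; first exact: measurable_cst.
  apply: (eq_integrable mD (cst 0%E)); last exact: integrable0.
  by move=> x _ /=; rewrite expr0n.
move=> a u v [mu0 ui] [mv vi]; split.
  by apply: measurable_funD => //; exact: measurable_funM.
apply: (@integrable_le _ _ _ mu D mD _ (fun x => 2 * a ^+ 2 * u x ^+ 2 + 2 * v x ^+ 2)).
- apply: measurable_funX; apply: measurable_funD => //; exact: measurable_funM.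
- exact: (integrableD mD (integrableZl mD _ ui) (integrableZl mD _ vi)).
- move=> x _; rewrite ger0_norm ?sqr_ge0//.
  have -> : ((a *: u + v) x) = a * u x + v x by [].
  by have := sqr_ge0 (a * u x - v x); nra.
Qed.

Lemma ip_semi : semi_ip (L2 : set (X -> R^o)) ip.
Proof.
split; first exact: L2_linsub.
- move=> a u v w Lu Lv Lw; rewrite /Defs.ip -RintegralZl//; last exact: L2_mul.
  rewrite -RintegralD//; last exact: L2_mul.
    by apply: eq_Rintegral => x _; rewrite /= mulrA -mulrDl.
  apply: (integrableZl mD a (L2_mul Lu Lw)).
- by move=> u v _ _; apply: eq_Rintegral => x _; rewrite mulrC.
- by move=> u _; apply: Rintegral_ge0 => x _; rewrite -expr2 sqr_ge0.
Qed.

Lemma nrmE (f : X -> R) : nrm mu D f = snorm ip f. Proof. by []. Qed.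

Lemma nrm_ae0 (f : X -> R) : measurable_fun D f ->
  {ae mu, forall x, D x -> f x = 0} -> nrm mu D f = 0.
Proof.
move=> mf f0; rewrite /nrm /Defs.ip (@Rint_ae_eq _ _ _ _ _ mD _ (cst 0)).
- by rewrite Rintegral_cst// mul0r sqrtr0.
- exact: measurable_funM.
- exact: measurable_cst.
- by apply: filterS f0 => x /= f0 Dx; rewrite f0// mul0r.
Qed.

Lemma L2_ae (f g : X -> R) : L2 f -> measurable_fun D g ->
  {ae mu, forall x, D x -> f x = g x} -> L2 g.
Proof.
move=> [mf fi] mg fg; split => //; apply: (integrable_ae_le mD _ fi).
  exact: measurable_funX.
by apply: filterS fg => x /= fg Dx; rewrite -fg// ger0_norm ?sqr_ge0.
Qed.

Lemma nrm_ae_eq (f g : X -> R^o) : L2 f -> L2 g ->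
  {ae mu, forall x, D x -> f x = g x} -> nrm mu D (f - g) = 0.
Proof.
move=> Lf Lg fg; apply: nrm_ae0.
  exact: (L2_measurable (subspaceB L2_linsub Lf Lg)).
by apply: filterS fg => x /= fg Dx; rewrite fctE fg// subrr.
Qed.

Lemma nrm0_eq (f g : X -> R^o) : L2 f -> L2 g -> nrm mu D (f - g) = 0 ->
  nrm mu D f = nrm mu D g.
Proof.
move=> Lf Lg fg; apply/eqP; rewrite -subr_eq0 -normr_le0 -fg.
exact: (snorm_dist ip_semi).
Qed.

Lemma ip_ae_l (f g h : X -> R^o) : L2 f -> L2 g -> L2 h ->
  {ae mu, forall x, D x -> f x = g x} -> ip f h = ip g h.
Proof.
move=> Lf Lg Lh /(nrm_ae_eq Lf Lg) h0; apply/eqP; rewrite -subr_eq0.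
rewrite -(sipBl ip_semi)//; apply/eqP; apply: (snorm0P ip_semi) => //.
exact: (subspaceB L2_linsub).
Qed.

Lemma nrm0_ae (f : X -> R) : L2 f -> nrm mu D f = 0 ->
  {ae mu, forall x, D x -> f x = 0}.
Proof.
move=> Lf; have /(_ Lf) f2 := @L2_mul f f Lf.
move/eqP; rewrite sqrtr_eq0 => le0.
(* Integrability matters here, since [fine] also sends an infinite integral to 0. *)
have i0 : (\int[mu]_(x in D) (f x * f x)%:E = 0)%E.
  have /fineK <- : (\int[mu]_(x in D) (f x * f x)%:E)%E \is a fin_num.
    exact: (integrable_fin_num mD f2).
  by congr EFin; apply/eqP; rewrite eq_le le0 /=; exact: (sip_ge0 ip_semi Lf).
have mf2 : measurable_fun D (fun x => (f x * f x)%:E) by exact: (measurable_int mu f2).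
have /(ae_eq_integral_abs mu mD mf2) : (\int[mu]_(x in D) `|(f x * f x)%:E| = 0)%E.
  by rewrite -[RHS]i0; apply: eq_integral => x _; rewrite gee0_abs// lee_fin -expr2 sqr_ge0.
by apply: filterS => x /= h Dx; have /eqP := h Dx; rewrite eqe mulf_eq0 orbb => /eqP.
Qed.

Lemma Linf_mul_L2 (h f : X -> R) : Linf mu D h -> L2 f -> L2 (fun x => h x * f x).
Proof.
move=> [mh [M hM]] [mf fi]; split; first exact: measurable_funM.
apply: (@integrable_ae_le _ _ _ mu D mD _ (fun x => M ^+ 2 * f x ^+ 2)).
- by apply: measurable_funX; exact: measurable_funM.
- exact: (integrableZl mD _ fi).
- apply: filterS hM => x /= hM Dx; rewrite ger0_norm ?sqr_ge0// exprMn.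
  apply: ler_wpM2r; first exact: sqr_ge0.
  rewrite -[h x ^+ 2]ger0_norm ?sqr_ge0// normrX ler_sqr ?nnegrE//; first exact: hM.
  exact: le_trans (hM Dx).
Qed.

Lemma ip_weight_semi (h : X -> R) : Linf mu D h ->
  {ae mu, forall x, D x -> 0 <= h x} ->
  semi_ip (L2 : set (X -> R^o)) (fun f g => ip (fun x => h x * f x) g).
Proof.
move=> hL h0; split; first exact: L2_linsub.
- move=> a u v w Lu Lv Lw.
  rewrite -(sip_linl ip_semi) //; try exact: Linf_mul_L2.
  by congr Defs.ip; apply/funext => x; rewrite !fctE /GRing.scale/=; ring.
- by move=> u v _ _; apply: eq_Rintegral => x _; ring.
- move=> u Lu; apply: Rint_ae_ge0 => //.
    apply: measurable_funM; last exact: L2_measurable.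
    exact: (L2_measurable (Linf_mul_L2 hL Lu)).
  by apply: filterS h0 => x /= h0 Dx; rewrite -mulrA -expr2 mulr_ge0 ?sqr_ge0// h0.
Qed.

Lemma ip_weight_le (h : X -> R) M : Linf mu D h ->
  {ae mu, forall x, D x -> `|h x| <= M} -> forall f, L2 f ->
  ip (fun x => h x * f x) f <= M * ip f f.
Proof.
move=> hL hM f Lf; rewrite /Defs.ip -RintegralZl//; last exact: L2_mul.
apply: Rint_ae_le => //.
- exact: (L2_mul (Linf_mul_L2 hL Lf) Lf).
- exact: (integrableZl mD _ (L2_mul Lf Lf)).
apply: filterS hM => x /= hM Dx; rewrite -mulrA; apply: ler_wpM2r.
  by rewrite -expr2 sqr_ge0.
by apply: le_trans (hM Dx); exact: ler_norm.
Qed.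

Definition L2m (A : X -> 'M[R]_d) := forall i j, L2 (fun x => A x i j).

Lemma L2v_linsub : linsub (L2v mu D).
Proof.
split=> [i|a u v Lu Lv i].
  have -> : (fun x => (0 : X -> X) x 0 i) = (0 : X -> R^o) by apply/funext => x; rewrite mxE.
  exact: (subspace0 L2_linsub).
have -> : (fun x => (a *: u + v) x 0 i) = (a *: (fun x => u x 0 i : R^o) + (fun x => v x 0 i)).
  by apply/funext => x; rewrite !mxE.
exact: L2_linsub.2.
Qed.

Lemma L2m_linsub : linsub L2m.
Proof.
split=> [i j|a u v Lu Lv i j].
  have -> : (fun x => (0 : X -> 'M[R]_d) x i j) = (0 : X -> R^o) by apply/funext => x; rewrite mxE.
  exact: (subspace0 L2_linsub).
have -> : (fun x => (a *: u + v) x i j) = (a *: (fun x => u x i j : R^o) + (fun x => v x i j)).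
  by apply/funext => x; rewrite !mxE.
exact: L2_linsub.2.
Qed.

Lemma Rint_sum n (f : 'I_n -> X -> R) :
  (forall i, mu.-integrable D (EFin \o f i)) ->
  mu.-integrable D (EFin \o (fun x => \sum_i f i x)) /\
  \int[mu]_(x in D) (\sum_i f i x) = \sum_i \int[mu]_(x in D) f i x.
Proof.
elim: n f => [|n IH] f fi.
  split.
    apply: (eq_integrable mD (cst 0%E)); last exact: integrable0.
    by move=> x _ /=; rewrite big_ord0.
  rewrite big_ord0 (@eq_Rintegral _ _ _ mu D (cst 0)); first by rewrite Rintegral_cst// mul0r.
  by move=> x _; rewrite big_ord0.
have [i1 e1] := IH (fun i => f (lift ord0 i)) (fun i => fi _).
split.
  apply: (eq_integrable mD _ _ _ (integrableD mD (fi ord0) i1)).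
  by move=> x _ /=; rewrite big_ord_recl.
rewrite big_ord_recl -e1 -RintegralD//.
by apply: eq_Rintegral => x _; rewrite big_ord_recl.
Qed.

Lemma ipvE (u v : X -> X) : L2v mu D u -> L2v mu D v ->
  ipv mu D u v = \sum_i ip (fun x => u x 0 i) (fun x => v x 0 i).
Proof.
by move=> Lu Lv; apply: (Rint_sum (f := fun i x => u x 0 i * v x 0 i) _).2 => i; exact: L2_mul.
Qed.

Lemma ipmE (u v : X -> 'M[R]_d) : L2m u -> L2m v ->
  ipm mu D u v = \sum_i \sum_j ip (fun x => u x i j) (fun x => v x i j).
Proof.
move=> Lu Lv; have H i := Rint_sum (f := fun j x => u x i j * v x i j) (fun j => L2_mul (Lu i j) (Lv i j)).
rewrite /ipm (Rint_sum (f := fun i x => \sum_j u x i j * v x i j) _).2 => [|i].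
  by apply: eq_bigr => i _; exact: (H i).2.
exact: (H i).1.
Qed.

Lemma ipv_semi : semi_ip (L2v mu D) (ipv mu D).
Proof.
suff H : semi_ip (L2v mu D) (fun u v => \sum_i ip (fun x => u x 0 i) (fun x => v x 0 i)).
  by apply: semi_ip_ext H => u v Lu Lv; rewrite ipvE.
apply: semi_ip_sum => [|i]; first exact: L2v_linsub.
apply: (semi_ip_pull (V := X -> X) (W := X -> R^o) (B' := L2) (b := ip) (f := fun u x => u x 0 i)).
- exact: L2v_linsub.
- by move=> u; apply.
- by move=> a u v; apply/funext => x; rewrite !mxE.
- exact: ip_semi.
Qed.

Lemma ipm_semi : semi_ip L2m (ipm mu D).
Proof.
suff H : semi_ip L2m (fun u v => \sum_i \sum_j ip (fun x => u x i j) (fun x => v x i j)).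
  by apply: semi_ip_ext H => u v Lu Lv; rewrite ipmE.
apply: semi_ip_sum => [|i]; first exact: L2m_linsub.
apply: semi_ip_sum => [|j]; first exact: L2m_linsub.
apply: (semi_ip_pull (V := X -> 'M[R]_d) (W := X -> R^o) (B' := L2) (b := ip) (f := fun u x => u x i j)).
- exact: L2m_linsub.
- by move=> u; apply.
- by move=> a u v; apply/funext => x; rewrite !mxE.
- exact: ip_semi.
Qed.

End L2.

(** * Bounded bilinear forms with essentially bounded coefficients *)

Section BddBilinConstructions.
Context {R : realType}.

Lemma bdd_bilin_ext (V W : lmodType R) B1 N1 B2 N2 (b b' : V -> W -> R) :
  (forall u v, B1 u -> B2 v -> b u v = b' u v) ->
  bdd_bilin B1 N1 B2 N2 b -> bdd_bilin B1 N1 B2 N2 b'.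
Proof.
move=> bb bP; have [s1 s2] := (bb_sub1 bP, bb_sub2 bP); split; first exact: s1.
- exact: s2.
- by move=> a u v w Bu Bv Bw; rewrite -!bb//; [exact: (bb_linl bP)|exact: s1.2].
- by move=> a u v w Bu Bv Bw; rewrite -!bb//; [exact: (bb_linr bP)|exact: s2.2].
- by have [c cP] := bb_bound bP; exists c => u v Bu Bv; rewrite -bb//; exact: cP.
Qed.

Lemma bdd_bilin_sum (V W : lmodType R) B1 N1 B2 N2 n (b : 'I_n -> V -> W -> R) :
  linsub B1 -> linsub B2 -> (forall i, bdd_bilin B1 N1 B2 N2 (b i)) ->
  bdd_bilin B1 N1 B2 N2 (fun u v => \sum_i b i u v).
Proof.
move=> s1 s2 bP; split; first exact: s1.
- exact: s2.
- move=> a u v w Bu Bv Bw; rewrite mulr_sumr -big_split/=; apply: eq_bigr => i _.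
  exact: (bb_linl (bP i)).
- move=> a u v w Bu Bv Bw; rewrite mulr_sumr -big_split/=; apply: eq_bigr => i _.
  exact: (bb_linr (bP i)).
- have /choice [c cP] : forall i, exists c, forall u v, B1 u -> B2 v -> `|b i u v| <= c * (N1 u * N2 v).
    by move=> i; exact: (bb_bound (bP i)).
  exists (\sum_i c i) => u v Bu Bv; rewrite mulr_suml.
  by apply: le_trans (ler_norm_sum _ _ _) _; apply: ler_sum => i _; exact: cP.
Qed.

(** Together with [bdd_bilin_sum] this reduces the boundedness of the forms of the problem, sums of
    weighted products of components, to that of one weighted L^2 product. *)
Lemma bdd_bilin_pull (V W V' W' : lmodType R) (B1 : set V) N1 (B2 : set W) N2
    (B1' : set V') N1' (B2' : set W') N2' (b : V' -> W' -> R) (f : V -> V') (g : W -> W') :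
  linsub B1 -> linsub B2 ->
  (forall u, B1 u -> [/\ B1' (f u), 0 <= N1' (f u) & N1' (f u) <= N1 u]) ->
  (forall u, B2 u -> [/\ B2' (g u), 0 <= N2' (g u) & N2' (g u) <= N2 u]) ->
  (forall a u v, f (a *: u + v) = a *: f u + f v) ->
  (forall a u v, g (a *: u + v) = a *: g u + g v) ->
  bdd_bilin B1' N1' B2' N2' b ->
  bdd_bilin B1 N1 B2 N2 (fun u v => b (f u) (g v)).
Proof.
move=> s1 s2 fB gB fl gl bP; split; first exact: s1.
- exact: s2.
- move=> a u v w /fB[Bu _ _] /fB[Bv _ _] /gB[Bw _ _]; rewrite fl.
  exact: (bb_linl bP).
- move=> a u v w /gB[Bu _ _] /gB[Bv _ _] /fB[Bw _ _]; rewrite gl.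
  exact: (bb_linr bP).
- have [c cP] := bb_bound bP; exists `|c| => u v /fB[Bu u0 uN] /gB[Bv v0 vN].
  apply: le_trans (cP _ _ Bu Bv) _; apply: le_trans (ler_norm _) _.
  rewrite normrM; apply: ler_wpM2l; first exact: normr_ge0.
  by rewrite ger0_norm ?mulr_ge0//; apply: ler_pM.
Qed.

Lemma bdd_bilinW (V W : lmodType R) (B1 B1' : set V) N1 (B2 B2' : set W) N2 (b : V -> W -> R) :
  linsub B1' -> linsub B2' -> B1' `<=` B1 -> B2' `<=` B2 ->
  bdd_bilin B1 N1 B2 N2 b -> bdd_bilin B1' N1 B2' N2 b.
Proof.
move=> s1 s2 i1 i2 bP; split; first exact: s1.
- exact: s2.
- by move=> a u v w /i1 Bu /i1 Bv /i2 Bw; exact: (bb_linl bP).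
- by move=> a u v w /i2 Bu /i2 Bv /i1 Bw; exact: (bb_linr bP).
- by have [c cP] := bb_bound bP; exists c => u v /i1 Bu /i2 Bv; exact: cP.
Qed.

Lemma semi_ipW (V : lmodType R) (B B' : set V) b :
  linsub B' -> B' `<=` B -> semi_ip B b -> semi_ip B' b.
Proof.
move=> s' i bP; split; first exact: s'.
- by move=> a u v w /i Bu /i Bv /i Bw; exact: (sip_linl bP).
- by move=> u v /i Bu /i Bv; exact: (sip_sym bP).
- by move=> u /i Bu; exact: (sip_ge0 bP).
Qed.
End BddBilinConstructions.

Section L2Weights.
Context {R : realType} {d : nat}.
Local Notation X := 'rV[R]_d.
Variables (mu : {measure set X -> \bar R}) (D : set X).
Hypothesis mD : measurable D.
Local Notation L2 := (L2 mu D).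
Local Notation ip := (ip mu D).

Lemma nrm_weight (h : X -> R) : Linf mu D h -> exists2 M, 0 <= M &
  forall f, L2 f -> nrm mu D (fun x => h x * f x) <= M * nrm mu D f.
Proof.
move=> hL; have [mh [M hM]] := hL.
have h2L : Linf mu D (fun x => h x ^+ 2).
  split; first exact: measurable_funX.
  exists (M ^+ 2); apply: filterS hM => x /= hM Dx.
  rewrite normrX ler_sqr ?nnegrE//; first exact: hM.
  exact: le_trans (hM Dx).
have [_ [M2 hM2]] := h2L.
exists (Num.sqrt `|M2|) => [|f Lf]; first exact: sqrtr_ge0.
rewrite /nrm -sqrtrM ?normr_ge0//; apply: ler_wsqrtr.
have -> : ip (fun x => h x * f x) (fun x => h x * f x) = ip (fun x => h x ^+ 2 * f x) f.
  by apply: eq_Rintegral => x _; ring.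
apply: ip_weight_le => //.
by apply: filterS hM2 => x /= hM2 Dx; apply: le_trans (hM2 Dx) _; exact: ler_norm.
Qed.

Lemma weight_bdd (h : X -> R) : Linf mu D h ->
  bdd_bilin (L2 : set (X -> R^o)) (nrm mu D) (L2 : set (X -> R^o)) (nrm mu D)
    (fun f g => ip (fun x => h x * f x) g).
Proof.
move=> hL; have iP := ip_semi mu mD; split; first exact: (sip_sub iP).
- exact: (sip_sub iP).
- move=> a u v w Lu Lv Lw; rewrite -(sip_linl iP) //; try exact: Linf_mul_L2.
  by congr Defs.ip; apply/funext => x; rewrite !fctE /GRing.scale/=; ring.
- move=> a u v w Lu Lv Lw; have Lhw := Linf_mul_L2 mD hL Lw.
  rewrite (sipDr iP) ?(sipZr iP)//.
  exact: subspaceZ (sip_sub iP) _ _ _.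
- have [M M0 MP] := nrm_weight hL; exists M => f g Lf Lg.
  apply: le_trans (sip_CS iP (Linf_mul_L2 mD hL Lf) Lg) _.
  by rewrite mulrA; apply: ler_wpM2r; [exact: snorm_ge0|exact: MP].
Qed.

Lemma nrm_le_vec (v : X -> X) i : L2v mu D v ->
  nrm mu D (fun x => v x 0 i) <= snorm (ipv mu D) v.
Proof.
move=> Lv; apply: ler_wsqrtr; rewrite (ipvE mD)// (bigD1 i)//= lerDl.
by apply: sumr_ge0 => j _; exact: (sip_ge0 (ip_semi mu mD)).
Qed.

Lemma nrm_le_mx (A : X -> 'M[R]_d) i j : L2m mu D A ->
  nrm mu D (fun x => A x i j) <= snorm (ipm mu D) A.
Proof.
move=> LA; apply: ler_wsqrtr; rewrite (ipmE mD)// (bigD1 i)//= (bigD1 j)//= -addrA lerDl.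
apply: addr_ge0; first by apply: sumr_ge0 => k _; exact: (sip_ge0 (ip_semi mu mD)).
apply: sumr_ge0 => k _; apply: sumr_ge0 => l _; exact: (sip_ge0 (ip_semi mu mD)).
Qed.

Lemma L2_sum n (f : 'I_n -> X -> R) : (forall i, L2 (f i)) -> L2 (fun x => \sum_i f i x).
Proof.
move=> Lf; have := subspace_sum (L2_linsub mu mD) (u := fun i => (f i : X -> R^o)) Lf.
by rewrite (_ : \sum_i _ = (fun x => \sum_i f i x))//; apply/funext => x; rewrite fct_sumE.
Qed.

Lemma ip_suml n (f : 'I_n -> X -> R) (g : X -> R) : (forall i, L2 (f i)) -> L2 g ->
  ip (fun x => \sum_i f i x) g = \sum_i ip (f i) g.
Proof.
move=> Lf Lg; transitivity (\int[mu]_(x in D) \sum_i f i x * g x).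
  by apply: eq_Rintegral => x _; rewrite mulr_suml.
by apply: (Rint_sum mD _).2 => i; exact: L2_mul.
Qed.

End L2Weights.

(** * Sobolev spaces on a bounded open set *)

Section SobolevSpaces.
Context {R : realType} {d : nat}.
Local Notation X := 'rV[R]_d.
Implicit Types (mu : {measure set X -> \bar R}) (Om : set X).

Lemma open_measurable_rV (O : set X) : open O -> measurable O.
Proof. by move=> oO; apply: sub_sigma_algebra. Qed.

Lemma bdry_measurable Om : open Om -> measurable (bdry Om).
Proof.
move=> oOm; apply: measurableD; last exact: open_measurable_rV.
rewrite -[closure Om]setCK; apply: measurableC; apply: open_measurable_rV.
by rewrite openC; exact: closed_closure.
Qed.

Lemma continuous_measurable_rV Om (f : X -> R) : measurable Om -> continuous f -> measurable_fun Om f.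
Proof.
move=> mOm fC; apply: (measurability _ (RGenOInfty.measurableE R)).
move=> _ [_ [a ->] <-]; apply: measurableI => //; apply: open_measurable_rV.
move/continuousP: fC => /(_ `]a, +oo[%classic); apply; exact: interval_open.
Qed.

Lemma continuous_bounded_rV Om (f : X -> R) : bounded_set Om -> continuous f ->
  exists M, forall x, Om x -> `|f x| <= M.
Proof.
move=> [M [Mr MP]] fC.
pose B := closed_ball_ Num.norm (0 : X) (M + 1).
have cB : compact B.
  apply: bounded_closed_compact; last exact: closed_closed_ball_.
  exists (M + 1); split; first by rewrite num_real.
  by move=> N MN x /=; rewrite /B /closed_ball_/= sub0r normrN => h; apply: le_trans h (ltW MN).
have : bounded_set (f @` B).
  by apply: compact_bounded; apply: continuous_compact => //; exact: continuous_subspaceT.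
move=> [N [Nr NP]]; exists (N + 1) => x Omx; apply: (NP (N + 1)); first by rewrite ltrDl.
exists x => //; rewrite /B /closed_ball_/= sub0r normrN; apply: (MP (M + 1)) => //.
by rewrite ltrDl.
Qed.

Section Fixed.
Variables (mu : {measure set X -> \bar R}) (Om : set X).
Hypotheses (oOm : open Om) (bOm : bounded_set Om) (L1 : L2 mu Om (fun=> 1)).
Let mOm := open_measurable_rV oOm.

(** [L1] expresses that the domain has finite measure, and [f] is bounded on it because the domain
    lies in a compact ball. *)
Lemma L2_continuous (f : X -> R) : continuous f -> L2 mu Om f.
Proof.
move=> fC; have mf := continuous_measurable_rV mOm fC; split => //.
have [M fM] := continuous_bounded_rV bOm fC.
apply: (@integrable_le _ _ _ mu Om mOm _ (fun x => M ^+ 2 * 1 ^+ 2)).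
- exact: measurable_funX.
- exact: (integrableZl mOm (M ^+ 2) L1.2).
- move=> x Omx; rewrite expr1n mulr1 ger0_norm ?sqr_ge0//.
  by rewrite -[f x ^+ 2]ger0_norm ?sqr_ge0// normrX ler_sqr ?nnegrE ?(le_trans _ (fM x Omx))// fM.
Qed.

(** Test functions and their partial derivatives are continuous on the whole space, hence in L^2 of
    the domain; so both sides of the identity that defines the weak gradient are linear. *)
Lemma H1_linsub : linsub (H1 mu Om).
Proof.
have sL := L2_linsub mu mOm; have iP := ip_semi mu mOm.
split.
  split; first exact: (subspace0 sL).
    exact: (subspace0 (L2v_linsub mu mOm)).
  move=> phi [ph _] i; have Lp : L2 mu Om (partial i phi).
    by apply: L2_continuous; exact: (ph [:: i]).1.
  have Lph : L2 mu Om phi by apply: L2_continuous; exact: (ph [::]).1.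
  rewrite (sip0l iP)// (_ : (fun x => (0 : sfield R d).2 x 0 i) = (0 : X -> R^o)).
    by rewrite (sip0l iP)// oppr0.
  by apply/funext => x; rewrite mxE.
move=> a u v [Lu Lu2 wu] [Lv Lv2 wv]; split; first exact: sL.2.
  exact: (L2v_linsub mu mOm).2.
move=> phi tphi i; have [ph _] := tphi.
have Lp : L2 mu Om (partial i phi).
  by apply: L2_continuous; exact: (ph [:: i]).1.
have Lph : L2 mu Om phi by apply: L2_continuous; exact: (ph [::]).1.
have -> : (fun x => (a *: u + v).2 x 0 i) = (a *: (fun x => u.2 x 0 i : R^o) + (fun x => v.2 x 0 i)).
  by apply/funext => x; rewrite !mxE.
rewrite (sip_linl iP a (u := u.1) (v := v.1))// (sip_linl iP)//.
by rewrite (wu phi tphi) (wv phi tphi) mulrN -opprD.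
Qed.

Lemma vcomp_lin i a (u v : vfield R d) : vcomp i (a *: u + v) = a *: vcomp i u + vcomp i v.
Proof.
congr pair; apply/funext => x; first by rewrite /= !mxE.
by apply/rowP => j; rewrite /= !mxE.
Qed.

Lemma vcomp0 i : vcomp i 0 = 0 :> sfield R d.
Proof.
congr pair; apply/funext => x; first by rewrite /= !mxE.
by apply/rowP => j; rewrite /= !mxE.
Qed.

Lemma H1v_linsub : linsub (H1v mu Om).
Proof.
split=> [i|a u v Hu Hv i]; first by rewrite vcomp0; exact: (subspace0 H1_linsub).
by rewrite vcomp_lin; exact: H1_linsub.2.
Qed.

Definition ipH1 (v w : sfield R d) := ip mu Om v.1 w.1 + ipv mu Om v.2 w.2.
Definition ipH1v (u w : vfield R d) := ipv mu Om u.1 w.1 + ipm mu Om u.2 w.2.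

Lemma H1_L2 v : H1 mu Om v -> L2 mu Om v.1. Proof. by case. Qed.
Lemma H1_L2v v : H1 mu Om v -> L2v mu Om v.2. Proof. by case. Qed.
Lemma H1v_L2v u : H1v mu Om u -> L2v mu Om u.1.
Proof. by move=> Hu i; have [] := Hu i. Qed.
Lemma H1v_L2m u : H1v mu Om u -> L2m mu Om u.2.
Proof.
move=> Hu i j; have [_ /(_ j) + _] := Hu i; rewrite /vcomp/=.
by congr (L2 mu Om _); apply/funext => x; rewrite mxE.
Qed.

Lemma ipH1_semi : semi_ip (H1 mu Om) ipH1.
Proof.
apply: (semi_ipD (b := fun v w : sfield R d => ip mu Om v.1 w.1) (b' := fun v w : sfield R d => ipv mu Om v.2 w.2)).
- apply: (semi_ip_pull (V := sfield R d) (W := X -> R^o) (b := ip mu Om) (f := fst) H1_linsub H1_L2) => //.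
  exact: ip_semi.
- apply: (semi_ip_pull (V := sfield R d) (W := X -> X) (b := ipv mu Om) (f := snd) H1_linsub H1_L2v) => //.
  exact: ipv_semi.
Qed.

Lemma ipH1v_semi : semi_ip (H1v mu Om) ipH1v.
Proof.
apply: (semi_ipD (b := fun v w : vfield R d => ipv mu Om v.1 w.1) (b' := fun v w : vfield R d => ipm mu Om v.2 w.2)).
- apply: (semi_ip_pull (V := vfield R d) (W := X -> X) (b := ipv mu Om) (f := fst) H1v_linsub H1v_L2v) => //.
  exact: ipv_semi.
- apply: (semi_ip_pull (V := vfield R d) (W := X -> 'M[R]_d) (b := ipm mu Om) (f := snd) H1v_linsub H1v_L2m) => //.
  exact: ipm_semi.
Qed.

Lemma grad_le_H1 v : H1 mu Om v -> snorm (ipv mu Om) v.2 <= normH1 mu Om v.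
Proof.
move=> Hv; apply: ler_wsqrtr; rewrite lerDr.
exact: (sip_ge0 (ip_semi mu mOm) (H1_L2 Hv)).
Qed.
Lemma nrm_le_H1v u : H1v mu Om u -> snorm (ipv mu Om) u.1 <= normH1v mu Om u.
Proof.
move=> Hv; apply: ler_wsqrtr; rewrite lerDl.
exact: (sip_ge0 (ipm_semi mu mOm) (H1v_L2m Hv)).
Qed.
Lemma grad_le_H1v u : H1v mu Om u -> snorm (ipm mu Om) u.2 <= normH1v mu Om u.
Proof.
move=> Hv; apply: ler_wsqrtr; rewrite lerDr.
exact: (sip_ge0 (ipv_semi mu mOm) (H1v_L2v Hv)).
Qed.

(** The strain epsilon(u), read off the gradient component of the pair. *)
Definition symg (u : vfield R d) : X -> 'M[R]_d := fun x => symp (u.2 x).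

Lemma symg_lin a u v i j : (fun x => symg (a *: u + v) x i j : R^o) =
  a *: (fun x => symg u x i j : R^o) + (fun x => symg v x i j).
Proof.
by apply/funext => x; rewrite !fctE /GRing.scale /symg /symp/= !mxE; ring.
Qed.

Lemma symgE u i j : (fun x => symg u x i j : R^o) =
  2^-1 *: ((fun x => u.2 x i j : R^o) + (fun x => u.2 x j i)).
Proof. by apply/funext => x; rewrite /symg /symp !mxE. Qed.

Lemma symg_L2 u : H1v mu Om u -> L2m mu Om (symg u).
Proof.
move=> Hu i j; rewrite (symgE u i j); have Lu := H1v_L2m Hu.
by apply: (subspaceZ (L2_linsub mu mOm)); apply: (subspaceD (L2_linsub mu mOm)).
Qed.

Lemma symg_nrm u i j : H1v mu Om u -> nrm mu Om (fun x => symg u x i j) <= normH1v mu Om u.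
Proof.
move=> Hu; rewrite (symgE u i j); have Lu := H1v_L2m Hu.
have iP := ip_semi mu mOm.
have LD : L2 mu Om ((fun x => u.2 x i j : R^o) + (fun x => u.2 x j i)).
  exact: (subspaceD (L2_linsub mu mOm)).
rewrite nrmE (snormZ iP) // ger0_norm ?invr_ge0//.
have := snormD iP (Lu i j) (Lu j i); have := grad_le_H1v Hu.
have := nrm_le_mx mOm i j Lu; have := nrm_le_mx mOm j i Lu; rewrite !nrmE.
set a := snorm _ _; set b := snorm _ _; set c := snorm _ _; set e := snorm _ _.
by move=> *; lra.
Qed.
End Fixed.
End SobolevSpaces.

(** * The trace and the spaces of the problem *)

Section ProblemSpaces.
Context {R : realType} {d : nat} (P : piezo R d).
Local Notation X := 'rV[R]_d.
Local Notation mu := (pz_mu P).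
Local Notation Om := (pz_Om P).
Local Notation sg := (pz_sg P).
Local Notation tr := (pz_tr P).
Local Notation Gam := (bdry Om).
Local Notation N1 := (normH1 mu Om).
Hypothesis one_H1 : H1 mu Om (cstf 1).

Lemma Om_open : open Om. Proof. by have [] := pz_Om_domain P. Qed.
Lemma Om_bounded : bounded_set Om. Proof. by have [] := pz_Om_domain P. Qed.
Lemma Om_measurable : measurable Om.
Proof. by apply: open_measurable_rV; exact: Om_open. Qed.
Lemma Gam_measurable : measurable Gam.
Proof. by apply: bdry_measurable; exact: Om_open. Qed.
Let mOm := Om_measurable.
Let mGam := Gam_measurable.
Let oOm := Om_open.
Let bOm := Om_bounded.
Let L1 : L2 mu Om (fun=> 1). Proof. exact: (H1_L2 one_H1). Qed.

Lemma H1P_linsub : linsub (H1 mu Om). Proof. exact: H1_linsub. Qed.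
Lemma H1vP_linsub : linsub (H1v mu Om). Proof. exact: H1v_linsub. Qed.

Lemma tr_L2 v : H1 mu Om v -> L2 sg Gam (tr v).
Proof. by have [h _ _ _] := pz_tr_trace P; exact: h. Qed.
Lemma tr_lin a v w : H1 mu Om v -> H1 mu Om w ->
  {ae sg, forall x, Gam x -> tr (a *: v + w) x = (a *: tr v + tr w) x}.
Proof. by have [_ h _ _] := pz_tr_trace P; exact: h. Qed.

(** The constant 1 is continuous, so its trace is 1 almost everywhere; as traces are square
    integrable, the boundary has finite surface measure. *)
Lemma one_L2Gam : L2 sg Gam (fun=> 1).
Proof.
have [h _ _ h4] := pz_tr_trace P.
apply: (L2_ae mGam (h _ one_H1)); first exact: measurable_cst.
by apply: h4 => //; apply: continuous_subspaceT; exact: cst_continuous.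
Qed.

(** [tr] is linear only almost everywhere on the boundary; pairing with a function makes the
    exceptional sets disappear. *)
Lemma tr_bdd : bdd_bilin (L2 sg Gam : set (X -> R^o)) (nrm sg Gam) (H1 mu Om) N1
  (fun g v => ip sg Gam g (tr v)).
Proof.
have iP := ip_semi sg mGam; have sH := H1P_linsub.
split; first exact: (sip_sub iP).
- exact: sH.
- by move=> a u v w Lu Lv Hw; rewrite (sip_linl iP)//; exact: tr_L2.
- move=> a u v w Hu Hv Lw; have [Tu Tv] := (tr_L2 Hu, tr_L2 Hv).
  rewrite -(sipZr iP)// -(sipDr iP)//; last exact: (subspaceZ (sip_sub iP)).
  rewrite !(sip_sym iP w) //; last 2 first.
  + by rewrite -[_ + _]/(a *: (tr u) + tr v); exact: (sip_sub iP).2.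
  + by apply: tr_L2; exact: sH.2.
  apply: (ip_ae_l mGam) => //; last exact: tr_lin.
    by apply: tr_L2; exact: sH.2.
  exact: (sip_sub iP).2.
- have [_ _ [c cP] _] := pz_tr_trace P; exists c => g v Lg Hv.
  apply: le_trans (sip_CS iP Lg (tr_L2 Hv)) _.
  rewrite mulrCA; apply: ler_wpM2l; first exact: snorm_ge0.
  exact: cP.
Qed.

Lemma GamD_sub : pz_GamD P `<=` Gam.
Proof. by have [U _ ->] := pz_GamD_open P; move=> x []. Qed.

Lemma H1D_H1v u : H1D P u -> H1v mu Om u. Proof. by case. Qed.
Lemma H1G_H1 v : H1G P v -> H1 mu Om v. Proof. by case. Qed.

Lemma H1G_linsub : linsub (H1G P).
Proof.
split.
  split; first exact: (subspace0 H1P_linsub).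
  have H0 := subspace0 H1P_linsub.
  have z2 := pz_G_linear (p := P) 1 H0 H0.
  move: z2; rewrite scaler0 addr0 mul1r => /eqP.
  by rewrite -[X in X == _]addr0 (inj_eq (addrI _)) eq_sym => /eqP.
move=> a u v [Hu gu] [Hv gv]; split; first exact: H1P_linsub.2.
by rewrite pz_G_linear// gu gv mulr0 addr0.
Qed.

Lemma tr0_ae : {ae sg, forall x, Gam x -> tr 0 x = 0}.
Proof.
have H0 := subspace0 H1P_linsub; have := tr_lin 1 H0 H0.
apply: filterS => x /= + Gx => /(_ Gx); rewrite scaler0 addr0 => /eqP.
by rewrite -[X in X == _]add0r fctE /= fctE scale1r (inj_eq (addIr _)) eq_sym => /eqP.
Qed.

(** Each component has its own exceptional set for the linearity of [tr], and there are finitely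
    many components. *)
Lemma H1D_linsub : linsub (H1D P).
Proof.
split.
  split; first exact: (subspace0 H1vP_linsub).
  by apply: filterS tr0_ae => x h /GamD_sub Gx i; rewrite vcomp0 h.
move=> a u v [Hu gu] [Hv gv]; split; first exact: H1vP_linsub.2.
have h : {ae sg, forall x i, Gam x ->
    tr (vcomp i (a *: u + v)) x = (a *: tr (vcomp i u) + tr (vcomp i v)) x}.
  apply: filter_forall => i.
  by rewrite vcomp_lin; exact: tr_lin.
apply: filterS3 gu gv h => x + + + Dx i => /(_ Dx i) gu /(_ Dx i) gv /(_ i (GamD_sub Dx)) ->.
by rewrite !fctE gu gv scaler0 addr0.
Qed.
End ProblemSpaces.

(** * The elastic, coupling and dielectric forms *)

Section PiezoForms.
Context {R : realType} {d : nat} (P : piezo R d).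
Local Notation X := 'rV[R]_d.
Local Notation mu := (pz_mu P).
Local Notation Om := (pz_Om P).
Local Notation N1 := (normH1 mu Om).
Local Notation N1v := (normH1v mu Om).
Local Notation L2 := (L2 mu Om).
Local Notation ip := (ip mu Om).
Hypothesis one_H1 : H1 mu Om (cstf 1).
Let mOm := Om_measurable P.
Let oOm : open Om := @Om_open _ _ P.
Let sH := H1P_linsub one_H1.
Let sHv := H1vP_linsub one_H1.

(** [elast], [coup] and [diel] are the elastic, piezoelectric and dielectric parts of [aform]. The
    first and the last are symmetric, while the coupling occurs in [aform] twice with opposite
    signs. *)
Definition elast (u w : vfield R d) : R :=
  ipm mu Om (fun x => appC (pz_Cc P x) (symg u x)) (symg w).
Definition coup (psi : sfield R d) (w : vfield R d) : R :=
  ipm mu Om (fun x => appE (pz_Ec P x) (psi.2 x)) (symg w).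
Definition diel (psi phi : sfield R d) : R :=
  ipv mu Om (fun x => appK (pz_Kc P x) (psi.2 x)) phi.2.

Lemma elast_L2 u : H1v mu Om u -> L2m mu Om (fun x => appC (pz_Cc P x) (symg u x)).
Proof.
move=> Hu i j.
have -> : (fun x => appC (pz_Cc P x) (symg u x) i j) =
    (fun x => \sum_k \sum_l pz_Cc P x i j k l * symg u x k l).
  by apply/funext => x; rewrite mxE.
apply: (L2_sum mOm) => k; apply: (L2_sum mOm) => l.
exact: (Linf_mul_L2 mOm (pz_Cc_Linf P i j k l) (symg_L2 oOm Hu k l)).
Qed.

Lemma coup_L2 psi : H1 mu Om psi -> L2m mu Om (fun x => appE (pz_Ec P x) (psi.2 x)).
Proof.
move=> Hu i j.
have -> : (fun x => appE (pz_Ec P x) (psi.2 x) i j) =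
    (fun x => \sum_k pz_Ec P x i j 0 k * psi.2 x 0 k).
  by apply/funext => x; rewrite mxE.
apply: (L2_sum mOm) => k.
exact: (Linf_mul_L2 mOm (pz_Ec_Linf P i j k) (H1_L2v Hu k)).
Qed.

Lemma diel_L2 psi : H1 mu Om psi -> L2v mu Om (fun x => appK (pz_Kc P x) (psi.2 x)).
Proof.
move=> Hu i.
have -> : (fun x => appK (pz_Kc P x) (psi.2 x) 0 i) =
    (fun x => \sum_k pz_Kc P x i k * psi.2 x 0 k).
  by apply/funext => x; rewrite mxE; apply: eq_bigr => k _; rewrite mxE mulrC.
apply: (L2_sum mOm) => k.
exact: (Linf_mul_L2 mOm (pz_Kc_Linf P i k) (H1_L2v Hu k)).
Qed.

Lemma coupt_L2 u : H1v mu Om u -> L2v mu Om (fun x => appEt (pz_Ec P x) (symg u x)).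
Proof.
move=> Hu k.
have -> : (fun x => appEt (pz_Ec P x) (symg u x) 0 k) =
    (fun x => \sum_i \sum_j pz_Ec P x i j 0 k * symg u x i j).
  apply/funext => x; rewrite /appEt summxE; apply: eq_bigr => i _.
  by rewrite summxE; apply: eq_bigr => j _; rewrite mxE mulrC.
apply: (L2_sum mOm) => i; apply: (L2_sum mOm) => j.
exact: (Linf_mul_L2 mOm (pz_Ec_Linf P i j k) (symg_L2 oOm Hu i j)).
Qed.

Lemma frobC (A B : 'M[R]_d) : frob A B = frob B A.
Proof. by apply: eq_bigr => i _; apply: eq_bigr => j _; rewrite mulrC. Qed.

Lemma coupE psi w : coup psi w = ipv mu Om (fun x => appEt (pz_Ec P x) (symg w x)) psi.2.
Proof. by apply: eq_Rintegral => x _; rewrite appEtP frobC. Qed.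

Lemma aformE u psi w phi : H1v mu Om u -> H1 mu Om psi -> H1v mu Om w -> H1 mu Om phi ->
  aform P u psi w phi = elast u w + coup psi w - coup phi u + diel psi phi.
Proof.
move=> Hu Hpsi Hw Hphi.
rewrite /aform.
have -> : ipm mu Om (sigma P u psi) (fun x => symp (w.2 x)) = elast u w + coup psi w.
  apply: (sipDl (ipm_semi mu mOm) (elast_L2 Hu) (coup_L2 Hpsi)).
  exact: (symg_L2 oOm Hw).
have -> : ipv mu Om (dfield P u psi) phi.2 = coup phi u - diel psi phi.
  rewrite coupE; apply: (sipBl (ipv_semi mu mOm) (coupt_L2 Hu) (diel_L2 Hpsi)).
  exact: (H1_L2v Hphi).
by rewrite opprB addrA addrAC.
Qed.

Let symg_pull i j : forall u, H1v mu Om u ->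
  [/\ L2 (fun x => symg u x i j), 0 <= nrm mu Om (fun x => symg u x i j) &
      nrm mu Om (fun x => symg u x i j) <= N1v u].
Proof.
move=> u Hu; split; first exact: (symg_L2 oOm Hu i j).
- exact: sqrtr_ge0.
- exact: (symg_nrm oOm).
Qed.

Let grad_pull i : forall v, H1 mu Om v ->
  [/\ L2 (fun x => v.2 x 0 i), 0 <= nrm mu Om (fun x => v.2 x 0 i) &
      nrm mu Om (fun x => v.2 x 0 i) <= N1 v].
Proof.
move=> v Hv; split; first exact: (H1_L2v Hv).
- exact: sqrtr_ge0.
- exact: le_trans (nrm_le_vec mOm i (H1_L2v Hv)) (grad_le_H1 oOm Hv).
Qed.

Let grad_lin i a (u v : sfield R d) : (fun x => (a *: u + v).2 x 0 i : R^o) =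
  a *: (fun x => u.2 x 0 i : R^o) + (fun x => v.2 x 0 i).
Proof. by apply/funext => x; rewrite !mxE. Qed.

Lemma elast_bdd : bdd_bilin (H1v mu Om) N1v (H1v mu Om) N1v elast.
Proof.
suff h : bdd_bilin (H1v mu Om) N1v (H1v mu Om) N1v (fun u w => \sum_i \sum_j \sum_k \sum_l
    ip (fun x => pz_Cc P x i j k l * symg u x k l) (fun x => symg w x i j)).
  apply: bdd_bilin_ext h => u w Hu Hw; rewrite /elast.
  rewrite (ipmE mOm (elast_L2 Hu) (symg_L2 oOm Hw)).
  apply: eq_bigr => i _; apply: eq_bigr => j _.
  have L k l := Linf_mul_L2 mOm (pz_Cc_Linf P i j k l) (symg_L2 oOm Hu k l).
  have Lw := symg_L2 oOm Hw i j.
  transitivity (ip (fun x => \sum_k \sum_l pz_Cc P x i j k l * symg u x k l) (fun x => symg w x i j)).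
    rewrite (ip_suml mOm (fun k => L2_sum mOm (L k)) Lw).
    by apply: eq_bigr => k _; rewrite (ip_suml mOm (L k) Lw).
  by apply: eq_Rintegral => x _; congr (_ * _); rewrite mxE.
do 4 (apply: bdd_bilin_sum => // ?).
apply: (bdd_bilin_pull (V := vfield R d) (W := vfield R d) (V' := X -> R^o) (W' := X -> R^o)
  sHv sHv (symg_pull _ _) (symg_pull _ _) _ _ (weight_bdd mOm (pz_Cc_Linf P _ _ _ _))).
- by move=> a u v; exact: symg_lin.
- by move=> a u v; exact: symg_lin.
Qed.

Lemma coup_bdd : bdd_bilin (H1 mu Om) N1 (H1v mu Om) N1v coup.
Proof.
suff h : bdd_bilin (H1 mu Om) N1 (H1v mu Om) N1v (fun u w => \sum_i \sum_j \sum_k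
    ip (fun x => pz_Ec P x i j 0 k * u.2 x 0 k) (fun x => symg w x i j)).
  apply: bdd_bilin_ext h => u w Hu Hw; rewrite /coup.
  rewrite (ipmE mOm (coup_L2 Hu) (symg_L2 oOm Hw)).
  apply: eq_bigr => i _; apply: eq_bigr => j _.
  have L k := Linf_mul_L2 mOm (pz_Ec_Linf P i j k) (H1_L2v Hu k).
  have Lw := symg_L2 oOm Hw i j.
  transitivity (ip (fun x => \sum_k pz_Ec P x i j 0 k * u.2 x 0 k) (fun x => symg w x i j)).
    by rewrite (ip_suml mOm L Lw).
  by apply: eq_Rintegral => x _; congr (_ * _); rewrite mxE.
do 3 (apply: bdd_bilin_sum => // ?).
apply: (bdd_bilin_pull (V := sfield R d) (W := vfield R d) (V' := X -> R^o) (W' := X -> R^o)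
  sH sHv (grad_pull _) (symg_pull _ _) _ _ (weight_bdd mOm (pz_Ec_Linf P _ _ _))).
- by move=> a u v; exact: grad_lin.
- by move=> a u v; exact: symg_lin.
Qed.

Lemma frob_integrable (A B : X -> 'M[R]_d) : L2m mu Om A -> L2m mu Om B ->
  mu.-integrable Om (EFin \o (fun x => frob (A x) (B x))).
Proof.
move=> LA LB; apply: (Rint_sum mOm (f := fun i x => \sum_j A x i j * B x i j) _).1 => i.
by apply: (Rint_sum mOm (f := fun j x => A x i j * B x i j) _).1 => j; exact: L2_mul.
Qed.

Lemma dot_integrable (A B : X -> X) : L2v mu Om A -> L2v mu Om B ->
  mu.-integrable Om (EFin \o (fun x => dot (A x) (B x))).
Proof.
move=> LA LB; apply: (Rint_sum mOm (f := fun i x => A x 0 i * B x 0 i) _).1 => i.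
exact: L2_mul.
Qed.

Let int_measurable (f : X -> R) : mu.-integrable Om (EFin \o f) -> measurable_fun Om f.
Proof. by move=> fi; apply/measurable_EFinP; exact: (measurable_int mu fi). Qed.

Lemma symp_sym (A : 'M[R]_d) : (symp A)^T = symp A.
Proof. by apply/matrixP => i j; rewrite !mxE addrC. Qed.

(** Symmetry is inherited from the tensor almost everywhere. Positivity is available because the
    matrices inserted are strains, hence symmetric. *)
Lemma elast_semi : semi_ip (H1v mu Om) elast.
Proof.
have bP := elast_bdd; split; first exact: sHv.
- exact: (bb_linl bP).
- move=> u v Hu Hv.
  have Lu := symg_L2 oOm Hu; have Lv := symg_L2 oOm Hv.
  transitivity (ipm mu Om (symg u) (fun x => appC (pz_Cc P x) (symg v x))).
    apply: Rint_ae_eq => //.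
    + exact: (int_measurable (frob_integrable (elast_L2 Hu) Lv)).
    + exact: (int_measurable (frob_integrable Lu (elast_L2 Hv))).
    + apply: filterS (pz_Cc_sym P) => x h Omx.
      by have [_ ->] := h Omx (symg u x) (symg v x).
  by apply: eq_Rintegral => x _; rewrite frobC.
- move=> u Hu; apply: Rint_ae_ge0 => //.
    exact: (int_measurable (frob_integrable (elast_L2 Hu) (symg_L2 oOm Hu))).
  have [c0 c00 h] := pz_Cc_pos P; apply: filterS h => x h Omx.
  apply: le_trans (h Omx _ (symp_sym _)); apply: mulr_ge0; first exact: ltW.
  by apply: sumr_ge0 => i _; apply: sumr_ge0 => j _; rewrite -expr2 sqr_ge0.
Qed.

Lemma diel_semi : semi_ip (H1 mu Om) diel.
Proof.
have iP := ipv_semi mu mOm.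
split; first exact: sH.
- move=> a u v w Hu Hv Hw.
  rewrite -(sip_linl iP _ (diel_L2 Hu) (diel_L2 Hv) (H1_L2v Hw)).
  apply: eq_Rintegral => x _; congr dot.
  by rewrite /appK -[(a *: u + v).2 x]/(a *: u.2 x + v.2 x) mulmxDl -scalemxAl.
- move=> u v Hu Hv.
  have Lu := H1_L2v Hu; have Lv := H1_L2v Hv.
  rewrite /diel; transitivity (ipv mu Om u.2 (fun x => appK (pz_Kc P x) (v.2 x))).
    apply: Rint_ae_eq => //.
    + exact: (int_measurable (dot_integrable (diel_L2 Hu) Lv)).
    + exact: (int_measurable (dot_integrable Lu (diel_L2 Hv))).
    + apply: filterS (pz_Kc_sym P) => x h Omx; have {}h := h Omx.
      rewrite /dot /appK h; under eq_bigr do rewrite mxE mulr_suml.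
      under [RHS]eq_bigr do rewrite mxE mulr_sumr.
      rewrite exchange_big/=; apply: eq_bigr => i _; apply: eq_bigr => j _.
      by rewrite -{1}h mxE; ring.
  by apply: eq_Rintegral => x _; apply: eq_bigr => i _; rewrite mulrC.
- move=> u Hu; apply: Rint_ae_ge0 => //.
    exact: (int_measurable (dot_integrable (diel_L2 Hu) (H1_L2v Hu))).
  have [k0 k00 h] := pz_Kc_pos P; apply: filterS h => x h Omx.
  by apply: le_trans (h Omx _); rewrite mulr_ge0 ?sqr_ge0// ltW.
Qed.

(** Only the gradient is controlled. The trace of a potential is recovered from its gradient by
    [trace_bound]. *)
Lemma diel_coercive : exists2 k0, 0 < k0 & forall psi, H1 mu Om psi ->
  k0 * ipv mu Om psi.2 psi.2 <= diel psi psi.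
Proof.
have [k0 k00 h] := pz_Kc_pos P; exists k0 => // psi Hpsi.
have Lp := H1_L2v Hpsi.
rewrite /ipv -RintegralZl//; last exact: (dot_integrable Lp Lp).
apply: Rint_ae_le => //.
- exact: (integrableZl mOm k0 (dot_integrable Lp Lp)).
- exact: (dot_integrable (diel_L2 Hpsi) Lp).
- apply: filterS h => x h Omx; apply: le_trans (h Omx _); rewrite sqr_sqrtr//.
  by apply: sumr_ge0 => i _; rewrite -expr2 sqr_ge0.
Qed.

Lemma ip_rho_semi : semi_ip (L2v mu Om) (ip_rho P).
Proof.
have rho0 : {ae mu, forall x, Om x -> 0 <= pz_rho P x}.
  have [r r0 h] := pz_rho_pos P; apply: filterS h => x h Omx.
  exact: le_trans (ltW r0) (h Omx).
suff h : semi_ip (L2v mu Om) (fun u v => \sum_i ip (fun x => pz_rho P x * u x 0 i) (fun x => v x 0 i)).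
  apply: semi_ip_ext h => u v Lu Lv.
  have Lru : L2v mu Om (fun x => pz_rho P x *: u x).
    move=> i; rewrite (_ : (fun x => _) = (fun x => pz_rho P x * u x 0 i)).
      exact: (Linf_mul_L2 mOm (pz_rho_Linf P) (Lu i)).
    by apply/funext => x; rewrite mxE.
  rewrite /ip_rho (ipvE mOm Lru Lv); apply: eq_bigr => i _.
  by apply: eq_Rintegral => x _; congr (_ * _); rewrite mxE.
apply: semi_ip_sum => [|i]; first exact: L2v_linsub.
apply: (semi_ip_pull (V := X -> X) (W := X -> R^o) (B' := L2)
  (b := fun f g => ip (fun x => pz_rho P x * f x) g) (f := fun u x => u x 0 i)).
- exact: L2v_linsub.
- by move=> u; apply.
- by move=> a u v; apply/funext => x; rewrite !mxE.
- exact: (ip_weight_semi mOm (pz_rho_Linf P)).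
Qed.

Lemma norm_rho_le : exists2 M, 0 <= M & forall u, L2v mu Om u ->
  norm_rho P u <= M * snorm (ipv mu Om) u.
Proof.
have [_ [M hM]] := pz_rho_Linf P.
exists (Num.sqrt `|M|) => [|u Lu]; first exact: sqrtr_ge0.
rewrite -sqrtrM ?normr_ge0//; apply: ler_wsqrtr.
rewrite /ip_rho /ipv -RintegralZl//; last exact: (dot_integrable Lu Lu).
have Lru : L2v mu Om (fun x => pz_rho P x *: u x).
  move=> i; rewrite (_ : (fun x => _) = (fun x => pz_rho P x * u x 0 i)).
    exact: (Linf_mul_L2 mOm (pz_rho_Linf P) (Lu i)).
  by apply/funext => x; rewrite mxE.
apply: Rint_ae_le => //.
- exact: (dot_integrable Lru Lu).
- exact: (integrableZl mOm _ (dot_integrable Lu Lu)).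
- apply: filterS hM => x hM Omx.
  have -> : dot (pz_rho P x *: u x) (u x) = pz_rho P x * dot (u x) (u x).
    by rewrite /dot mulr_sumr; apply: eq_bigr => i _; rewrite mxE mulrA.
  apply: ler_wpM2r; first by apply: sumr_ge0 => i _; rewrite -expr2 sqr_ge0.
  apply: le_trans (ler_norm _) _; apply: le_trans (hM Omx) _; exact: ler_norm.
Qed.

Lemma norm_rho_le_H1v : exists2 M, 0 <= M & forall u, H1v mu Om u ->
  norm_rho P u.1 <= M * N1v u.
Proof.
have [M M0 h] := norm_rho_le; exists M => // u Hu.
apply: le_trans (h _ (H1v_L2v Hu)) _; apply: ler_wpM2l => //.
exact: (nrm_le_H1v oOm).
Qed.

Lemma ip_rho_bdd : bdd_bilin (L2v mu Om) (norm_rho P) (L2v mu Om) (norm_rho P) (ip_rho P).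
Proof. exact: semi_ip_bdd ip_rho_semi. Qed.

Lemma ip_rhov_semi : semi_ip (H1v mu Om) (fun u w : vfield R d => ip_rho P u.1 w.1).
Proof.
pose g : vfield R d -> X -> X := fst.
exact: (semi_ip_pull (V := vfield R d) (W := X -> X) (b := ip_rho P) (f := g) sHv (@H1v_L2v _ _ mu Om) (fun a u v => erefl) ip_rho_semi).
Qed.

Lemma ip_rhov_bdd : bdd_bilin (H1v mu Om) N1v (H1v mu Om) N1v
  (fun u w : vfield R d => ip_rho P u.1 w.1).
Proof.
have iP := ip_rhov_semi; split; first exact: sHv.
- exact: sHv.
- exact: (sip_linl iP).
- exact: (bb_linr (semi_ip_bdd iP)).
- have [M M0 h] := norm_rho_le_H1v; exists (M * M) => u v Hu Hv.
  apply: le_trans (sip_CS iP Hu Hv) _; rewrite mulrACA.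
  by apply: ler_pM; rewrite ?snorm_ge0//; [exact: (h u)|exact: (h v)].
Qed.
End PiezoForms.

(** * Difference quotients and integration by parts in time *)

Section QuotientLimits.
Context {R : realType}.
Variable T : R.
Local Notation I := (`[0, T]%classic : set R).

Lemma is_C0_cst (V : lmodType R) (B : set V) N (v : V) : N 0 = 0 -> B v -> is_C0 T B N (fun=> v).
Proof.
move=> N0 Bv t It; split => //; rewrite subrr N0; exact: cvg_cst.
Qed.

(** Half of a product rule: only the second argument is incremented, so continuity of the first is
    enough. The energy estimate uses it for the potential, which has no time derivative there. *)
Lemma cvg_bilin_quot (V W : lmodType R) (B1 : set V) N1 (B2 : set W) N2 b x y y' t :
  bdd_bilin B1 N1 B2 N2 b -> is_C0 T B1 N1 x ->
  is_C0 T B2 N2 y -> is_C0 T B2 N2 y' -> has_tderiv T N2 y y' -> I t ->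
  (s - t)^-1 * (b (x s) (y s) - b (x s) (y t))
     @[s --> within (I `\ t) (nbhs t)] --> b (x t) (y' t).
Proof.
move=> bP xC yC y'C dy It.
have [s1 s2] := (bb_sub1 bP, bb_sub2 bP).
have [Bx xct] := xC _ It; have [By yct] := yC _ It; have [By' _] := y'C _ It.
have [c cP] := bb_bound bP.
have cb p q : B1 p -> B2 q -> `|b p q| <= `|c| * (`|N1 p| * `|N2 q|).
  move=> Bp Bq; apply: le_trans (cP _ _ Bp Bq) _.
  by rewrite -!normrM ler_norm.
pose J := within (I `\ t) (nbhs t).
have FJ : Filter J by exact: within_filter.
have sJ : \forall s \near J, (I `\ t) s by apply: withinT.
have nu (h : R -> R) : h s @[s --> J] --> (0 : R) -> `|h s| @[s --> J] --> (0 : R).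
  by move=> /cvg_norm; rewrite normr0.
have JI (h : R -> R) : h s @[s --> within I (nbhs t)] --> (0 : R) -> h s @[s --> J] --> (0 : R).
  by apply: cvg_trans; apply: cvg_app; apply: within_subset => z [].
have dy0 := nu _ (dy _ It); have xc0 := nu _ (JI _ xct).
set q := fun s => (s - t)^-1 *: (y s - y t) - y' t.
pose g s := `|c| * (`|N1 (x s - x t)| * `|N2 (q s)| + (`|N1 (x s - x t)| * `|N2 (y' t)|
   + `|N1 (x t)| * `|N2 (q s)|)).
have gc : g s @[s --> J] --> `|c| * (0 * 0 + (0 * `|N2 (y' t)| + `|N1 (x t)| * 0)).
  apply: cvgMr; apply: cvgD; first exact: cvgM.
  by apply: cvgD; [exact: cvgMl|exact: cvgMr].
rewrite !(mulr0, mul0r, addr0) in gc.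
apply/cvgrPdist_le => e e0.
have : \forall s \near J, `|0 - g s| <= e by move/cvgrPdist_le: gc; apply.
apply: filterS2 sJ => s [Is /eqP st]; rewrite sub0r normrN => h; apply: le_trans h.
have [Bxs _] := xC _ Is; have [Bys _] := yC _ Is.
have Dx := subspaceB s1 Bxs Bx; have Dy := subspaceB s2 Bys By.
have Bq : B2 (q s) by apply: subspaceB => //; exact: subspaceZ.
rewrite distrC.
have -> : (s - t)^-1 * (b (x s) (y s) - b (x s) (y t)) - b (x t) (y' t) =
   b (x s - x t) (q s) + (b (x s - x t) (y' t) + b (x t) (q s)).
  have Dz := subspaceZ s2 (s - t)^-1 Dy.
  by rewrite !(bbBl bP) ?(bbBr bP) ?(bbZr bP) ?(bbBr bP)//; ring.
apply: le_trans _ (ler_norm _); rewrite /g !mulrDr.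
do 2 (apply: le_trans (ler_normD _ _) _; apply: lerD; first exact: cb).
exact: cb.
Qed.

Lemma derID F g F' g' : derI T F g -> derI T F' g' ->
  derI T (fun s => F s + F' s) (fun s => g s + g' s).
Proof.
move=> d1 d2 t It.
have -> : (fun s => (s - t)^-1 * (F s + F' s - (F t + F' t))) =
    (fun s => (s - t)^-1 * (F s - F t) + (s - t)^-1 * (F' s - F' t)).
  by apply/funext => s; ring.
by apply: cvgD; [exact: d1|exact: d2].
Qed.

Lemma derIN F g : derI T F g -> derI T (fun s => - F s) (fun s => - g s).
Proof.
move=> d1 t It.
have -> : (fun s => (s - t)^-1 * (- F s - - F t)) = (fun s => - ((s - t)^-1 * (F s - F t))).
  by apply/funext => s; ring.
by apply: cvgN; exact: d1.
Qed.

Lemma derI_eq F g g' : (forall t, I t -> g t = g' t) -> derI T F g -> derI T F g'.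
Proof. by move=> gg d1 t It; rewrite -gg//; exact: d1. Qed.

(** Both integrations by parts at once: the integrands differ by the derivative of a function with
    equal values at the two ends. *)
Lemma adjoint_int F h1 h2 : 0 <= T -> contI T F -> contI T h1 -> contI T h2 ->
  derI T F (fun t => h1 t - h2 t) -> F 0 = F T ->
  \int[lebesgue_measure]_(t in I) h1 t = \int[lebesgue_measure]_(t in I) h2 t.
Proof.
move=> T0 cF c1 c2 dF F0T.
have := FTC_I cF (contID c1 (contIN c2)) dF (lexx 0) T0 (lexx T).
rewrite F0T subrr RintegralB//; try by apply: contI_integrable.
by move/eqP; rewrite subr_eq0 => /eqP.
Qed.
End QuotientLimits.

(** * The duality of H^{-1}_D and the adjoint identity for S and R *)

Section DualPairing.
Context {R : realType} {d : nat} (P : piezo R d).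
Local Notation X := 'rV[R]_d.
Local Notation mu := (pz_mu P).
Local Notation Om := (pz_Om P).
Local Notation N1v := (normH1v mu Om).
Hypothesis one_H1 : H1 mu Om (cstf 1).
Let mOm := Om_measurable P.
Let mGam := Gam_measurable P.
Let oOm : open Om := @Om_open _ _ P.

Lemma HmD_linsub : linsub (HmD P).
Proof.
have z w : (0 : vfield R d -> R^o) w = 0 :> R by [].
split.
  split; first by move=> a v w _ _; rewrite !z mulr0 addr0.
  by exists 0 => w _; rewrite z mul0r normr0.
move=> a F G [Fl [c cP]] [Gl [c' cP']]; split.
  move=> k v w Hv Hw; rewrite !fctE Fl// Gl// /GRing.scale/=; ring.
exists (`|a| * c + c') => w Hw; rewrite !fctE mulrDl -mulrA.
apply: le_trans (ler_normD _ _) _; apply: lerD; last exact: cP'.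
by rewrite normrM; apply: ler_wpM2l => //; exact: cP.
Qed.

(** The constant is 1 by the definition of the dual norm, applied to the normalised [w]. *)
Lemma dual_bdd : bdd_bilin (HmD P) (norm_HmD P) (H1D P) N1v
  ((fun F w => F w) : (vfield R d -> R^o) -> vfield R d -> R).
Proof.
have sD := H1D_linsub one_H1; split; first exact: HmD_linsub.
- exact: sD.
- by [].
- by move=> a u v F Hu Hv [Fl _]; exact: Fl.
exists 1 => F w HF Hw; rewrite mul1r; have [Fl [c cP]] := HF.
(* A [w] of seminorm 0 cannot be normalised, but a bounded functional vanishes on it. *)
have [w0|w0] := eqVneq (N1v w) 0.
  by have := cP w Hw; rewrite w0 !mulr0.
have wp : 0 < N1v w by rewrite lt_neqAle eq_sym w0 sqrtr_ge0.
have H0 := subspace0 sD.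
have F0 : F 0 = 0.
  by have := Fl 1 0 0 H0 H0; rewrite scaler0 addr0 mul1r => /eqP; rewrite -[X in X == _]addr0 (inj_eq (addrI _)) eq_sym => /eqP.
have Ninv : `|(N1v w)^-1| = (N1v w)^-1 by rewrite ger0_norm ?invr_ge0 ?ltW.
rewrite -ler_pdivrMr//.
have -> : `|F w| / N1v w = `|F ((N1v w)^-1 *: w)|.
  by rewrite -[_ *: w]addr0 Fl// F0 addr0 normrM Ninv mulrC.
(* The supremum is meaningful only if the set of values is bounded above; the bound [c] of the
   functional provides this. *)
apply: ub_le_sup.
  exists `|c| => _ [v [Hv v1] <-]; apply: le_trans (cP _ Hv) _.
  apply: le_trans (ler_norm _) _; rewrite normrM ler_piMr// ger0_norm//.
  exact: sqrtr_ge0.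
exists ((N1v w)^-1 *: w) => //; split; first exact: subspaceZ.
have := snormZ (ipH1v_semi oOm (@Om_bounded _ _ P) (H1_L2 one_H1)) (N1v w)^-1 (H1D_H1v Hw).
rewrite /snorm -/(normH1v mu Om _) => ->.
by rewrite Ninv -/(N1v w) mulVf.
Qed.
End DualPairing.

Section ContinuousAdjoint.
Context {R : realType} {d : nat} (P : piezo R d).
Local Notation X := 'rV[R]_d.
Local Notation mu := (pz_mu P).
Local Notation Om := (pz_Om P).
Local Notation sg := (pz_sg P).
Local Notation tr := (pz_tr P).
Local Notation T := (pz_T P).
Local Notation Gam := (bdry Om).
Local Notation N1v := (normH1v mu Om).
Local Notation I := (`[0, T]%classic : set R).
Hypothesis one_H1 : H1 mu Om (cstf 1).
Let mOm := Om_measurable P.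
Let mGam := Gam_measurable P.
Let oOm : open Om := @Om_open _ _ P.
Let bOm : bounded_set Om := @Om_bounded _ _ P.
Let L1 : L2 mu Om (fun=> 1). Proof. exact: (H1_L2 one_H1). Qed.
Let sH := H1P_linsub one_H1.
Let T0 := pz_T_gt0 P.
Let I0 : I 0. Proof. by rewrite /= in_itv/= lexx ltW. Qed.
Let IT : I T. Proof. by rewrite /= in_itv/= lexx ltW. Qed.

Lemma N1v0_rho u : H1v mu Om u -> N1v u = 0 -> norm_rho P u.1 = 0.
Proof.
move=> Hu u0; have [M M0 h] := norm_rho_le_H1v P.
by apply/eqP; rewrite eq_le sqrtr_ge0 andbT; have := h _ Hu; rewrite u0 mulr0.
Qed.

(** The coupling is skew, the rest symmetric. Negating the potential of the test pair gives both
    coupling terms the same sign and makes the expression symmetric in the two pairs. *)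
Lemma aform_flip u psi w phi : H1v mu Om u -> H1 mu Om psi -> H1v mu Om w -> H1 mu Om phi ->
  aform P u psi w (- phi) = aform P w phi u (- psi).
Proof.
move=> Hu Hp Hw Hf; have Hp' := subspaceN sH Hp; have Hf' := subspaceN sH Hf.
have cN p v : H1 mu Om p -> H1v mu Om v -> coup P (- p) v = - coup P p v.
  by move=> Hpp Hv; rewrite -scaleN1r (bbZl (coup_bdd one_H1))// mulN1r.
have dP := diel_semi one_H1.
rewrite !aformE// (sip_sym (elast_semi one_H1) u w)// !cN//.
rewrite (sipNr dP Hf Hp) (sipNr dP Hp Hf) (sip_sym dP phi psi Hf Hp); ring.
Qed.

(** The normal trace conditions are Green's formulas with vanishing boundary terms; inserting the
    equation of motion into them gives the weak form, for all potentials in H^1 and not only those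
    in the kernel of G. *)
Lemma sol_R_weak f p xi p'' : Uspace P f ->
  (forall t, I t -> L2v mu Om (p'' t)) ->
  (forall t, I t -> H1D P (p t)) -> (forall t, I t -> H1 mu Om (xi t)) ->
  forall t, I t ->
        [/\ exists D : X -> 'rV[R]_d,
            [/\ L2v mu Om D,
                forall i, weak_div mu Om (fun x => row i (sigma P (p t) (xi t) x))
                            (fun x => D x 0 i),
                {ae mu, forall x, Om x ->
                  pz_rho P x *: p'' t x = D x + pz_rho P x *: (f t).1 x} &
                forall v, H1D P v -> normal_trace_m P (sigma P (p t) (xi t)) D v = 0],
            weak_div mu Om (dfield P (p t) (xi t)) (fun=> 0),
            pz_G P (xi t) = 0 &
            forall phi, H1 mu Om phi ->
              normal_trace_v P (dfield P (p t) (xi t)) (fun=> 0) phi = 0] ->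
  forall w phi, H1D P w -> H1 mu Om phi ->
    ip_rho P (p'' t) w.1 + aform P (p t) (xi t) w phi = ip_rho P (f t).1 w.1.
Proof.
move=> fU Lp pD xH t It [[D [LD _ De Dn]] _ _ Nv] w phi Hw Hphi.
have iP := ipv_semi mu mOm.
have Lw := H1v_L2v (H1D_H1v Hw).
have Lf : L2v mu Om (f t).1 by have [/H1D_H1v /H1v_L2v] := fU t It.
have rhoL v : L2v mu Om v -> L2v mu Om (fun x => pz_rho P x *: v x).
  move=> Lv i; rewrite (_ : (fun x => _) = (fun x => pz_rho P x * v x 0 i)).
    exact: (Linf_mul_L2 mOm (pz_rho_Linf P) (Lv i)).
  by apply/funext => x; rewrite mxE.
have e1 : ip_rho P (p'' t) w.1 = ipv mu Om D w.1 + ip_rho P (f t).1 w.1.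
  rewrite /ip_rho -(sipDl iP LD (rhoL _ Lf) Lw).
  have LDf := subspaceD (L2v_linsub mu mOm) LD (rhoL _ Lf).
  have im g : mu.-integrable Om (EFin \o g) -> measurable_fun Om g.
    by move=> fi; apply/measurable_EFinP; exact: (measurable_int mu fi).
  apply: Rint_ae_eq => //.
  - exact: (im _ (dot_integrable (rhoL _ (Lp t It)) Lw)).
  - exact: (im _ (dot_integrable LDf Lw)).
  - by apply: filterS De => x h Omx; rewrite h.
have := Dn w Hw; rewrite /normal_trace_m => e2.
have := Nv phi Hphi; rewrite /normal_trace_v (sip0l (ip_semi mu mOm) (H1_L2 Hphi)) addr0 => e3.
by rewrite e1 /aform e3 subr0 addrC addrA e2 add0r.
Qed.

(** The derivative of [u'] exists only in H^{-1}_D and is paired with [p], which is C^1 with values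
    in H^1_D. The derivative of [p'] lies in L^2_rho and is paired with [u]. *)
Lemma adjoint_R z u psi f p xi : is_C0 T (L2 sg Gam) (nrm sg Gam) z ->
  sol_S P z u psi -> Uspace P f -> sol_R P f p xi ->
  \int[lebesgue_measure]_(t in I) ip_rho P (f t).1 (u t).1 =
  \int[lebesgue_measure]_(t in I) ip sg Gam (z t) (tr (xi t)).
Proof.
move=> zC [u' [u'' [[uC [u1C u1'C du] [[eC e'C de] [_ e''C de']] psiC] [eqS u00 u'00]]]].
move=> fU [p' [p'' [xi' [[[p1C p1'C dp1] [_ p1''C dp1']] [pC p'C dp] [xiC _ _] eqR [pT p'T]]]]].
have rb := ip_rho_bdd P; have db := dual_bdd one_H1.
have HD t : I t -> H1D P (p t) by move=> It; have [] := pC t It.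
have HDu t : I t -> H1D P (u t) by move=> It; have [] := uC t It.
have Hxi t : I t -> H1 mu Om (xi t) by move=> It; have [] := xiC t It.
have Hpsi t : I t -> H1G P (psi t) by move=> It; have [] := psiC t It.
have Lz t : I t -> L2 sg Gam (z t) by move=> It; have [] := zC t It.
have Lu t : I t -> L2v mu Om (u t).1 by move=> It; have [] := u1C t It.
have Lu' t : I t -> L2v mu Om (u' t) by move=> It; have [] := u1'C t It.
have Lp' t : I t -> L2v mu Om (p' t).1 by move=> It; have [] := p1'C t It.
have Lp'' t : I t -> L2v mu Om (p'' t) by move=> It; have [] := p1''C t It.
have rS := ip_rho_semi P.
(* A Wronskian: its derivative is the difference of the two second-order terms, in which the
   first-order products cancel. *)
pose F t := ip_rho P (p' t).1 (u t).1 - emb P (u' t) (p t).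
apply: (@adjoint_int _ T F).
- exact: ltW.
- apply: contID; first exact: (contI_bilin rb p1'C u1C).
  by apply: contIN; exact: (contI_bilin db e'C pC).
- have fC : is_C0 T (H1v mu Om) N1v f by apply: is_C0_sub fU => t _; exact: H1D_H1v.
  have uC' : is_C0 T (H1v mu Om) N1v u by apply: is_C0_sub uC => t _; exact: H1D_H1v.
  exact: (contI_bilin (ip_rhov_bdd one_H1) fC uC').
- exact: (contI_bilin (tr_bdd one_H1) zC xiC).
- have d1 := derI_bilin rb p1'C p1''C dp1' u1C u1'C du.
  have d2 := derI_bilin db e'C e''C de' pC p'C dp.
  apply: derI_eq (derID d1 (derIN d2)) => t It.
  (* The equation for [p] is tested with (u, -psi), the one for [u] with (p, -xi); by [aform_flip]
     the two values of [aform] coincide. *)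
  have wR := sol_R_weak fU Lp'' HD Hxi It (eqR t It) (HDu t It) (subspaceN sH (H1G_H1 (Hpsi t It))).
  have Gxi : H1G P (- xi t).
    apply: (subspaceN (H1G_linsub one_H1)); split; first exact: Hxi.
    by have [] := eqR t It.
  have := eqS t It _ _ (HD t It) Gxi.
  rewrite (aform_flip (H1D_H1v (HDu t It)) (H1G_H1 (Hpsi t It)) (H1D_H1v (HD t It)) (Hxi t It)).
  have -> : ip sg Gam (z t) (tr (- xi t)) = - ip sg Gam (z t) (tr (xi t)).
    by rewrite -scaleN1r (bbZr (tr_bdd one_H1) _ (Hxi t It) (Lz t It)) mulN1r.
  move: wR; rewrite /emb (sip_sym rS (u' t) (p' t).1)//; [|exact: Lu'|exact: Lp'].
  by move=> e1 e2; lra.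
(* [F] vanishes at 0 by the initial conditions of [u] and at [T] by the terminal conditions of
   [p]. *)
- rewrite /F /emb.
  rewrite (sip_sym rS (p' 0).1)//; [|exact: Lp'|exact: Lu].
  rewrite (snorm0P rS (Lu _ I0) (Lp' _ I0)); last first.
    by apply: N1v0_rho => //; apply: H1D_H1v; exact: HDu.
  rewrite (snorm0P rS (Lu' _ I0) (H1v_L2v (H1D_H1v (HD _ I0))))//.
  rewrite (sip_sym rS (u' T))//; [|exact: Lu'|exact: H1v_L2v (H1D_H1v (HD _ IT))].
  have Hp'T : H1D P (p' T) by have [] := p'C _ IT.
  rewrite (snorm0P rS (Lp' _ IT) (Lu _ IT)); last by apply: N1v0_rho => //; exact: H1D_H1v.
  rewrite (snorm0P rS (H1v_L2v (H1D_H1v (HD _ IT))) (Lu' _ IT))//.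
  by apply: N1v0_rho => //; apply: H1D_H1v; exact: HD.
Qed.

End ContinuousAdjoint.

(** * The discrete adjoint identity and the energy estimate for R_h *)

Lemma finite_dim_linsub (R : realType) (V : lmodType R) (B : set V) :
  finite_dim_subspace B -> linsub B.
Proof.
move=> [n [b ->]]; split.
  by exists (fun=> 0); rewrite big1// => i _; rewrite scale0r.
move=> a _ _ [c ->] [c' ->]; exists (fun i => a * c i + c' i).
rewrite scaler_sumr -big_split/=; apply: eq_bigr => i _.
by rewrite scalerDl scalerA.
Qed.

Lemma linsubI (R : realType) (V : lmodType R) (B B' : set V) :
  linsub B -> linsub B' -> linsub (B `&` B').
Proof.
move=> s s'; split; first by split; exact: subspace0.
by move=> a u v [? ?] [? ?]; split; [exact: s.2|exact: s'.2].
Qed.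

Section DiscreteAdjoint.
Context {R : realType} {d : nat} (P : piezo R d).
Local Notation mu := (pz_mu P).
Local Notation Om := (pz_Om P).
Local Notation sg := (pz_sg P).
Local Notation tr := (pz_tr P).
Local Notation T := (pz_T P).
Local Notation Gam := (bdry Om).
Local Notation N1 := (normH1 mu Om).
Local Notation N1v := (normH1v mu Om).
Local Notation I := (`[0, T]%classic : set R).
Variables (Vh : set (vfield R d)) (Wh : set (sfield R d)).
Hypothesis gal : galerkin_spaces P Vh Wh.

(** The Galerkin spaces supply the hypothesis [one_H1] under which the spaces and forms above were
    studied. *)
Lemma galerkin_one_H1 : H1 mu Om (cstf 1).
Proof. by have [_ _ _ WH cW] := gal; apply: WH. Qed.
Let one_H1 := galerkin_one_H1.
Let sH := H1P_linsub one_H1.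
Let sHv := H1vP_linsub one_H1.
Let T0 := pz_T_gt0 P.
Let I0 : I 0. Proof. by rewrite /= in_itv/= lexx ltW. Qed.
Let IT : I T. Proof. by rewrite /= in_itv/= lexx ltW. Qed.
Let VhH : Vh `<=` H1v mu Om.
Proof. by have [_ h _ _ _] := gal; move=> v /h /H1D_H1v. Qed.
Let WhH : Wh `<=` H1 mu Om. Proof. by have [] := gal. Qed.
Let sV : linsub Vh. Proof. by have [h _ _ _ _] := gal; exact: finite_dim_linsub. Qed.
Let sW : linsub (Wh `&` H1G P).
Proof.
have [_ _ h _ _] := gal; apply: linsubI; first exact: finite_dim_linsub.
exact: H1G_linsub.
Qed.

Let VC u : is_C0 T Vh N1v u -> is_C0 T (H1v mu Om) N1v u.
Proof. by apply: is_C0_sub => t _; exact: VhH. Qed.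
Let WC u : is_C0 T (Wh `&` H1G P) N1 u -> is_C0 T (H1 mu Om) N1 u.
Proof. by apply: is_C0_sub => t _ []; move=> /WhH. Qed.

(** All time derivatives now take values in [Vh], so both terms of the Wronskian are products in
    L^2_rho, and each equation may be tested with the other discrete solution. *)
Lemma adjoint_Rh z u psi f p xi : is_C0 T (L2 sg Gam) (nrm sg Gam) z ->
  sol_Sh P Vh Wh z u psi -> Uspace P f -> sol_Rh P Vh Wh f p xi ->
  \int[lebesgue_measure]_(t in I) ip_rho P (f t).1 (u t).1 =
  \int[lebesgue_measure]_(t in I) ip sg Gam (z t) (tr (xi t)).
Proof.
move=> zC [u' [u'' [[[uC u'C du] [_ u''C du']] psiC eqS [u00 u'00]]]].
move=> fU [p' [p'' [[[pC p'C dp] [_ p''C dp']] xiC eqR [pT p'T]]]].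
have rb := ip_rhov_bdd one_H1; have rS := ip_rhov_semi one_H1.
have Vp t : I t -> Vh (p t) by move=> It; have [] := pC t It.
have Vu t : I t -> Vh (u t) by move=> It; have [] := uC t It.
have Vp' t : I t -> Vh (p' t) by move=> It; have [] := p'C t It.
have Vu' t : I t -> Vh (u' t) by move=> It; have [] := u'C t It.
have Wxi t : I t -> (Wh `&` H1G P) (xi t) by move=> It; have [] := xiC t It.
have Wpsi t : I t -> (Wh `&` H1G P) (psi t) by move=> It; have [] := psiC t It.
have Lz t : I t -> L2 sg Gam (z t) by move=> It; have [] := zC t It.
pose F t := ip_rho P (p' t).1 (u t).1 - ip_rho P (u' t).1 (p t).1.
apply: (@adjoint_int _ T F).
- exact: ltW.
- apply: contID; first exact: (contI_bilin rb (VC p'C) (VC uC)).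
  by apply: contIN; exact: (contI_bilin rb (VC u'C) (VC pC)).
- have fC : is_C0 T (H1v mu Om) N1v f by apply: is_C0_sub fU => t _; exact: H1D_H1v.
  exact: (contI_bilin rb fC (VC uC)).
- exact: (contI_bilin (tr_bdd one_H1) zC (WC xiC)).
- have d1 := derI_bilin rb (VC p'C) (VC p''C) dp' (VC uC) (VC u'C) du.
  have d2 := derI_bilin rb (VC u'C) (VC u''C) du' (VC pC) (VC p'C) dp.
  apply: derI_eq (derID d1 (derIN d2)) => t It.
  have wR := eqR t It _ _ (Vu t It) (subspaceN sW (Wpsi t It)).
  have := eqS t It _ _ (Vp t It) (subspaceN sW (Wxi t It)).
  rewrite (aform_flip one_H1 (VhH (Vu t It)) (WhH (Wpsi t It).1) (VhH (Vp t It)) (WhH (Wxi t It).1)).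
  have -> : ip sg Gam (z t) (tr (- xi t)) = - ip sg Gam (z t) (tr (xi t)).
    by rewrite -scaleN1r (bbZr (tr_bdd one_H1) _ (WhH (Wxi t It).1) (Lz t It)) mulN1r.
  move: wR; rewrite (sip_sym rS (u' t) (p' t) (VhH (Vu' t It)) (VhH (Vp' t It))).
  by move=> e1 e2; lra.
- have z1 v w : Vh v -> Vh w -> N1v v = 0 -> ip_rho P v.1 w.1 = 0.
    by move=> /VhH Hv /VhH Hw v0; apply: (snorm0P rS Hv Hw); exact: N1v0_rho.
  have z2 v w : Vh v -> Vh w -> N1v w = 0 -> ip_rho P v.1 w.1 = 0.
    move=> Hv Hw v0; rewrite (sip_sym rS v w (VhH Hv) (VhH Hw)); exact: z1.
  rewrite /F (z2 _ _ (Vp' _ I0) (Vu _ I0))// (z1 _ _ (Vu' _ I0) (Vp _ I0))//.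
  by rewrite (z1 _ _ (Vp' _ IT) (Vu _ IT))// (z2 _ _ (Vu' _ IT) (Vp _ IT)).
Qed.

Lemma Rint_sub_le (h : R -> R) t : I t -> contI T h -> (forall s, I s -> 0 <= h s) ->
  \int[lebesgue_measure]_(s in `[t, T]) h s <= \int[lebesgue_measure]_(s in I) h s.
Proof.
move=> It hC h0; have /andP[t0 tT] : 0 <= t <= T by move: It; rewrite /= in_itv.
have ih := contI_integrable (lexx 0) (lexx T) hC.
have -> : \int[lebesgue_measure]_(s in `[t, T]) h s =
    \int[lebesgue_measure]_(s in `]t, T]) h s.
  rewrite Rintegral_itv_obnd_cbnd//.
  by apply: integrableS ih => //; apply: subset_itv; rewrite bnd_simp.
rewrite -(@Rintegral_itvB _ h (BLeft 0) (BRight T) t) ?bnd_simp//.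
rewrite gerBl; apply: Rintegral_ge0 => s.
by rewrite /= in_itv/= => /andP[s0 st]; apply: h0; rewrite /= in_itv/= s0 (le_trans st tT).
Qed.

(* Twice the energy is ip_rho p' p' + elast p p + coup xi p; the last term equals
   diel xi xi, and symmetry makes it differentiable although [xi] is only
   continuous in time. *)
Lemma energy_Rh f p xi : Uspace P f -> sol_Rh P Vh Wh f p xi ->
  forall t, I t -> diel P (xi t) (xi t) <=
    4 * T * \int[lebesgue_measure]_(s in I) ip_rho P (f s).1 (f s).1.
Proof.
move=> fU [p' [p'' [[[pC p'C dp] [_ p''C dp']] xiC eqR [pT p'T]]]].
(* The final absorption: [y] will be the share of the load in the bound [J] of the energy and [x]
   that of the velocity. *)
have half (x y j : R) : j = y + x -> x <= j / 2 -> j <= 2 * y.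
  by move=> -> h; lra.
have rb := ip_rhov_bdd one_H1; have rS := ip_rhov_semi one_H1.
have eb := elast_bdd one_H1; have eS := elast_semi one_H1.
have cb := coup_bdd one_H1; have dS := diel_semi one_H1.
have Vp t : I t -> Vh (p t) by move=> It; have [] := pC t It.
have Vp' t : I t -> Vh (p' t) by move=> It; have [] := p'C t It.
have Vp'' t : I t -> Vh (p'' t) by move=> It; have [] := p''C t It.
have Wxi t : I t -> (Wh `&` H1G P) (xi t) by move=> It; have [] := xiC t It.
have Hxi t : I t -> H1 mu Om (xi t) by move=> It; exact: (WhH (Wxi t It).1).
have Hf t : I t -> H1v mu Om (f t) by move=> It; have [/H1D_H1v] := fU t It.
have fC : is_C0 T (H1v mu Om) N1v f by apply: is_C0_sub fU => t _; exact: H1D_H1v.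
have HV0 := subspace0 sHv.
(* The equation at time [t] tested with (0, xi s). The right-hand side is symmetric in [s] and [t],
   which is what allows the coupling energy to be differentiated. *)
have coupxi s t : I s -> I t -> coup P (xi s) (p t) = diel P (xi t) (xi s).
  move=> Is It; have := eqR t It _ _ (subspace0 sV) (Wxi s Is).
  have r0 v : H1v mu Om v -> ip_rho P v.1 (0 : vfield R d).1 = 0.
    by move=> Hv; exact: (bb0r rb Hv).
  rewrite r0; last exact: VhH (Vp'' t It).
  rewrite r0 ?add0r; last exact: Hf.
  rewrite aformE//; [|exact: VhH (Vp t It)|exact: Hxi|exact: Hxi].
  rewrite (bb0r eb) ?(bb0r cb) ?add0r; [|exact: Hxi|exact: VhH (Vp t It)].
  by move=> h; lra.
pose E t := ip_rho P (p' t).1 (p' t).1 + elast P (p t) (p t) + coup P (xi t) (p t).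
have EC : contI T E.
  apply: contID; first apply: contID.
  - exact: (contI_bilin rb (VC p'C) (VC p'C)).
  - exact: (contI_bilin eb (VC pC) (VC pC)).
  - exact: (contI_bilin cb (WC xiC) (VC pC)).
have gC : contI T (fun t => 2 * ip_rho P (f t).1 (p' t).1).
  by apply: contIZ; exact: (contI_bilin rb fC (VC p'C)).
(* By [coupxi], [coup (xi s) (p t) = coup (xi t) (p s)]. Subtracting one and adding the other splits
   the increment into two increments of [p] only, each covered by [cvg_bilin_quot]. *)
have dcoup : derI T (fun t => coup P (xi t) (p t)) (fun t => coup P (xi t) (p' t) + coup P (xi t) (p' t)).
  move=> t It.
  have xtC : is_C0 T (H1 mu Om) N1 (fun=> xi t).
    by apply: is_C0_cst (Hxi t It); exact: (snorm0 (ipH1_semi (@Om_open _ _ P) (@Om_bounded _ _ P) (H1_L2 one_H1))).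
  have q1 := cvg_bilin_quot cb (WC xiC) (VC pC) (VC p'C) dp It.
  have q2 := cvg_bilin_quot cb xtC (VC pC) (VC p'C) dp It.
  apply: (cvg_trans _ (cvgD q1 q2)); apply: near_eq_cvg.
  have : \forall s \near within (I `\ t) (nbhs t), (I `\ t) s by apply: withinT.
  apply: filterS => s [Is _] /=.
  have e : coup P (xi s) (p t) = coup P (xi t) (p s).
    by rewrite (coupxi _ _ Is It) (coupxi _ _ It Is) (sip_sym dS)//; exact: Hxi.
  rewrite !fctE -mulrDr e; congr (_ * _).
  by rewrite addrA subrK.
have dE : derI T E (fun t => 2 * ip_rho P (f t).1 (p' t).1).
  have d1 := derI_bilin rb (VC p'C) (VC p''C) dp' (VC p'C) (VC p''C) dp'.
  have d2 := derI_bilin eb (VC pC) (VC p'C) dp (VC pC) (VC p'C) dp.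
  apply: derI_eq (derID (derID d1 d2) dcoup) => t It.
  (* Testing with (p', 0) identifies the derivative of the energy as twice the power of the load. *)
  have := eqR t It _ _ (Vp' t It) (subspace0 sW).
  rewrite aformE//; [|exact: VhH (Vp t It)|exact: Hxi|exact: VhH (Vp' t It)|exact: subspace0].
  rewrite (bb0l cb); last exact: VhH (Vp t It).
  have -> : diel P (xi t) 0 = 0.
    by rewrite (sip_sym dS)// ?(sip0l dS)//; [exact: Hxi|exact: Hxi|exact: subspace0].
  rewrite subr0 addr0 => <-.
  rewrite (sip_sym rS (p' t) (p'' t) (VhH (Vp' t It)) (VhH (Vp'' t It))).
  rewrite (sip_sym eS (p' t) (p t) (VhH (Vp' t It)) (VhH (Vp t It))).
  by ring.
have ET : E T = 0.
  have HpT := VhH (Vp _ IT); have Hp'T := VhH (Vp' _ IT).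
  have bb0 (V : lmodType R) B1 (M1 : V -> R) b v : bdd_bilin B1 M1 (H1v mu Om) N1v b ->
      B1 v -> b v (p T) = 0.
    move=> bP Bv; have [c cP] := bb_bound bP; have := cP v (p T) Bv HpT.
    by rewrite pT !mulr0 normr_le0 => /eqP.
  rewrite /E (bb0 _ _ _ _ _ eb)// (bb0 _ _ _ _ _ cb) ?addr0; last exact: Hxi.
  by apply: (snorm0P rS Hp'T Hp'T); exact: N1v0_rho.
pose a := fun s : R => ip_rho P (p' s).1 (p' s).1.
(* Young's inequality with weight [2 * T]. As [a <= E <= J], the velocity contributes at most
   [T * J / (2 * T) = J / 2] to [J]; absorbing it gives the constant [4 * T]. *)
pose m := fun s : R => 2 * T * ip_rho P (f s).1 (f s).1 + (2 * T)^-1 * a s.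
have aC : contI T a by exact: (contI_bilin rb (VC p'C) (VC p'C)).
have ffC : contI T (fun t => ip_rho P (f t).1 (f t).1) by exact: (contI_bilin rb fC fC).
have mC : contI T m by apply: contID; exact: contIZ.
have a0 t : I t -> 0 <= a t by move=> It; exact: (sip_ge0 rS (VhH (Vp' t It))).
have ff0 t : I t -> 0 <= ip_rho P (f t).1 (f t).1 by move=> It; exact: (sip_ge0 rS (Hf t It)).
have T2 : 0 < 2 * T by rewrite mulr_gt0.
have m0 t : I t -> 0 <= m t.
  move=> It; have i0 : 0 <= (2 * T)^-1 by rewrite invr_ge0 ltW.
  exact: (addr_ge0 (mulr_ge0 (ltW T2) (ff0 t It)) (mulr_ge0 i0 (a0 t It))).
have gm t : I t -> - (2 * ip_rho P (f t).1 (p' t).1) <= m t.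
  move=> It; have Hp := VhH (Vp' t It); have HF := Hf t It.
  have H2f := subspaceZ sHv (2 * T) HF.
  (* The square of [2 * T] times the load plus the velocity, expanded. *)
  have := sip_ge0 rS (subspaceD sHv H2f Hp).
  rewrite (sipDl rS) ?(sipDr rS) ?(sipZl rS) ?(sipZr rS)//; try exact: (subspaceD sHv).
  rewrite (sip_sym rS (p' t) (f t) Hp HF) => h.
  rewrite -(ler_pM2l T2) /m /a mulrDr mulrA.
  have -> : 2 * T * ((2 * T)^-1 * ip_rho P (p' t).1 (p' t).1) = ip_rho P (p' t).1 (p' t).1.
    by rewrite mulrA divff ?mul1r// gt_eqF.
  by move: h; set x := ip_rho P _ _; set y := ip_rho P _ _; set w := ip_rho P _ _ => h; nra.
pose J := \int[lebesgue_measure]_(t in I) m t.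
have Ele t : I t -> E t <= J.
  move=> It; have /andP[t0 tT] : 0 <= t <= T by move: It; rewrite /= in_itv.
  apply: le_trans _ (Rint_sub_le It mC m0).
  (* Integration runs from [t] up to [T], where the energy vanishes by the terminal conditions. *)
  have := FTC_I EC gC dE t0 tT (lexx T); rewrite ET sub0r => /(congr1 -%R); rewrite opprK => <-.
  have ig := contI_integrable t0 (lexx T) gC.
  rewrite -mulN1r -RintegralZl; [|exact: measurable_itv|exact: ig].
  apply: le_Rintegral => //.
  - exact: (integrableZl _ _ ig).
  - exact: contI_integrable.
  - move=> s; rewrite /= in_itv/= => /andP[ts sT]; rewrite mulN1r; apply: gm.
    by rewrite /= in_itv/= (le_trans t0 ts).
have Ea t : I t -> a t <= E t.
  move=> It; rewrite /E -addrA lerDl addr_ge0//; first exact: (sip_ge0 eS (VhH (Vp t It))).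
  by rewrite coupxi//; exact: (sip_ge0 dS (Hxi t It)).
have Ed t : I t -> diel P (xi t) (xi t) <= E t.
  move=> It; rewrite /E (coupxi t t)// lerDr addr_ge0//; first exact: a0.
  exact: (sip_ge0 eS (VhH (Vp t It))).
set FF := \int[lebesgue_measure]_(s in I) ip_rho P (f s).1 (f s).1.
have ia := contI_integrable (lexx 0) (lexx T) aC.
have iff := contI_integrable (lexx 0) (lexx T) ffC.
have JE : J = 2 * T * FF + (2 * T)^-1 * \int[lebesgue_measure]_(s in I) a s.
  rewrite /J /m RintegralD//; [|exact: (integrableZl _ _ iff)|exact: (integrableZl _ _ ia)].
  by rewrite !RintegralZl.
have aJ : \int[lebesgue_measure]_(s in I) a s <= T * J.
  have -> : T * J = \int[lebesgue_measure]_(s in I) J.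
    rewrite Rintegral_cst// mulrC; congr (_ * _).
    transitivity (fine (lebesgue_measure I)); last by [].
    by rewrite lebesgue_measure_itv/= lte_fin T0 oppr0 addr0.
  apply: le_Rintegral => //; first by apply: contI_integrable => //; exact: contI_cst.
  by move=> s Is; apply: le_trans (Ea s Is) (Ele s Is).
move=> t It; apply: le_trans (Ed t It) _; apply: le_trans (Ele t It) _.
have TJ : (2 * T)^-1 * (T * J) = J / 2 by field; rewrite gt_eqF.
have : (2 * T)^-1 * \int[lebesgue_measure]_(s in I) a s <= J / 2.
  by rewrite -TJ ler_wpM2l// invr_ge0 mulr_ge0// ltW.
have -> : 4 * T * FF = 2 * (2 * T * FF) by ring.
exact: half JE.
Qed.

End DiscreteAdjoint.

(** * Null sets and strong measurability in time *)

Section NullSetIntegral.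
Import HBNNSimple.
Context {dd : measure_display} {Y : measurableType dd} {R : realType}.
Variable mu : {measure set Y -> \bar R}.

(* No measurability of the integrands is needed: the integral is a supremum over
   simple functions, which can be cut off on a null set. *)
Lemma ge0_integral_null_le (f g : Y -> \bar R) N : measurable N -> mu N = 0%E ->
  (forall x, 0 <= f x)%E -> (forall x, 0 <= g x)%E -> (forall x, ~ N x -> (f x <= g x)%E) ->
  (\int[mu]_x f x <= \int[mu]_x g x)%E.
Proof.
move=> mN N0 f0 g0 fg; rewrite !ge0_integralTE//.
apply: ge_ereal_sup => _ [h hf <-].
have mCN := measurableC mN.
have -> : sintegral mu h = sintegral mu (proj_nnsfun h mCN).
  have := integral_nnsfun mu measurableT h; rewrite patch_setT => <-.
  have := integral_nnsfun mu measurableT (proj_nnsfun h mCN); rewrite patch_setT => <-.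
  apply: ae_eq_integral => //.
  - by apply/measurable_EFinP; exact: measurable_funTS.
  - by apply/measurable_EFinP; exact: measurable_funTS.
  exists N; split => // x /= H; apply: contrapT => Nx; apply: H => _.
  by rewrite /= mindicE mem_set// mulr1.
apply: ereal_sup_ubound; exists (proj_nnsfun h mCN) => //= x.
rewrite /= mindicE; have [xN|xN] := boolP (x \in ~` N).
  by rewrite mulr1; apply: le_trans (hf x) (fg _ _); exact: set_mem xN.
by rewrite mulr0.
Qed.

(** Allows a strongly measurable function to be changed on a null set inside integrals whose
    integrand is not known to be measurable. *)
Lemma Rint_null_eq (D N : set Y) (f g : Y -> R) : measurable N -> mu N = 0%E ->
  (forall x, D x -> ~ N x -> f x = g x) ->
  \int[mu]_(x in D) f x = \int[mu]_(x in D) g x.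
Proof.
move=> mN N0 fg; congr fine.
have H (p q : Y -> \bar R) : (forall x, 0 <= p x)%E -> (forall x, 0 <= q x)%E ->
    (forall x, ~ N x -> p x = q x) -> (\int[mu]_x p x = \int[mu]_x q x)%E.
  move=> p0 q0 pq; apply/eqP; rewrite eq_le; apply/andP; split;
   by apply: (ge0_integral_null_le mN N0) => // x /pq ->.
rewrite !(integral_mkcond D) integralE [RHS]integralE; congr (_ - _)%E; apply: H => x;
  rewrite ?funepos_ge0 ?funeneg_ge0// => Nx; rewrite ?funepos.unlock ?funeneg.unlock /patch; case: ifPn => // /set_mem Dx;
  by rewrite (fg _ Dx Nx).
Qed.

Lemma ae_mono (p q : Y -> Prop) : (forall x, p x -> q x) ->
  {ae mu, forall x, p x} -> {ae mu, forall x, q x}.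
Proof. by move=> pq; apply: filterS. Qed.

Lemma ae_forall_fin (J : finType) (p : J -> Y -> Prop) :
  (forall i, {ae mu, forall x, p i x}) -> {ae mu, forall x, forall i, p i x}.
Proof. by move=> h; apply: filter_forall. Qed.

Lemma measure_setU0 (A B : set Y) : measurable A -> measurable B ->
  mu A = 0%E -> mu B = 0%E -> mu (A `|` B) = 0%E.
Proof.
move=> mA mB A0 B0; apply/eqP; rewrite -measure_le0.
apply: le_trans (measureU2 _ mA mB) _.
by change (mu A + mu B <= 0)%E; rewrite A0 B0 adde0.
Qed.
End NullSetIntegral.

Section StrongMeasurability.
Context {R : realType} {d : nat}.
Local Notation X := 'rV[R]_d.
Variables (T : R) (sg : {measure set X -> \bar R}) (D : set X).
Hypothesis mD : measurable D.
Local Notation I := (`[0, T]%classic : set R).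
Local Notation L2 := (L2 sg D).
Local Notation ip := (ip sg D).
Local Notation nrm := (nrm sg D).
Local Notation simple := (simple_L2 sg D).
Let iP := ip_semi sg mD.
Let sL := L2_linsub sg mD.

Lemma simple_in s t : simple s -> L2 (s t).
Proof.
move=> [n [A [g [mA Lg ->]]]]; apply: (subspace_sum sL) => i.
by apply: (subspaceZ sL); exact: Lg.
Qed.

Lemma simple_lin a s s' : simple s -> simple s' -> simple (fun t => a *: s t + s' t).
Proof.
move=> [n [A [g [mA Lg sE]]]] [m [B [k [mB Lk sE']]]].
exists (n + m)%N, (fun i => match fintype.split i with inl j => A j | inr j => B j end),
  (fun i => match fintype.split i with inl j => a *: g j | inr j => k j end); split.
- by move=> i; case: fintype.split.
- move=> i; case: fintype.split => j; last exact: Lk.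
  by apply: (subspaceZ sL); exact: Lg.
- move=> t; rewrite sE sE' big_split_ord/= scaler_sumr; congr (_ + _); apply: eq_bigr => i _.
    by rewrite (unsplitK (inl i)) !scalerA mulrC.
  by rewrite (unsplitK (inr i)).
Qed.

Lemma simple_cst v : L2 v -> simple (fun=> v).
Proof.
move=> Lv; exists 1%N, (fun=> setT), (fun=> v); split => // t.
by rewrite big_ord1 indicE mem_set// scale1r.
Qed.

Lemma simple_indic s E : measurable E -> simple s -> simple (fun t => \1_E t *: s t).
Proof.
move=> mE [n [A [g [mA Lg sE]]]]; exists n, (fun i => E `&` A i), g; split => //.
  by move=> i; exact: measurableI.
by move=> t; rewrite sE scaler_sumr; apply: eq_bigr => i _; rewrite scalerA indicI.
Qed.

Lemma simple_ip_sum s v t : L2 v -> forall n (A : 'I_n -> set R) (g : 'I_n -> X -> R^o),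
  (forall i, L2 (g i)) -> s t = \sum_i \1_(A i) t *: g i -> ip (s t) v = \sum_i \1_(A i) t * ip (g i) v.
Proof.
move=> Lv n A g Lg ->.
elim: n A g Lg => [|n IH] A g Lg; first by rewrite !big_ord0; exact: (sip0l iP).
have LS (B : 'I_n -> set R) (k : 'I_n -> X -> R^o) : (forall i, L2 (k i)) -> L2 (\sum_i \1_(B i) t *: k i).
  by move=> Lk; apply: (subspace_sum sL) => i; apply: (subspaceZ sL).
rewrite !big_ord_recl (sipDl iP)//; [|exact: (subspaceZ sL)|exact: LS].
by rewrite (sipZl iP)// IH.
Qed.

Lemma simple_ip_meas E s s' : simple s -> simple s' -> measurable_fun E (fun t => ip (s t) (s' t)).
Proof.
move=> ss [n [A [g [mA Lg sE]]]].
have H v : L2 v -> measurable_fun E (fun t => ip v (s t)).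
  move=> Lv; have [m [B [k [mB Lk sE']]]] := ss.
  apply: (eq_measurable_fun (fun t => \sum_i \1_(B i) t * ip (k i) v)).
    move=> t _; rewrite (sip_sym iP)//; last exact: simple_in.
    by rewrite (simple_ip_sum Lv Lk (sE' t)).
  apply: measurable_sum => i; apply: measurable_funM; last exact: measurable_cst.
  by apply: measurable_funTS; exact: measurable_indic.
apply: (eq_measurable_fun (fun t => \sum_i \1_(A i) t * ip (g i) (s t))).
  move=> t _; rewrite (sip_sym iP (s t))//; [|exact: simple_in|].
    by rewrite (simple_ip_sum (simple_in t ss) Lg (sE t)).
  by apply: simple_in; exists n, A, g.
apply: measurable_sum => i; apply: measurable_funM; last exact: H.
by apply: measurable_funTS; exact: measurable_indic.
Qed.

(* Strongly measurable functions for which the approximation by simple functions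
   holds everywhere; they form a vector space of honest measurable functions. *)
Definition simple_limit (y : R -> X -> R^o) := (forall t, I t -> L2 (y t)) /\
  exists s : nat -> R -> X -> R^o, (forall k, simple (s k)) /\
    forall t, I t -> nrm (s k t - y t) @[k --> \oo] --> (0 : R).

Lemma simple_limit_lin a y w : simple_limit y -> simple_limit w -> simple_limit (fun t => a *: y t + w t).
Proof.
move=> [Ly [s [ss sy]]] [Lw [r [sr rw]]]; split.
  by move=> t It; apply: sL.2; [exact: Ly|exact: Lw].
exists (fun k t => a *: s k t + r k t); split; first by move=> k; exact: simple_lin.
move=> t It.
have c0 : `|a| * nrm (s k t - y t) + nrm (r k t - w t) @[k --> \oo] --> (0 : R).
  rewrite -[X in _ --> X]addr0 -[X in _ --> X + _](mulr0 `|a|).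
  by apply: cvgD; [apply: cvgMr; exact: sy|exact: rw].
apply: (squeeze_cvgr _ (cvg_cst 0) c0); apply: nearW => k; rewrite sqrtr_ge0/=.
have Ls := simple_in t (ss k); have Lr := simple_in t (sr k).
have D1 := subspaceB sL Ls (Ly t It); have D2 := subspaceB sL Lr (Lw t It).
rewrite opprD addrACA -scalerBr; apply: le_trans (snormD iP (subspaceZ sL a D1) D2) _.
by rewrite (snormZ iP).
Qed.

Lemma simple_limit_cst v : L2 v -> simple_limit (fun=> v).
Proof.
move=> Lv; split => //; exists (fun _ _ => v); split; first by move=> _; exact: simple_cst.
move=> t It; rewrite subrr (snorm0 iP : nrm 0 = 0); exact: cvg_cst.
Qed.

Lemma simple_limit_ip_meas y w : simple_limit y -> simple_limit w -> measurable_fun I (fun t => ip (y t) (w t)).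
Proof.
move=> [Ly [s [ss sy]]] [Lw [r [sr rw]]].
apply: (measurable_fun_cvg (h := fun k t => ip (s k t) (r k t))).
  by move=> k; exact: simple_ip_meas.
move=> t It.
have c0 : nrm (s k t - y t) * nrm (r k t - w t) + (nrm (s k t - y t) * nrm (w t) +
    nrm (y t) * nrm (r k t - w t)) @[k --> \oo] --> (0 : R).
  have -> : (0 : R) = 0 * 0 + (0 * nrm (w t) + nrm (y t) * 0) by rewrite !(mulr0, mul0r, addr0).
  apply: cvgD; first by apply: cvgM; [exact: sy|exact: rw].
  by apply: cvgD; [apply: cvgMl; exact: sy|apply: cvgMr; exact: rw].
apply/cvgrPdist_le => e e0; move/cvgrPdist_le: c0 => /(_ e e0).
apply: filterS => k; rewrite sub0r normrN => h; apply: le_trans h; apply: le_trans _ (ler_norm _).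
have Ls := simple_in t (ss k); have Lr := simple_in t (sr k).
have Lyt := Ly t It; have Lwt := Lw t It.
have D1 := subspaceB sL Ls Lyt; have D2 := subspaceB sL Lr Lwt.
rewrite distrC.
have -> : ip (s k t) (r k t) - ip (y t) (w t) =
   ip (s k t - y t) (r k t - w t) + (ip (s k t - y t) (w t) + ip (y t) (r k t - w t)).
  by rewrite !(sipBl iP)// !(sipBr iP)//; ring.
apply: le_trans (ler_normD _ _) _; apply: lerD; first exact: (sip_CS iP).
by apply: le_trans (ler_normD _ _) _; apply: lerD; exact: (sip_CS iP).
Qed.

(** Cutting off on the union of the set where the simple functions fail to converge and the set
    where the mean is wrong turns a.e. statements into statements for every time. *)
Lemma strongly_measurable_simple_limit y : strongly_measurable T sg D y ->
  {ae lebesgue_measure, forall t, t \in `[0, T] -> L20 sg D (y t)} ->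
  exists N : set R, [/\ @measurable _ (measurableTypeR R) N, lebesgue_measure N = 0%E,
    simple_limit (fun t => \1_(~` N) t *: y t) & forall t, I t -> ~ N t -> L20 sg D (y t)].
Proof.
move=> [s [ss [N1 [mN1 N10 H1]]]] [N2 [mN2 N20 H2]].
have Ly t : I t -> ~ (N1 `|` N2) t -> L20 sg D (y t).
  by move=> It Nt; apply: contrapT => Lyt; apply: Nt; right; apply: H2 => /= h; apply: Lyt; exact: h.
exists (N1 `|` N2); split.
- exact: measurableU.
- exact: measure_setU0.
- split.
    move=> t It; rewrite indicE; have [/set_mem tN|] := boolP (t \in ~` (N1 `|` N2)).
      by rewrite scale1r; exact: (Ly t It tN).1.
    by rewrite scale0r => _; exact: (subspace0 sL).
  exists (fun k t => \1_(~` (N1 `|` N2)) t *: s k t); split.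
    by move=> k; apply: simple_indic => //; apply: measurableC; exact: measurableU.
  move=> t It; rewrite indicE; have [/set_mem tN|] := boolP (t \in ~` (N1 `|` N2)).
    have : ~ N1 t by move=> h; apply: tN; left.
    move=> nN; rewrite scale1r; under eq_fun do rewrite scale1r.
    by apply: contrapT => h; apply: nN; apply: H1 => /= /(_ It).
  move=> _; under eq_fun do rewrite !scale0r subrr (snorm0 iP : nrm 0 = 0).
  exact: cvg_cst.
- exact: Ly.
Qed.
End StrongMeasurability.

(** * Weak time derivatives and their uniqueness *)

(** Lebesgue differentiation: almost everywhere [h] is the derivative of its primitive, here a
    constant. *)
Lemma primitive_eq0 (R : realType) (T : R) (h : R -> R) : 0 <= T ->
  lebesgue_measure.-integrable `[0, T] (EFin \o h) ->
  (forall t, `[0, T]%classic t -> \int[lebesgue_measure]_(s in `[0, t]) h s = 0) ->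
  {ae lebesgue_measure, forall t, `[0, T]%classic t -> h t = 0}.
Proof.
move=> T0 ih h0; set I := (`[0, T]%classic : set R).
have mI : @measurable _ (measurableTypeR R) I by exact: measurable_itv.
(* Extending [h] by 0 gives a primitive on the whole line; it vanishes to the left of 0 and is
   constant to the right of [T]. *)
pose F x := \int[lebesgue_measure]_(t in [set` `]-oo, x]]) (h \_ I) t.
have F0 : F = cst 0.
  apply/funext => x; rewrite /F -Rintegral_mkcondr.
  have [x0|x0] := ltP x 0.
    rewrite (_ : _ `&` _ = set0) ?Rintegral_set0//.
    rewrite -subset0 => s [] /=; rewrite /I /= !in_itv/= => sx /andP[s0 _].
    by move: (le_lt_trans (le_trans s0 sx) x0); rewrite ltxx.
  rewrite (_ : _ `&` _ = `[0, Num.min x T]%classic).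
    by apply: h0; rewrite /= in_itv/= le_min x0 T0 ge_min lexx orbT.
  apply/seteqP; split => s /=; rewrite /I /= !in_itv/=.
    by move=> [sx /andP[s0 sT]]; rewrite s0 le_min sx sT.
  by rewrite le_min => /and3P[s0 -> ->]; rewrite s0.
have iT : lebesgue_measure.-integrable setT (EFin \o (h \_ I)).
  by have := (integrable_mkcond _ mI).1 ih; rewrite restrict_EFin.
have iy y : lebesgue_measure.-integrable `]-oo, y] (EFin \o (h \_ I)).
  by apply: integrableS iT.
have := FTC1Ny iy (integrable_locally mI ih).
rewrite -/F F0; apply: ae_mono => t [_]; rewrite derive1_cst => + It.
by rewrite patchE mem_set.
Qed.

Section TimeDerivative.
Context {R : realType} {d : nat}.
Local Notation X := 'rV[R]_d.
Variables (T : R) (sg : {measure set X -> \bar R}) (D : set X).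
Hypotheses (T0 : 0 < T) (mD : measurable D) (one_L2 : L2 sg D (fun=> 1)).
Local Notation I := (`[0, T]%classic : set R).
Local Notation L2 := (L2 sg D).
Local Notation ip := (ip sg D).
Local Notation nrm := (nrm sg D).
Local Notation simple := (simple_L2 sg D).
Local Notation simple_limit := (simple_limit T sg D).
Local Notation L20 := (L20 sg D).
Let iP := ip_semi sg mD.
Let sL := L2_linsub sg mD.
Let mI : @measurable _ (measurableTypeR R) I. Proof. exact: measurable_itv. Qed.
Let I0 : I 0. Proof. by rewrite /= in_itv/= lexx ltW. Qed.

Lemma L20E f : L20 f <-> L2 f /\ ip f (fun=> 1) = 0.
Proof.
by rewrite /Defs.L20 /Defs.ip; under [in X in _ <-> X]eq_Rintegral do rewrite mulr1.
Qed.

Lemma L20_linsub : linsub L20.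
Proof.
split; first by apply/L20E; split; [exact: (subspace0 sL)|exact: (sip0l iP)].
move=> a u v /L20E[Lu u0] /L20E[Lv v0]; apply/L20E; split; first exact: sL.2.
by rewrite (sip_linl iP)// u0 v0 mulr0 addr0.
Qed.

(** Representatives that are good at every time, not just almost every time, so that time integrals
    of [ip] behave as in an L^2 space without further null sets. *)
Definition bochner : set (R -> X -> R^o) := [set y | simple_limit y /\
  lebesgue_measure.-integrable I (EFin \o (fun t => nrm (y t) ^+ 2))].

Definition ipT (E : set R) (y w : R -> X -> R^o) : R :=
  \int[lebesgue_measure]_(t in E) ip (y t) (w t).

Lemma bochner_ip y w : bochner y -> bochner w ->
  lebesgue_measure.-integrable I (EFin \o (fun t => ip (y t) (w t))).
Proof.
move=> [yn yi] [wn wi].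
apply: (@integrable_le _ _ _ lebesgue_measure I mI _ (fun t => nrm (y t) ^+ 2 + nrm (w t) ^+ 2)).
- exact: simple_limit_ip_meas.
- exact: (integrableD mI yi wi).
- move=> t It; apply: le_trans (sip_CS iP (yn.1 t It) (wn.1 t It)) _.
  rewrite !nrmE; set a := snorm _ _; set b := snorm _ _.
  by have := sqr_ge0 (a - b); have := sqr_ge0 (a + b); nra.
Qed.

Lemma bochner_linsub : linsub bochner.
Proof.
split.
  split; first exact: (simple_limit_cst T mD (subspace0 sL)).
  apply: (eq_integrable mI (cst 0%E)); last exact: integrable0.
  by move=> t _ /=; rewrite (snorm0 iP : nrm 0 = 0) expr0n.
move=> a y w yB wB; have [yn yi] := yB; have [wn wi] := wB.
have nn := simple_limit_lin mD a yn wn; split; first exact: nn.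
apply: (@integrable_le _ _ _ lebesgue_measure I mI _
  (fun t => 2 * a ^+ 2 * nrm (y t) ^+ 2 + 2 * nrm (w t) ^+ 2)).
- apply: (eq_measurable_fun (fun t => ip ((a *: y + w) t) ((a *: y + w) t))).
    by move=> t /set_mem It; rewrite nrmE (sqr_snorm iP)//; exact: (nn.1 t It).
  exact: simple_limit_ip_meas.
- exact: (integrableD mI (integrableZl mI _ yi) (integrableZl mI _ wi)).
- move=> t It; rewrite ger0_norm ?sqr_ge0//.
  have Ly := yn.1 t It; have Lw := wn.1 t It.
  have := snormD iP (subspaceZ sL a Ly) Lw; rewrite (snormZ iP)// -!nrmE.
  rewrite -[(a *: y + w) t]/(a *: y t + w t).
  have := sqrtr_ge0 (ip (a *: y t + w t) (a *: y t + w t)); rewrite -/(nrm _).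
  rewrite -(real_normK (num_real a)).
  set n1 := nrm _; set n2 := nrm _; set n3 := nrm _; set b := `|a| => h0 h.
  have h2 : n1 ^+ 2 <= (b * n2 + n3) ^+ 2 by rewrite ler_sqr ?nnegrE//; exact: le_trans h.
  by apply: le_trans h2 _; have := sqr_ge0 (b * n2 - n3); nra.
Qed.

Lemma bochner_cst v : L2 v -> bochner (fun=> v).
Proof.
move=> Lv; split; first exact: simple_limit_cst.
apply: (eq_integrable mI (EFin \o cst (nrm v ^+ 2))) => //.
apply: contI_integrable => //; exact: contI_cst.
Qed.

Lemma ipT_semi E : @measurable _ (measurableTypeR R) E -> E `<=` I -> semi_ip bochner (ipT E).
Proof.
move=> mE EI; split; first exact: bochner_linsub.
- move=> a u v w Bu Bv Bw.
  have iu := integrableS mI mE EI (bochner_ip Bu Bw).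
  have iv := integrableS mI mE EI (bochner_ip Bv Bw).
  rewrite /ipT -RintegralZl// -RintegralD//; last exact: (integrableZl mE a iu).
  apply: eq_Rintegral => t /set_mem /EI It.
  by rewrite -(sip_linl iP)//; [exact: Bu.1.1|exact: Bv.1.1|exact: Bw.1.1].
- move=> u v Bu Bv; apply: eq_Rintegral => t /set_mem /EI It.
  by rewrite (sip_sym iP)//; [exact: Bu.1.1|exact: Bv.1.1].
- move=> u Bu; apply: Rintegral_ge0 => t /EI It; exact: (sip_ge0 iP (Bu.1.1 t It)).
Qed.

(* The exceptional set depends on [v], but the countably many values of the
   approximating simple functions suffice as test functions. *)
Lemma bochner_weak_eq0 w : bochner w ->
  (forall v, L2 v -> forall t, I t -> \int[lebesgue_measure]_(s in `[0, t]) ip (w s) v = 0) ->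
  {ae lebesgue_measure, forall t, I t -> nrm (w t) = 0}.
Proof.
move=> Bw w0; have [[Lw [s [ss sw]]] _] := Bw.
have H v : L2 v -> {ae lebesgue_measure, forall t, I t -> ip (w t) v = 0}.
  move=> Lv; apply: primitive_eq0; first exact: ltW.
    exact: (bochner_ip Bw (bochner_cst Lv)).
  by move=> t It; exact: w0.
(* The values of one simple function lie in the span of finitely many [g i], hence a single null set
   serves for all [t']. *)
have H2 k : {ae lebesgue_measure, forall t, I t -> forall t', ip (w t) (s k t') = 0}.
  have [n [A [g [mA Lg sE]]]] := ss k.
  have : {ae lebesgue_measure, forall t, forall i, I t -> ip (w t) (g i) = 0}.
    by apply: ae_forall_fin => i; exact: H.
  apply: ae_mono => t h It t'.
  rewrite (sip_sym iP)//; [|exact: Lw|exact: simple_in].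
  rewrite (simple_ip_sum mD (Lw t It) Lg (sE t')); apply: big1 => i _.
  by rewrite (sip_sym iP)// ?h ?mulr0//; exact: Lw.
have := ae_foralln H2.
apply: ae_mono => t h It; have Lwt := Lw t It.
(* The approximants are orthogonal to [w t] and converge to it, so [w t] is orthogonal to itself. *)
have : ip (w t) (s k t - w t) @[k --> \oo] --> (0 : R).
  have c0 : nrm (w t) * nrm (s k t - w t) @[k --> \oo] --> (0 : R).
    by rewrite -[X in _ --> X](mulr0 (nrm (w t))); apply: cvgMr; exact: sw.
  apply/cvgrPdist_le => e e0; move/cvgrPdist_le: c0 => /(_ e e0).
  apply: filterS => k; rewrite !sub0r !normrN => hk; apply: le_trans hk; apply: le_trans _ (ler_norm _).
  by apply: (sip_CS iP) => //; apply: (subspaceB sL) => //; exact: simple_in.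
have -> : (fun k => ip (w t) (s k t - w t)) = cst (- ip (w t) (w t)).
  by apply/funext => k; rewrite (sipBr iP)//; [rewrite (h k It) sub0r|exact: simple_in].
move/cvg_lim => /(_ (@Rhausdorff R)); rewrite lim_cst// => /eqP; rewrite oppr_eq0 => /eqP wt.
by rewrite /Defs.nrm wt sqrtr0.
Qed.

(** A time derivative in the sense of [is_tderivative] whose representative lies in [bochner] and
    has zero mean at every time of the interval. *)
Definition nder (z y : R -> X -> R^o) := [/\ bochner y, forall t, I t -> L20 (y t) &
  forall t, I t -> forall v, L2 v ->
    ip (z t) v = ip (z 0) v + \int[lebesgue_measure]_(tau in `[0, t]) ip (y tau) v].

Lemma nder_tder z y : nder z y -> is_tderivative T sg D z y.
Proof.
move=> [[[Ly [s [ss sy]]] yi] y0 zy]; split; last exact: zy.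
split => //; last exact: aeW.
by exists s; split => //; exact: aeW.
Qed.

Lemma tder_nder z y : is_tderivative T sg D z y -> exists2 y', nder z y' &
  {ae lebesgue_measure, forall t, I t -> y t = y' t}.
Proof.
move=> [[ym yL20 yi] zy].
have [N [mN N0 nN Ly]] := strongly_measurable_simple_limit mD ym yL20.
pose y' t := \1_(~` N) t *: y t.
have yy t : ~ N t -> y' t = y t by move=> Nt; rewrite /y' indicE mem_set// scale1r.
have aey : {ae lebesgue_measure, forall t, I t -> y t = y' t}.
  exists N; split => // t /= h; apply: contrapT => Nt; apply: h => _; by rewrite yy.
exists y'; last exact: aey.
split.
- split=> //.
  have /measurable_EFinP ym2 := measurable_int _ yi.
  apply: (integrable_ae_le mI _ yi).
    apply: (eq_measurable_fun (fun t => ip (y' t) (y' t))).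
      by move=> t /set_mem It; rewrite nrmE (sqr_snorm iP)//; exact: nN.1.
    exact: simple_limit_ip_meas.
  by apply: ae_mono aey => t /= h It; rewrite ger0_norm ?sqr_ge0// (h It).
- move=> t It; rewrite /y' indicE; have [/set_mem tN|_] := boolP (t \in ~` N).
    by rewrite scale1r; exact: Ly.
  by rewrite scale0r; exact: (subspace0 L20_linsub).
- move=> t It v Lv; rewrite (zy t It v Lv); congr (_ + _).
  by apply: (Rint_null_eq mN N0) => s _ Ns; rewrite yy.
Qed.

Lemma sub0t t : I t -> `[0, t]%classic `<=` I.
Proof.
by rewrite /= in_itv/= => /andP[t0 tT]; apply: subset_itv; rewrite bnd_simp.
Qed.

Lemma nder_lin a z y z' y' : (forall t, I t -> L2 (z t)) -> (forall t, I t -> L2 (z' t)) ->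
  nder z y -> nder z' y' -> nder (a *: z + z') (a *: y + y').
Proof.
move=> Lz Lz' [By y0 zy] [By' y0' zy']; split.
- exact: bochner_linsub.2.
- by move=> t It; apply: L20_linsub.2; [exact: y0|exact: y0'].
- move=> t It v Lv.
  have Bv := bochner_cst Lv.
  have mt : @measurable _ (measurableTypeR R) `[0, t]%classic by exact: measurable_itv.
  have := sip_linl (ipT_semi mt (sub0t It)) a By By' Bv; rewrite /ipT => ->.
  rewrite -[(a *: z + z') t]/(a *: z t + z' t) -[(a *: z + z') 0]/(a *: z 0 + z' 0).
  rewrite !(sip_linl iP)//; try (by exact: Lz); try (by exact: Lz').
  rewrite (zy t It v Lv) (zy' t It v Lv); ring.
Qed.

Lemma nder_uniq z y y' : nder z y -> nder z y' ->
  {ae lebesgue_measure, forall t, I t -> nrm (y t - y' t) = 0}.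
Proof.
move=> [By y0 zy] [By' y0' zy'].
apply: (@bochner_weak_eq0 (y - y')); first exact: (subspaceB bochner_linsub).
move=> v Lv t It.
have Bv := bochner_cst Lv.
have mt : @measurable _ (measurableTypeR R) `[0, t]%classic by exact: measurable_itv.
have := sipBl (ipT_semi mt (sub0t It)) By By' Bv; rewrite /ipT => ->.
by have := zy t It v Lv; rewrite (zy' t It v Lv) => /addrI ->; rewrite subrr.
Qed.

Lemma ipT_ae_eq y y' w : bochner y -> bochner y' -> bochner w ->
  {ae lebesgue_measure, forall t, I t -> nrm (y t - y' t) = 0} -> ipT I y w = ipT I y' w.
Proof.
move=> By By' Bw h; apply: Rint_ae_eq => //.
- by apply: simple_limit_ip_meas => //; [exact: By.1|exact: Bw.1].
- by apply: simple_limit_ip_meas => //; [exact: By'.1|exact: Bw.1].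
apply: ae_mono h => t h It; have Ly := By.1.1 t It; have Ly' := By'.1.1 t It; have Lw := Bw.1.1 t It.
apply/eqP; rewrite -subr_eq0 -(sipBl iP)//; apply/eqP; apply: (snorm0P iP) => //.
- exact: (subspaceB sL).
- exact: h.
Qed.

(** [dtime] returns an arbitrarily chosen derivative. It agrees with some [nder] almost everywhere,
    and that one agrees with [y] up to null functions, so the norm does not depend on the choice. *)
Lemma normZ_nder z y : nder z y -> normZ T sg D z = Num.sqrt (ipT I y y).
Proof.
move=> zy; congr Num.sqrt.
have dz : is_tderivative T sg D z (dtime T sg D z).
  by apply: xgetPex; exists y; exact: nder_tder.
have [y' zy' yy'] := tder_nder dz.
have [By _ _] := zy; have [By' _ _] := zy'.
have u := nder_uniq zy' zy.
have e1 := ipT_ae_eq By' By By u.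
have e2 := ipT_ae_eq By' By By' u.
rewrite -e1 (sip_sym (ipT_semi mI (@subset_refl _ I)) y' y By' By) -e2 /ipT.
have [_ _ im] := dz.1; have /measurable_EFinP m1 := measurable_int _ im.
apply: (Rint_ae_eq mI m1).
- exact: (simple_limit_ip_meas mD By'.1 By'.1).
- apply: ae_mono yy' => t h It; rewrite (h It); exact: (sqr_snorm iP (By'.1.1 t It)).
Qed.

End TimeDerivative.

(** * The control space *)

Section ZSpace.
Context {R : realType} {d : nat}.
Local Notation X := 'rV[R]_d.
Variables (T : R) (sg : {measure set X -> \bar R}) (D : set X).
Hypotheses (T0 : 0 < T) (mD : measurable D) (one_L2 : L2 sg D (fun=> 1)).
Local Notation I := (`[0, T]%classic : set R).
Local Notation L2 := (L2 sg D).
Local Notation ip := (ip sg D).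
Local Notation nrm := (nrm sg D).
Local Notation L20 := (L20 sg D).
Local Notation ipT := (ipT sg D).
Local Notation nder := (nder T sg D).
Local Notation bochner := (bochner T sg D).
Local Notation Zs := (Zspace T sg D).
Let iP := ip_semi sg mD.
Let sL := L2_linsub sg mD.
Let mI : @measurable _ (measurableTypeR R) I. Proof. exact: measurable_itv. Qed.
Let I0 : I 0. Proof. by rewrite /= in_itv/= lexx ltW. Qed.

Lemma ipT_subset E y : @measurable _ (measurableTypeR R) E -> E `<=` I -> bochner y ->
  ipT E y y <= ipT I y y.
Proof.
move=> mE EI By; have iy := bochner_ip mD By By.
have iE := integrableS mI mE EI iy.
apply: fine_le; [exact: (integrable_fin_num mE iE)|exact: (integrable_fin_num mI iy)|].
apply: ge0_subset_integral => //; first exact: (measurable_int _ iy).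
by move=> t It; rewrite lee_fin; exact: (sip_ge0 iP (By.1.1 t It)).
Qed.

(** Hölder continuity of exponent 1/2. The derivative is known only through its products with fixed
    functions, so the increment itself serves as test function, followed by Cauchy-Schwarz on the
    interval from [s] to [t]. *)
Lemma nder_holder z y s t : (forall t, I t -> L2 (z t)) -> nder z y -> I s -> I t -> s <= t ->
  ip (z t - z s) (z t - z s) <= (t - s) * ipT I y y.
Proof.
move=> Lz [By y0 zy] Is It st.
have Lv := subspaceB sL (Lz t It) (Lz s Is); set v := z t - z s in Lv *.
pose E := (`]s, t]%classic : set R).
have mE : @measurable _ (measurableTypeR R) E by exact: measurable_itv.
have Isu : E `<=` I.
  move: Is It; rewrite /= !in_itv/= => /andP[s0 _] /andP[_ tT].
  by apply: subset_itv; rewrite bnd_simp.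
have Bv := bochner_cst T mD Lv.
have e1 : ip v v = ipT E y (fun=> v).
  rewrite {1}/v (sipBl iP (Lz t It) (Lz s Is) Lv) (zy t It v Lv) (zy s Is v Lv).
  rewrite opprD addrACA subrr add0r /ipT.
  have s0 : 0 <= s by move: Is; rewrite /= in_itv/= => /andP[].
  apply: Rintegral_itvB; [|by rewrite bnd_simp|by rewrite bnd_simp].
  by apply: integrableS (bochner_ip mD By Bv) => //; exact: sub0t.
have e2 : ipT E (fun=> v) (fun=> v) = (t - s) * ip v v.
  rewrite /ipT Rintegral_cst// mulrC; congr (_ * _).
  transitivity (fine (lebesgue_measure E)); first by [].
  rewrite lebesgue_measure_itv/= lte_fin; case: ltP => //= ts.
  by rewrite (le_anti (introT andP (conj st ts))) subrr.
have := sip_sqr_CS (ipT_semi sg mD mE Isu) By Bv; rewrite -e1 e2.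
have v0 := sip_ge0 iP Lv; have Y0 := sip_ge0 (ipT_semi sg mD mI (@subset_refl _ I)) By.
have YE := ipT_subset mE Isu By.
have ts0 : 0 <= t - s by rewrite subr_ge0.
have [->|vn] := eqVneq (ip v v) 0; first by move=> _; rewrite mulr_ge0.
have vp : 0 < ip v v by rewrite lt_neqAle eq_sym vn.
rewrite expr2 mulrA ler_pM2r// => h; apply: le_trans h _.
by rewrite mulrC ler_wpM2l.
Qed.

Lemma Z_L2 z t : Zs z -> I t -> L2 (z t).
Proof. by move=> [[h _] _] It; exact: (h t It).1. Qed.

(** Some good derivative; by [ipZ_nder] the product built from it does not depend on which one. *)
Definition zder (z : R -> X -> R^o) : R -> X -> R^o := xget 0 [set y | nder z y].

Lemma zderP z : Zs z -> nder z (zder z).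
Proof.
move=> [[_ [z' zz']] _]; apply: (xgetPex 0 (P := [set y | nder z y])).
by have [y zy _] := tder_nder mD one_L2 zz'; exists y.
Qed.

Definition ipZ (z w : R -> X -> R^o) : R := ipT I (zder z) (zder w).

Lemma nder_Z z y : (forall t, I t -> L20 (z t)) -> nrm (z 0) = 0 -> nder z y -> Zs z.
Proof. by move=> z0 z00 zy; split => //; split => //; exists y; exact: nder_tder. Qed.

Lemma Z_linsub : linsub Zs.
Proof.
split.
  apply: (@nder_Z 0 0).
  - by move=> t _; exact: (subspace0 (L20_linsub mD one_L2)).
  - exact: (snorm0 iP).
  - split; first exact: (subspace0 (bochner_linsub T sg mD)).
      by move=> t _; exact: (subspace0 (L20_linsub mD one_L2)).
    move=> t It v Lv; transitivity (0 : R); first exact: (sip0l iP Lv).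
    rewrite -[LHS]addr0; congr (_ + _); symmetry; first exact: (sip0l iP Lv).
    transitivity (\int[lebesgue_measure]_(s in `[0, t]) cst (0 : R) s).
      by apply: eq_Rintegral => s _; exact: (sip0l iP Lv).
    by rewrite Rintegral_cst ?mul0r//; exact: measurable_itv.
move=> a z w Hz Hw; apply: (@nder_Z _ (a *: zder z + zder w)).
- move=> t It; apply: (L20_linsub mD one_L2).2; first exact: Hz.1.1.
  exact: Hw.1.1.
- have L1 := Z_L2 Hz I0; have L2' := Z_L2 Hw I0.
  have := snormD iP (subspaceZ sL a L1) L2'; rewrite (snormZ iP)// -!nrmE Hz.2 Hw.2 mulr0 addr0 => h.
  by apply/eqP; rewrite eq_le h sqrtr_ge0.
- apply: (nder_lin T0 mD one_L2) => //; try exact: zderP.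
  + by move=> t It; exact: Z_L2.
  + by move=> t It; exact: Z_L2.
Qed.

Lemma ipZ_nder z w y y' : Zs z -> Zs w -> nder z y -> nder w y' -> ipZ z w = ipT I y y'.
Proof.
move=> Hz Hw zy wy'.
have [B1 _ _] := zderP Hz; have [B2 _ _] := zderP Hw; have [B3 _ _] := zy; have [B4 _ _] := wy'.
have iT := ipT_semi sg mD mI (@subset_refl _ I).
rewrite /ipZ (ipT_ae_eq mD B1 B3 B2 (nder_uniq T0 mD (zderP Hz) zy)).
rewrite (sip_sym iT _ _ B3 B2) (ipT_ae_eq mD B2 B4 B3 (nder_uniq T0 mD (zderP Hw) wy')).
exact: (sip_sym iT _ _ B4 B3).
Qed.

Lemma ipZ_semi : semi_ip Zs ipZ.
Proof.
have iT := ipT_semi sg mD mI (@subset_refl _ I).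
split; first exact: Z_linsub.
- move=> a u v w Hu Hv Hw.
  have [Bu _ _] := zderP Hu; have [Bv _ _] := zderP Hv; have [Bw _ _] := zderP Hw.
  have n := nder_lin T0 mD one_L2 a (fun t It => Z_L2 Hu It) (fun t It => Z_L2 Hv It) (zderP Hu) (zderP Hv).
  rewrite (ipZ_nder (Z_linsub.2 a u v Hu Hv) Hw n (zderP Hw)).
  exact: (sip_linl iT).
- move=> u v Hu Hv; have [Bu _ _] := zderP Hu; have [Bv _ _] := zderP Hv.
  exact: (sip_sym iT).
- by move=> u Hu; have [Bu _ _] := zderP Hu; exact: (sip_ge0 iT).
Qed.

Lemma normZE z : Zs z -> normZ T sg D z = snorm ipZ z.
Proof. by move=> Hz; exact: (normZ_nder T0 mD one_L2 (zderP Hz)). Qed.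

(** Poincaré inequality in time: [nder_holder] between 0 and [t], where [z 0] is a null function. *)
Lemma Z_bound z t : Zs z -> I t -> ip (z t) (z t) <= T * ipZ z z.
Proof.
move=> Hz It; have Lt := Z_L2 Hz It; have L0 := Z_L2 Hz I0.
have /andP[t0 tT] : 0 <= t <= T by move: It; rewrite /= in_itv.
have := nder_holder (fun t It => Z_L2 Hz It) (zderP Hz) I0 It t0.
rewrite -(sqr_snorm iP (subspaceB sL Lt L0)) -(sqr_snorm iP Lt).
have -> : snorm ip (z t - z 0) = snorm ip (z t).
  apply: (nrm0_eq mD); [exact: (subspaceB sL)|exact: Lt|].
  by rewrite addrAC subrr add0r nrmE (snormN iP L0); exact: Hz.2.
rewrite subr0 -/(ipZ z z) => h; apply: le_trans h _.
by apply: ler_wpM2r => //; exact: (sip_ge0 ipZ_semi Hz).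
Qed.

Lemma Z_C0 z : Zs z -> is_C0 T (L2 : set (X -> R^o)) nrm z.
Proof.
move=> Hz t It; have Lt := Z_L2 Hz It; split=> //.
set Y := ipZ z z.
have Y0 : 0 <= Y by exact: (sip_ge0 ipZ_semi Hz).
apply/cvgrPdist_le => e e0.
have sI : \forall s \near within I (nbhs t), I s by apply: withinT.
(* Solves the Hölder estimate for the distance in time; the added 1 covers [Y = 0]. *)
have : \forall s \near within I (nbhs t), `|t - s| <= e ^+ 2 / (Y + 1).
  apply: cvg_within.
  have : s @[s --> t] --> t by exact: cvg_id.
  by move/cvgrPdist_le; apply; rewrite divr_gt0 ?exprn_gt0//; lra.
apply: filterS2 sI => s Is h.
rewrite sub0r normrN ger0_norm ?sqrtr_ge0//.
have Ls := Z_L2 Hz Is.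
have key : ip (z s - z t) (z s - z t) <= e ^+ 2.
  have H r q : I r -> I q -> r <= q -> `|q - r| <= e ^+ 2 / (Y + 1) -> ip (z q - z r) (z q - z r) <= e ^+ 2.
    move=> Ir Iq rq; rewrite ger0_norm ?subr_ge0// => qr.
    apply: le_trans (nder_holder (fun t It => Z_L2 Hz It) (zderP Hz) Ir Iq rq) _.
    have Y1 : 0 < Y + 1 by lra.
    rewrite ler_pdivlMr// in qr; rewrite -/(ipZ z z) -/Y.
    by apply: le_trans qr; apply: ler_wpM2l; [rewrite subr_ge0|lra].
  have [ts|ts] := leP t s; first by apply: H => //; rewrite distrC.
  have := H s t Is It (ltW ts) h.
  by rewrite -!(sqr_snorm iP) ?(snorm_distC iP Lt Ls)//; exact: (subspaceB sL).
by rewrite -(ger0_norm (ltW e0)) -sqrtr_sqr; apply: ler_wsqrtr.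
Qed.

End ZSpace.

(** * Continuous functions of time with an integrated product *)

Section C0Space.
Context {R : realType} (T : R) {V : lmodType R} {B : set V} {b0 : V -> V -> R}.
Local Notation I := (`[0, T]%classic : set R).
Hypothesis b0P : semi_ip B b0.
Let sB := sip_sub b0P.

Lemma is_C0_linsub : linsub [set u : R -> V | is_C0 T B (snorm b0) u].
Proof.
split.
  by apply: is_C0_cst; [exact: (snorm0 b0P)|exact: (subspace0 sB)].
move=> a u v uC vC t It; have [Bu ut] := uC t It; have [Bv vt] := vC t It.
split; first exact: sB.2.
have sI : \forall s \near within I (nbhs t), I s by apply: withinT.
have c0 : `|a| * snorm b0 (u s - u t) + snorm b0 (v s - v t) @[s --> within I (nbhs t)] --> (0 : R).
  rewrite -[X in _ --> X]addr0 -[X in _ --> X + _](mulr0 `|a|).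
  by apply: cvgD; [apply: cvgMr; exact: ut|exact: vt].
apply: (squeeze_cvgr _ (cvg_cst 0) c0); apply: filterS sI => s Is.
rewrite snorm_ge0/=; have [Bus _] := uC s Is; have [Bvs _] := vC s Is.
have D1 := subspaceB sB Bus Bu; have D2 := subspaceB sB Bvs Bv.
rewrite -[(a *: u + v) s]/(a *: u s + v s) -[(a *: u + v) t]/(a *: u t + v t).
rewrite opprD addrACA -scalerBr; apply: le_trans (snormD b0P (subspaceZ sB a D1) D2) _.
by rewrite (snormZ b0P).
Qed.

(** [b0] governs continuity in time and [b] is the form that is integrated. They differ for the
    states, which are continuous into H^1 but measured in L^2_rho. *)
Lemma is_C0_semi b : 0 <= T -> semi_ip B b -> bdd_bilin B (snorm b0) B (snorm b0) b ->
  semi_ip [set u : R -> V | is_C0 T B (snorm b0) u]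
    (fun u v => \int[lebesgue_measure]_(t in I) b (u t) (v t)).
Proof.
move=> T0 bP bB; have mI : @measurable _ (measurableTypeR R) I by exact: measurable_itv.
have H u v : is_C0 T B (snorm b0) u -> is_C0 T B (snorm b0) v ->
  lebesgue_measure.-integrable I (EFin \o (fun t => b (u t) (v t))).
  by move=> uC vC; apply: contI_integrable => //; exact: (contI_bilin bB uC vC).
split; first exact: is_C0_linsub.
- move=> a u v w uC vC wC; rewrite -RintegralZl//; last exact: H.
  rewrite -RintegralD//; [|exact: (integrableZl mI a (H _ _ uC wC))|exact: H].
  apply: eq_Rintegral => t /set_mem It.
  have [Bu _] := uC t It; have [Bv _] := vC t It; have [Bw _] := wC t It.
  exact: (sip_linl bP).
- move=> u v uC vC; apply: eq_Rintegral => t /set_mem It.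
  by have [Bu _] := uC t It; have [Bv _] := vC t It; exact: (sip_sym bP).
- move=> u uC; apply: Rintegral_ge0 => t It.
  by have [Bu _] := uC t It; exact: (sip_ge0 bP).
Qed.
End C0Space.

(** * The projection onto piecewise constants *)

Section Projection.
Context {R : realType} {d : nat} (P : piezo R d).
Local Notation X := 'rV[R]_d.
Local Notation sg := (pz_sg P).
Local Notation T := (pz_T P).
Local Notation Gam := (bdry (pz_Om P)).
Local Notation I := (`[0, T]%classic : set R).
Local Notation L2 := (L2 sg Gam).
Local Notation ip := (ip sg Gam).
Local Notation nrm := (nrm sg Gam).
Local Notation L20 := (L20 sg Gam).
Local Notation ipT := (ipT sg Gam).
Local Notation nder := (nder T sg Gam).
Local Notation Zs := (Zspace T sg Gam).
Local Notation ipZ := (ipZ T sg Gam).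
Local Notation zder := (zder T sg Gam).
Hypothesis one_L2 : L2 (fun=> 1).
Variables (n : nat) (K : 'I_n -> set X) (Pi : (X -> R^o) -> X -> R^o).
Hypothesis PiP : is_L2proj P K Pi.
Let T0 := pz_T_gt0 P.
Let mD := Gam_measurable P.
Let iP := ip_semi sg mD.
Let sL := L2_linsub sg mD.
Let mI : @measurable _ (measurableTypeR R) I. Proof. exact: measurable_itv. Qed.
Let I0 : I 0. Proof. by rewrite /= in_itv/= lexx ltW. Qed.

Lemma P0_L2 f : P0 P K f -> L2 f. Proof. by case. Qed.

Lemma P0_linsub : linsub (P0 P K).
Proof.
split.
  split; first exact: (subspace0 sL).
  by exists (fun=> 0); exact: aeW.
move=> a u v [Lu [c cu]] [Lv [e ev]]; split; first exact: sL.2.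
exists (fun i => a * c i + e i); apply: filterS2 cu ev => x cu ev i Kx.
by rewrite !fctE (cu i Kx) (ev i Kx).
Qed.

Lemma Pi_P0 f : L2 f -> P0 P K (Pi f). Proof. by move=> /PiP[]. Qed.
Lemma Pi_L2 f : L2 f -> L2 (Pi f). Proof. by move=> /Pi_P0/P0_L2. Qed.
Lemma Pi_orth f q : L2 f -> P0 P K q -> ip (Pi f) q = ip f q.
Proof.
move=> Lf Pq; have [_ /(_ q Pq)] := PiP Lf.
have LP := P0_L2 (Pi_P0 Lf); have Lq := P0_L2 Pq.
by rewrite (sipBl iP Lf LP Lq) => /eqP; rewrite subr_eq0 => /eqP.
Qed.
Lemma Pi_sym f g : L2 f -> L2 g -> ip (Pi f) g = ip f (Pi g).
Proof.
move=> Lf Lg; rewrite -(Pi_orth Lf (Pi_P0 Lg)) (sip_sym iP _ g (Pi_L2 Lf) Lg).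
by rewrite -(Pi_orth Lg (Pi_P0 Lf)) (sip_sym iP)//; exact: Pi_L2.
Qed.

(* Membership in P0 and orthogonality determine the projection. *)
Lemma proj_contr f f' g g' : L2 f -> L2 g -> P0 P K f' -> P0 P K g' ->
  (forall q, P0 P K q -> ip f' q = ip f q) -> (forall q, P0 P K q -> ip g' q = ip g q) ->
  nrm (f' - g') <= nrm (f - g).
Proof.
move=> Lf Lg Pf Pg of_ og; have Lf' := P0_L2 Pf; have Lg' := P0_L2 Pg.
have Pd := subspaceB P0_linsub Pf Pg; have Ld := P0_L2 Pd.
have Lfg := subspaceB sL Lf Lg.
have e : ip (f' - g') (f' - g') = ip (f - g) (f' - g').
  by rewrite (sipBl iP Lf' Lg' Ld) (sipBl iP Lf Lg Ld) of_// og.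
have := sip_CSr iP Lfg Ld; rewrite -e -(sqr_snorm iP Ld) -!nrmE expr2.
have [->|n0] := eqVneq (nrm (f' - g')) 0; first by move=> _; exact: sqrtr_ge0.
by rewrite ler_pM2r// lt_neqAle eq_sym n0 sqrtr_ge0.
Qed.

(** [Pi] picks representatives and is linear only up to null functions, so the difference of two
    projections is estimated through their characterisation. *)
Lemma Pi_contr f g : L2 f -> L2 g -> nrm (Pi f - Pi g) <= nrm (f - g).
Proof.
by move=> Lf Lg; apply: proj_contr => //; try exact: Pi_P0; move=> q; exact: Pi_orth.
Qed.

Lemma P0_one : P0 P K (fun=> 1).
Proof. by split => //; exists (fun=> 1); exact: aeW. Qed.

(** Constants are piecewise constant, so the projection preserves the mean. *)
Lemma Pi_L20 f : L20 f -> L20 (Pi f).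
Proof.
move=> /L20E[Lf f0]; apply/L20E; split; first exact: Pi_L2.
by rewrite Pi_orth//; exact: P0_one.
Qed.

Lemma Pi_nrm f : L2 f -> nrm (Pi f) <= nrm f.
Proof.
move=> Lf; have P00 := subspace0 P0_linsub.
have := @proj_contr f (Pi f) 0 0 Lf (subspace0 sL) (Pi_P0 Lf) P00.
rewrite !subr0; apply => //; move=> q; exact: Pi_orth.
Qed.

Lemma Pi_C0 z : is_C0 T (L2 : set (X -> R^o)) nrm z ->
  is_C0 T (L2 : set (X -> R^o)) nrm (fun t => Pi (z t)).
Proof.
move=> zC t It; have [Lt zt] := zC t It; split; first exact: Pi_L2.
have sI : \forall s \near within I (nbhs t), I s by apply: withinT.
apply: (squeeze_cvgr _ (cvg_cst 0) zt); apply: filterS sI => s Is.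
by rewrite sqrtr_ge0/=; apply: Pi_contr => //; have [] := zC s Is.
Qed.

(** Since [Pi] may fail to commute with sums on a null set, the projected simple function is
    assembled from the [Pi (g i)] and identified by membership and orthogonality, as [proj_contr]
    requires. *)
Lemma simple_proj s : simple_L2 sg Gam s -> exists2 s', simple_L2 sg Gam s' &
  forall t, P0 P K (s' t) /\ forall q, P0 P K q -> ip (s' t) q = ip (s t) q.
Proof.
move=> [m [A [g [mA Lg sE]]]].
pose s' t : X -> R^o := \sum_i \1_(A i) t *: Pi (g i).
exists s'; first by exists m, A, (fun i => Pi (g i)); split => // i; exact: Pi_L2.
move=> t; split.
  by apply: (subspace_sum P0_linsub) => i; apply: (subspaceZ P0_linsub); exact: Pi_P0.
move=> q Pq; have Lq := P0_L2 Pq.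
rewrite (simple_ip_sum mD Lq Lg (sE t)).
rewrite (simple_ip_sum (s := s') (t := t) mD Lq (fun i => Pi_L2 (Lg i)) erefl).
by apply: eq_bigr => i _; rewrite Pi_orth.
Qed.

Lemma Pi_bochner y : bochner T sg Gam y -> bochner T sg Gam (fun t => Pi (y t)).
Proof.
move=> [[Ly [s [ss sy]]] yi].
have nn : simple_limit T sg Gam (fun t => Pi (y t)).
  split; first by move=> t It; apply: Pi_L2; exact: Ly.
  have /choice [s' s'P] : forall k, exists s', simple_L2 sg Gam s' /\
      forall t, P0 P K (s' t) /\ forall q, P0 P K q -> ip (s' t) q = ip (s k t) q.
    by move=> k; have [s' h1 h2] := simple_proj (ss k); exists s'.
  exists s'; split; first by move=> k; have [] := s'P k.
  move=> t It; apply: (squeeze_cvgr _ (cvg_cst 0) (sy t It)); apply: nearW => k.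
  rewrite sqrtr_ge0/=; have [_ /(_ t)[Ps os]] := s'P k.
  apply: proj_contr => //; [exact: simple_in|exact: Ly|exact: Pi_P0 (Ly t It)|].
  by move=> q; apply: Pi_orth; exact: Ly.
split => //; apply: (@integrable_le _ _ _ lebesgue_measure I mI _ (fun t => nrm (y t) ^+ 2)) => //.
- apply: (eq_measurable_fun (fun t => ip (Pi (y t)) (Pi (y t)))).
    by move=> t /set_mem It; rewrite nrmE (sqr_snorm iP)//; exact: nn.1.
  exact: simple_limit_ip_meas.
- move=> t It; rewrite ger0_norm ?sqr_ge0// ler_sqr ?nnegrE ?sqrtr_ge0//.
  by apply: Pi_nrm; exact: Ly.
Qed.

(** Self-adjointness moves [Pi] onto the test function, hence the projection commutes with the weak
    time derivative. *)
Lemma Pi_nder z y : (forall t, I t -> L2 (z t)) -> nder z y ->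
  nder (fun t => Pi (z t)) (fun t => Pi (y t)).
Proof.
move=> Lz [By y0 zy]; split; first exact: Pi_bochner.
  by move=> t It; apply: Pi_L20; exact: y0.
move=> t It v Lv; rewrite !Pi_sym//; [|exact: Lz|exact: Lz].
rewrite (zy t It _ (Pi_L2 Lv)); congr (_ + _); apply: eq_Rintegral => s /set_mem /(sub0t It) Is.
by rewrite Pi_sym//; exact: By.1.1.
Qed.

Lemma Pi_Z z : Zs z -> Zs (fun t => Pi (z t)).
Proof.
move=> Hz; have Lz t := Z_L2 (t := t) Hz; apply: (nder_Z _ _ (Pi_nder Lz (zderP mD one_L2 Hz))).
- by move=> t It; apply: Pi_L20; exact: Hz.1.1.
- by apply/eqP; rewrite eq_le sqrtr_ge0 andbT -[leRHS]Hz.2; apply: Pi_nrm; exact: Lz.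
Qed.

(** The positive part [g] of [s * Pi f - M] is again piecewise constant, so in its product with
    [s * Pi f - M] the projection may be dropped: [|g|^2 = (s * f - M, g) <= 0]. With [s] equal to 1
    and -1 this covers the upper and the lower bound. *)
Lemma Pi_bound s M f : L2 f -> {ae sg, forall x, Gam x -> s * f x <= M} ->
  {ae sg, forall x, Gam x -> s * Pi f x <= M}.
Proof.
move=> Lf fM; have LP := Pi_L2 Lf; have [_ [c cP]] := Pi_P0 Lf.
pose w x : R^o := s * Pi f x - M; pose g x : R^o := Num.max (w x) 0.
have P1 := P0_one.
have wE : w = s *: Pi f + (- M) *: ((fun=> 1) : X -> R^o).
  by apply/funext => x; rewrite /w !fctE /GRing.scale/= mulr1.
have Lw : L2 w by rewrite wE; apply: sL.2 => //; apply: (subspaceZ sL).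
have Lg : L2 g.
  split; first by apply: measurable_maxr; [exact: L2_measurable Lw|exact: measurable_cst].
  apply: (@integrable_le _ _ _ sg Gam mD _ (fun x => w x ^+ 2)).
  - by apply: measurable_funX; apply: measurable_maxr; [exact: L2_measurable Lw|exact: measurable_cst].
  - exact: Lw.2.
  - move=> x _; rewrite ger0_norm ?sqr_ge0// /g; case: (leP (w x) 0) => // _.
    by rewrite expr0n sqr_ge0.
have Pg : P0 P K g.
  split => //; exists (fun i => Num.max (s * c i - M) 0).
  by apply: filterS cP => x h i Kx; rewrite /g /w (h i Kx).
pose w' : X -> R^o := s *: f + (- M) *: ((fun=> 1) : X -> R^o).
have Lw' : L2 w' by apply: sL.2 => //; apply: (subspaceZ sL).
have e1 : ip g g = ip w' g.
  transitivity (ip w g).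
    apply: eq_Rintegral => x _; rewrite /g; case: (leP (w x) 0) => h; last by [].
    by rewrite !mulr0.
  have L1 : L2 ((- M) *: ((fun=> 1) : X -> R^o)) by apply: (subspaceZ sL).
  by rewrite wE /w' !(sip_linl iP)// Pi_orth.
have e2 : ip w' g <= 0.
  rewrite -oppr_ge0 -(sipNl iP)//; apply: Rint_ae_ge0 => //.
    by apply: measurable_funM; [exact: L2_measurable (subspaceN sL Lw')|exact: L2_measurable Lg].
  apply: filterS fM => x h Gx; rewrite mulr_ge0//; last by rewrite /g le_max lexx orbT.
  by rewrite !fctE /w' !fctE /GRing.scale/= mulr1 oppr_ge0 subr_le0 h.
have g0 : nrm g = 0.
  by apply/eqP; rewrite sqrtr_eq0 e1.
apply: filterS (nrm0_ae mD Lg g0) => x h Gx; have := h Gx; rewrite /g => /eqP.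
by case: (leP (w x) 0) => [w0 _|w0 /eqP w1]; [rewrite -subr_le0|move: w0; rewrite w1 ltxx].
Qed.

Lemma Pi_Zad za zb z : Zad P za zb z -> Zad P za zb (fun t => Pi (z t)).
Proof.
move=> [Hz b]; split; first exact: Pi_Z.
move=> t It; have Lz := Z_L2 Hz It; have bt := b t It.
have h1 := @Pi_bound 1 zb (z t) Lz.
have h2 := @Pi_bound (-1) (- za) (z t) Lz.
have {}h1 : {ae sg, forall x, Gam x -> 1 * Pi (z t) x <= zb}.
  by apply: h1; apply: filterS bt => x h Gx; rewrite mul1r; have /andP[] := h Gx.
have {}h2 : {ae sg, forall x, Gam x -> -1 * Pi (z t) x <= - za}.
  by apply: h2; apply: filterS bt => x h Gx; rewrite mulN1r lerN2; have /andP[] := h Gx.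
apply: filterS2 h1 h2 => x h1 h2 Gx.
by have := h1 Gx; have := h2 Gx; rewrite mul1r mulN1r lerN2 => -> ->.
Qed.

Lemma Pi_Zh z : Zs z -> Zh P K (fun t => Pi (z t)).
Proof.
by move=> Hz; split; [exact: Pi_Z|move=> t It; apply: Pi_P0; exact: Z_L2 Hz It].
Qed.

(** The derivative of [zh] may be taken piecewise constant, and it is then orthogonal at every time
    to the projection error of the derivative of [z]. *)
Lemma Zh_orth z zh : Zs z -> Zh P K zh -> ipZ zh ((fun t => Pi (z t)) - z) = 0.
Proof.
move=> Hz [Hzh Pzh]; have HPz := Pi_Z Hz.
have nz := zderP mD one_L2 Hz; have nzh := zderP mD one_L2 Hzh.
have Lz t := Z_L2 (t := t) Hz; have Lzh t := Z_L2 (t := t) Hzh.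
have [Bz _ _] := nz; have [Bzh _ _] := nzh.
(* [Pi (zh s)] and [zh s] differ by a null function, so the projected derivative is again a
   derivative of [zh]. *)
have n1 : nder zh (fun t => Pi (zder zh t)).
  have [B1 y1 e1] := Pi_nder Lzh nzh; split => // t It v Lv.
  have E s : I s -> ip (Pi (zh s)) v = ip (zh s) v.
    move=> Is; have Ls := Lzh s Is; have Ps := Pzh s Is.
    have z0 : nrm (Pi (zh s) - zh s) = 0.
      apply/eqP; rewrite eq_le sqrtr_ge0 andbT.
      have := @proj_contr (zh s) (Pi (zh s)) (zh s) (zh s) Ls Ls (Pi_P0 Ls) Ps.
      by rewrite subrr (snorm0 iP : nrm 0 = 0); apply => // q; exact: Pi_orth.
    apply/eqP; rewrite -subr_eq0 -(sipBl iP)//; last exact: Pi_L2.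
    by apply/eqP; apply: (snorm0P iP) => //; apply: (subspaceB sL) => //; exact: Pi_L2.
  by rewrite -(E t It) (e1 t It v Lv) (E 0 I0).
have n2 := nder_lin T0 mD one_L2 (-1) Lz (fun t It => Pi_L2 (Lz t It)) nz (Pi_nder Lz nz).
have -> : (fun t => Pi (z t)) - z = -1 *: z + (fun t => Pi (z t)).
  by rewrite scaleN1r [LHS]addrC.
have Hd : Zs (-1 *: z + (fun t => Pi (z t))) by exact: (Z_linsub T0 mD one_L2).2.
rewrite (ipZ_nder T0 mD one_L2 Hzh Hd n1 n2).
rewrite /ipT (@eq_Rintegral _ _ _ lebesgue_measure I (cst 0)).
  by rewrite Rintegral_cst ?mul0r.
move=> t /set_mem It; have L1 := Bz.1.1 t It; have L2h := Bzh.1.1 t It.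
rewrite -[(-1 *: zder z + _) t]/(-1 *: zder z t + Pi (zder z t)).
have LP := Pi_L2 L2h.
rewrite (sip_sym iP)//; last by apply: sL.2 => //; exact: Pi_L2.
rewrite (sip_linl iP)//; last exact: Pi_L2.
by rewrite (Pi_orth L1 (Pi_P0 L2h)) mulN1r addNr.
Qed.

End Projection.

(** * Completeness of L^2 and the Banach-Steinhaus theorem *)

Lemma geometric_half_sum (R : realType) (s : R) n :
  \sum_(0 <= k < n) s * 2^-1 ^+ k = 2 * s - 2 * s * 2^-1 ^+ n.
Proof.
elim: n => [|n IH]; first by rewrite big_geq// expr0 mulr1 subrr.
by rewrite big_nat_recr//= IH exprS; field.
Qed.

Lemma series_geometric_le (R : realType) (c : nat -> R) (s : R) : 0 <= s ->
  (forall k, `|c k| <= s * 2^-1 ^+ k) ->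
  exists2 l, \sum_(0 <= k < n) c k @[n --> \oo] --> l & `|l| <= 2 * s.
Proof.
move=> s0 cs.
have cc : cvgn (series c).
  apply: normed_cvg; apply: (@series_le_cvg _ _ (geometric s 2^-1)).
  - by move=> k; exact: normr_ge0.
  - move=> k; apply: (mulr_ge0 s0); by rewrite exprn_ge0// invr_ge0.
  - exact: cs.
  - by apply: is_cvg_geometric_series; rewrite ger0_norm ?invr_ge0// invf_lt1// ltr1n.
exists (limn (series c)); first exact: cc.
have cN : cvgn (fun n => `|series c n|) by exact: is_cvg_norm.
have -> : `|limn (series c)| = limn (fun n => `|series c n|).
  by apply/esym/cvg_lim => //; exact: cvg_norm.
apply: limr_le => //; apply: nearW => n.
apply: le_trans (ler_norm_sum _ _ _) _.
apply: le_trans (ler_sum _ (fun k _ => cs k)) _.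
rewrite geometric_half_sum gerBl; apply: mulr_ge0; first exact: mulr_ge0.
by rewrite exprn_ge0// invr_ge0.
Qed.

Section L2Complete.
Context {R : realType} {d : nat}.
Local Notation X := 'rV[R]_d.
Variables (mu : {measure set X -> \bar R}) (D : set X).
Hypothesis mD : measurable D.
Local Notation L2 := (L2 mu D).
Local Notation ip := (ip mu D).
Local Notation nrm := (nrm mu D).
Let iP := ip_semi mu mD.

(** The weighted sum [G] of the [4^k * c k^2] has integral at most 2, hence is finite almost
    everywhere. Where it is, [|c k|] is at most [2^-k] times the root of [G], so the series
    converges absolutely to a sum bounded by twice that root. *)
Lemma L2_series_sum (c : nat -> X -> R^o) : (forall k, L2 (c k)) ->
  (forall k, nrm (c k) <= 2^-1 ^+ (3 * k)) ->
  exists f : X -> R^o, [/\ L2 f, nrm f <= 3 &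
    {ae mu, forall x, D x -> \sum_(0 <= k < n) c k x @[n --> \oo] --> f x}].
Proof.
move=> Lc nc.
pose h k x : \bar R := (4 ^+ k * (c k x * c k x))%:E.
have h0 k x : (0 <= h k x)%E by rewrite lee_fin mulr_ge0 ?exprn_ge0// -expr2 sqr_ge0.
have mh k : measurable_fun D (h k).
  apply/measurable_EFinP; apply: measurable_funM; first exact: measurable_cst.
  by apply: measurable_funM; exact: L2_measurable (Lc k).
pose G x : \bar R := (\sum_(k <oo) h k x)%E.
have G0 x : (0 <= G x)%E by apply: nneseries_ge0.
have mG : measurable_fun D G by apply: ge0_emeasurable_sum.
have intG : (\int[mu]_(x in D) G x <= 2%:E)%E.
  rewrite integral_nneseries//.
  apply: lime_le; first by apply: is_cvg_nneseries => k _ _; exact: integral_ge0.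
  apply: nearW => n.
  have hk k : (\int[mu]_(x in D) h k x)%E = (4 ^+ k * ip (c k) (c k))%:E.
    have ih := integrableZl mD (4 ^+ k) (L2_mul mD (Lc k) (Lc k)).
    rewrite /Defs.ip -RintegralZl//; last exact: L2_mul.
    by rewrite fineK//; exact: (integrable_fin_num mD ih).
  under eq_bigr do rewrite hk; rewrite sumEFin lee_fin.
  apply: (@le_trans _ _ (\sum_(0 <= k < n) 1 * 2^-1 ^+ k)).
    apply: ler_sum => k _; rewrite mul1r -(sqr_snorm iP (Lc k)) -nrmE.
    have n2 : nrm (c k) ^+ 2 <= (2^-1 ^+ (3 * k)) ^+ 2.
      by rewrite ler_sqr ?nnegrE ?sqrtr_ge0 ?exprn_ge0 ?invr_ge0.
    apply: le_trans (ler_wpM2l _ n2) _; first exact: exprn_ge0.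
    have -> : (4 : R) = 2 ^+ 2 by rewrite -natrX.
    rewrite -!exprM !exprVn -[X in X <= _]/(2 ^+ (2 * k) / 2 ^+ (3 * k * 2)).
    rewrite ler_pdivrMr ?exprn_gt0// mulrC ler_pdivlMr ?exprn_gt0//.
    rewrite -exprD; apply: ler_weXn2l; first by rewrite ler1n.
    by lia.
  by rewrite geometric_half_sum mulr1 gerBl mulr_ge0// exprn_ge0// invr_ge0.
have iG : mu.-integrable D G.
  apply/integrableP; split => //.
  rewrite (eq_integral G); last by move=> x _; rewrite gee0_abs.
  exact: le_lt_trans intG (ltry _).
have aeG := integrable_ae mD iG.
pose E := [set x | (G x < +oo)%E].
have key x : E x -> exists2 l, \sum_(0 <= k < n) c k x @[n --> \oo] --> l & `|l| <= 2 * Num.sqrt (fine (G x)).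
  move=> Ex; have Gf : G x \is a fin_num by rewrite ge0_fin_numE.
  apply: series_geometric_le; first exact: sqrtr_ge0.
  move=> k; rewrite -sqrtr_sqr.
  have -> : (2^-1 ^+ k : R) = Num.sqrt ((2^-1 ^+ k) ^+ 2).
    by rewrite sqrtr_sqr ger0_norm// exprn_ge0// invr_ge0.
  rewrite -sqrtrM ?fine_ge0//; apply: ler_wsqrtr.
  rewrite -exprM mulnC exprM exprVn.
  have -> : (2 ^+ 2 : R) = 4 by rewrite -natrX.
  rewrite exprVn ler_pdivlMr ?exprn_gt0// mulrC.
  rewrite -lee_fin fineK// expr2.
  have := @nneseries_lim_ge R (h ^~ x) xpredT 0 k.+1 (fun n _ _ => h0 n x).
  apply: le_trans; rewrite big_nat_recr//= leeDr//.
  by apply: sume_ge0.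
(* The value 0 where [G] is infinite makes [f] the limit of the partial sums cut off there, hence
   measurable. *)
pose f x : R^o := if pselect (E x) is left Ex then sval (cid2 (key x Ex)) else 0.
have fE x : E x -> \sum_(0 <= k < n) c k x @[n --> \oo] --> f x /\ `|f x| <= 2 * Num.sqrt (fine (G x)).
  by rewrite /f; case: pselect => // Ex _; case: cid2.
have fN x : ~ E x -> f x = 0 by rewrite /f; case: pselect.
have mE : measurable (D `&` E).
  by apply: emeasurable_fun_infty_o.
have mf : measurable_fun D f.
  apply: (measurable_fun_cvg (h := fun n x => \1_(D `&` E) x * \sum_(0 <= k < n) c k x)).
    move=> n; apply: measurable_funM; first by apply: measurable_funTS; exact: measurable_indic.
    by apply: measurable_sum => k; exact: L2_measurable (Lc k).
  move=> x Dx; rewrite indicE; have [/set_mem[_ Ex]|xE] := boolP (x \in D `&` E).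
    under eq_fun do rewrite mul1r.
    exact: (fE x Ex).1.
  under eq_fun do rewrite mul0r.
  rewrite fN; first exact: cvg_cst.
  by move=> Ex; move/negP: xE; apply; exact/mem_set.
have f2 x : D x -> ((f x * f x)%:E <= 4%:E * G x)%E.
  move=> Dx; rewrite -expr2.
  have [Ex|/fN ->] := pselect (E x); last by rewrite expr0n mule_ge0// lee_fin.
  have Gf : G x \is a fin_num by rewrite ge0_fin_numE.
  rewrite -(fineK Gf) -EFinM lee_fin -[f x ^+ 2]ger0_norm ?sqr_ge0// normrX.
  have [_ h2] := fE x Ex.
  have : `|f x| ^+ 2 <= (2 * Num.sqrt (fine (G x))) ^+ 2.
    by rewrite ler_sqr ?nnegrE// mulr_ge0// sqrtr_ge0.
  by rewrite exprMn sqr_sqrtr ?fine_ge0// -natrX.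
have mf2 : measurable_fun D (fun x => (f x * f x)%:E).
  by apply/measurable_EFinP; exact: measurable_funM.
have i4 : mu.-integrable D (fun x => 4%:E * G x)%E by exact: integrableZl.
have if2 : mu.-integrable D (fun x => (f x * f x)%:E).
  apply: (le_integrable mD mf2 _ i4) => x Dx.
  rewrite [leRHS]gee0_abs; last by rewrite mule_ge0// lee_fin.
  by rewrite gee0_abs ?f2// lee_fin -expr2 sqr_ge0.
exists f; split.
- by split.
(* The integral of the square is at most 4 times 2, and 8 is below the square of 3. *)
- rewrite /Defs.nrm -[3]ger0_norm// -sqrtr_sqr; apply: ler_wsqrtr.
  have le1 : (\int[mu]_(x in D) (f x * f x)%:E <= 8%:E)%E.
    apply: (@le_trans _ _ (\int[mu]_(x in D) (4%:E * G x))%E).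
      apply: ge0_le_integral => //.
      + by move=> x Dx; rewrite lee_fin -expr2 sqr_ge0.
      + exact: (measurable_int _ i4).
    rewrite ge0_integralZl//.
    have -> : (8%:E = 4%:E * 2%:E :> \bar R)%E by rewrite -EFinM -natrM.
    by rewrite lee_pmul2l// lte_fin.
  rewrite -lee_fin /Defs.ip fineK; last exact: (integrable_fin_num mD if2).
  apply: le_trans le1 _; rewrite lee_fin -natrX ler_nat//.
- apply: filterS aeG => x hx Dx; have := hx Dx; rewrite ge0_fin_numE// => Ex.
  exact: (fE x Ex).1.
Qed.

End L2Complete.

Section L2Series.
Context {R : realType} {d : nat}.
Local Notation X := 'rV[R]_d.
Variables (mu : {measure set X -> \bar R}) (D : set X).
Hypothesis mD : measurable D.
Local Notation L2 := (L2 mu D).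
Local Notation ip := (ip mu D).
Local Notation nrm := (nrm mu D).
Let iP := ip_semi mu mD.
Let sL := L2_linsub mu mD.

(** The rate comes from applying [L2_series_sum] a second time, to the tail after [m] terms rescaled
    by [8^m]. *)
Lemma L2_series_cvg (c : nat -> X -> R^o) : (forall k, L2 (c k)) ->
  (forall k, nrm (c k) <= 8^-1 ^+ k) ->
  exists f : X -> R^o, L2 f /\
    forall m, nrm (f - \sum_(0 <= k < m) c k) <= 3 * 8^-1 ^+ m.
Proof.
move=> Lc nc.
have e8 k : (2^-1 : R) ^+ (3 * k) = 8^-1 ^+ k.
  by rewrite exprM; congr (_ ^+ _); field.
have p8 k : 0 < (8^-1 : R) ^+ k by rewrite exprn_gt0// invr_gt0.
have [|f [Lf _ cf]] := L2_series_sum mD Lc; first by move=> k; rewrite e8.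
exists f; split=> // m.
have Lc' k : L2 (8 ^+ m *: c (k + m)%N) by exact: (subspaceZ sL).
have [|g [Lg ng cg]] := L2_series_sum mD Lc'.
  move=> k; rewrite e8 nrmE (snormZ iP)// ger0_norm ?exprn_ge0// -nrmE.
  apply: le_trans (ler_wpM2l _ (nc _)) _; first exact: exprn_ge0.
  by rewrite addnC exprD mulrA exprVn divff ?mul1r// expf_neq0.
have LS : L2 (\sum_(0 <= k < m) c k).
  by rewrite big_mkord; apply: (subspace_sum sL).
have fE : {ae mu, forall x, D x -> f x = (\sum_(0 <= k < m) c k + 8^-1 ^+ m *: g) x}.
  apply: filterS2 cf cg => x hf hg Dx; have {}hf := hf Dx; have {}hg := hg Dx.
  rewrite -[RHS]/((\sum_(0 <= k < m) c k) x + 8^-1 ^+ m * g x) fct_sumE.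
  have h1 : \sum_(0 <= k < n + m) c k x @[n --> \oo] --> f x.
    by rewrite (@cvg_shiftn m _ (fun n => \sum_(0 <= k < n) c k x)).
  have h2 : \sum_(0 <= k < m) c k x + 8^-1 ^+ m * (\sum_(0 <= k < n) (8 ^+ m *: c (k + m)%N) x) @[n --> \oo]
     --> \sum_(0 <= k < m) c k x + 8^-1 ^+ m * g x.
    by apply: cvgD; [exact: cvg_cst|apply: cvgMr].
  apply: (cvg_unique _ h1); first exact: Rhausdorff.
  apply: cvg_trans h2; apply: near_eq_cvg; apply: nearW => n /=.
  rewrite addnC (@big_cat_nat _ _ _ m 0 (m + n))//= ?leq_addr//; congr (_ + _).
  rewrite mulr_sumr -[X in _ = \sum_(X <= _ < _) _]add0n big_addn addKn; apply: eq_bigr => k _.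
  by rewrite -[X in _ * X]/(8 ^+ m * c (k + m)%N x) mulrA exprVn mulVf ?mul1r// expf_neq0.
have Lr := subspaceD sL LS (subspaceZ sL (8^-1 ^+ m) Lg).
have h := nrm_ae_eq mD Lf Lr fE.
have -> : f - \sum_(0 <= k < m) c k = (f - (\sum_(0 <= k < m) c k + 8^-1 ^+ m *: g)) + 8^-1 ^+ m *: g.
  by rewrite opprD addrA subrK.
apply: le_trans (snormD iP (subspaceB sL Lf Lr) (subspaceZ sL _ Lg)) _.
rewrite -nrmE h add0r (snormZ iP)// ger0_norm ?(ltW (p8 m))// mulrC.
by rewrite ler_wpM2r// ltW.
Qed.

(* Gliding hump. *)
Lemma L2_banach_steinhaus (H : set (X -> R^o)) : H `<=` L2 ->
  (forall f, L2 f -> exists C, forall h, H h -> `|ip f h| <= C) ->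
  exists C, forall h, H h -> nrm h <= C.
Proof.
move=> HL pb; apply: contrapT => nC.
(* The increments below have norm [8^-n]; growth [16^n] then leaves [2^n] in the final
   contradiction. *)
have /choice [h hP] : forall n : nat, exists h, H h /\ 16 ^+ n < nrm h.
  move=> n; apply: contrapT => nh; apply: nC; exists (16 ^+ n) => h Hh.
  by rewrite leNgt; apply/negP => hn; apply: nh; exists h.
have Hh n := (hP n).1; have hn n := (hP n).2; have Lh n := HL _ (Hh n).
have hp n : 0 < nrm (h n) by apply: lt_trans (hn n); rewrite exprn_gt0.
(* The sign of what the earlier increments contribute against [h n], so that the new hump cannot be
   cancelled by them. *)
pose sgn (x : X -> R^o) n : R := if 0 <= ip x (h n) then 1 else -1.
pose incr x n : X -> R^o := (sgn x n * 8^-1 ^+ n / nrm (h n)) *: h n.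
pose fix x n : X -> R^o := if n is m.+1 then x m + incr (x m) m else 0.
pose c n := incr (x n) n.
have sgn1 y n : `|sgn y n| = 1 by rewrite /sgn; case: ifP; rewrite ?normrN normr1.
have p8 k : 0 < (8^-1 : R) ^+ k by rewrite exprn_gt0// invr_gt0.
have Lc n : L2 (c n) by exact: (subspaceZ sL).
have nc n : nrm (c n) <= 8^-1 ^+ n.
  rewrite nrmE (snormZ iP)// !normrM sgn1 mul1r normfV -nrmE.
  by rewrite [`|8^-1 ^+ n|]ger0_norm ?(ltW (p8 n))// ger0_norm ?sqrtr_ge0// divfK// gt_eqF.
have xE n : x n = \sum_(0 <= k < n) c k.
  by elim: n => [|n IH]; [rewrite big_geq|rewrite big_nat_recr//= -IH].
have Lx n : L2 (x n) by rewrite xE big_mkord; apply: (subspace_sum sL).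
have [f [Lf fx]] := L2_series_cvg Lc nc.
have [C CP] := pb f Lf.
have low n : 8^-1 ^+ n * nrm (h n) <= `|ip (x n.+1) (h n)|.
  rewrite /= (sipDl iP)//; last exact: (Lc n).
  rewrite /incr (sipZl iP)// -(sqr_snorm iP)// -nrmE.
  have -> : sgn (x n) n * 8^-1 ^+ n / nrm (h n) * nrm (h n) ^+ 2 = sgn (x n) n * (8^-1 ^+ n * nrm (h n)).
    by field; rewrite gt_eqF.
  have q0 : 0 <= 8^-1 ^+ n * nrm (h n) by rewrite mulr_ge0 ?sqrtr_ge0// ltW.
  rewrite /sgn; case: ifPn => [i0|]; first by rewrite mul1r ger0_norm ?addr_ge0// lerDr.
  by rewrite -ltNge => i0; rewrite mulN1r ltr0_norm ?opprD ?opprK; lra.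
(* The later increments have norm at most [3 * 8^-(n+1)], that is 3/8 of the hump; 5/8 of it survive
   in the limit. *)
have up n : 8^-1 ^+ n * nrm (h n) * (5 / 8) <= C.
  apply: le_trans _ (CP _ (Hh n)).
  have Ld := subspaceB sL (Lx n.+1) Lf.
  have e : ip f (h n) = ip (x n.+1) (h n) - ip (x n.+1 - f) (h n).
    by rewrite (sipBl iP)//; ring.
  rewrite e; apply: le_trans _ (lerB_dist _ _).
  have h1 := sip_CS iP Ld (Lh n).
  have h2 := fx n.+1; rewrite -xE nrmE (snorm_distC iP Lf (Lx n.+1)) in h2.
  have h3 : snorm ip (x n.+1 - f) * snorm ip (h n) <= 3 * 8^-1 ^+ n.+1 * nrm (h n).
    by apply: ler_wpM2r h2; exact: sqrtr_ge0.
  have h4 := low n; rewrite exprS in h3.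
  have h5 := le_trans h1 h3; move: h4 h5.
  have -> : 3 * (8^-1 * 8^-1 ^+ n) * nrm (h n) = 8^-1 ^+ n * nrm (h n) * (3 / 8) by field.
  by move=> h4 h5; lra.
have pow n : 2 ^+ n * (5 / 8) <= C.
  apply: le_trans _ (up n); apply: ler_wpM2r; first by rewrite divr_ge0.
  have -> : (2 ^+ n : R) = 8^-1 ^+ n * 16 ^+ n.
    by rewrite -exprMn; congr (_ ^+ _); field.
  by apply: ler_wpM2l; [exact: ltW|exact: ltW].
have n2 n : (n%:R : R) <= 2 ^+ n.
  by rewrite -natrX ler_nat; apply: ltnW; exact: ltn_expl.
have C0 : 0 <= C by apply: le_trans (pow 0%N); rewrite expr0 mul1r divr_ge0.
pose N := Num.truncn (2 * C); have := pow N.+1; apply/negP; rewrite -ltNge.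
have h1 : 2 * C < N.+1%:R by rewrite truncnS_gt.
have h2 := n2 N.+1; lra.
Qed.

End L2Series.

(** * The trace bounded by the gradient *)

Section TraceBound.
Context {R : realType} {d : nat} (P : piezo R d).
Local Notation X := 'rV[R]_d.
Local Notation mu := (pz_mu P).
Local Notation Om := (pz_Om P).
Local Notation sg := (pz_sg P).
Local Notation tr := (pz_tr P).
Local Notation T := (pz_T P).
Local Notation Gam := (bdry Om).
Local Notation I := (`[0, T]%classic : set R).
Local Notation L2 := (L2 sg Gam).
Local Notation L20 := (L20 sg Gam).
Local Notation ip := (ip sg Gam).
Local Notation nrm := (nrm sg Gam).
Local Notation Zs := (Zspace T sg Gam).
Local Notation ipZ := (ipZ T sg Gam).
Local Notation ipT := (ipT sg Gam).
Hypothesis one_H1 : H1 mu Om (cstf 1).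
Let mOm := Om_measurable P.
Let mGam := Gam_measurable P.
Let one_L2 : L2 (fun=> 1) := one_L2Gam one_H1.
Let iP := ip_semi sg mGam.
Let sL := L2_linsub sg mGam.
Let sHv := H1vP_linsub one_H1.
Let T0 := pz_T_gt0 P.
Let IT : I T. Proof. by rewrite /= in_itv/= lexx ltW. Qed.

Definition gradn (v : sfield R d) : R := snorm (ipv mu Om) v.2.

Lemma linear_data_Z g : L20 g -> Zs (fun t => t *: g).
Proof.
move=> Lg0; have Lg := Lg0.1.
apply: (@nder_Z _ _ T sg Gam _ (fun=> g)).
- by move=> t It; apply: (subspaceZ (L20_linsub mGam one_L2)).
- by rewrite scale0r; exact: (snorm0 iP).
- split; first exact: (bochner_cst T mGam Lg).
    by [].
  move=> t It v Lv; rewrite (sipZl iP t Lg Lv) (sipZl iP 0 Lg Lv) mul0r add0r.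
  rewrite Rintegral_cst; last exact: measurable_itv.
  rewrite mulrC; congr (_ * _).
  transitivity (fine (lebesgue_measure (`[0, t]%classic : set R))); last by [].
  rewrite lebesgue_measure_itv/= lte_fin; case: ltP => [t0|t0]/=.
    by rewrite oppr0 addr0.
  by apply/eqP; rewrite eq_le t0/=; move: It; rewrite /= in_itv/= => /andP[].
Qed.

(* Solvability for the data t *: g yields the bound for each fixed g. *)
Lemma trace_pointwise S g : is_S P S -> L20 g ->
  exists C, forall phi, H1G P phi -> `|ip g (tr phi)| <= C * gradn phi.
Proof.
move=> SP Lg; have Lg2 := Lg.1.
have [psi [[u' [u'' [[uC _ eC psiC] [eqS _ _]]]] _]] := SP _ (linear_data_Z Lg).
have [Hu _] := uC _ IT; have [Hpsi _] := psiC _ IT.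
have Hu1 := H1D_H1v Hu; have Hp1 := H1G_H1 Hpsi.
set u := S _ T in Hu Hu1 *.
(* The two summands are the norms of the two parts of the electric displacement at time [T]. The
   division undoes the factor [T] of the data at that time. *)
pose c := (snorm (ipv mu Om) (fun x => appEt (pz_Ec P x) (symg u x)) +
  snorm (ipv mu Om) (fun x => appK (pz_Kc P x) ((psi T).2 x))) / T.
exists c => phi Hphi; have Hphi1 := H1G_H1 Hphi.
have D0 := subspace0 (H1D_linsub one_H1).
have [_ [_ /(_ T IT)[[u''l _] _] _]] := eC.
have u''0 : u'' T 0 = 0.
  have := u''l 1 0 0 D0 D0; rewrite scaler0 addr0 mul1r.
  by move: (u'' T 0 : R) => x h; lra.
(* With the zero displacement as test function only the equation for the potential remains. *)
have := eqS T IT 0 phi D0 Hphi; rewrite u''0 add0r.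
have H0 := subspace0 sHv.
rewrite (aformE Hu1 Hp1 H0 Hphi1).
rewrite (bb0r (elast_bdd one_H1) Hu1) (bb0r (coup_bdd one_H1) Hp1) addr0 sub0r.
have -> : ip (T *: g) (tr phi) = T * ip g (tr phi) by apply: (sipZl iP) => //; exact: tr_L2.
move=> e.
have h1 : `|coup P phi u| <= snorm (ipv mu Om) (fun x => appEt (pz_Ec P x) (symg u x)) * gradn phi.
  by rewrite coupE; apply: (sip_CS (ipv_semi mu mOm)); [exact: coupt_L2|exact: H1_L2v].
have h2 : `|diel P (psi T) phi| <= snorm (ipv mu Om) (fun x => appK (pz_Kc P x) ((psi T).2 x)) * gradn phi.
  by apply: (sip_CS (ipv_semi mu mOm)); [exact: diel_L2|exact: H1_L2v].
have -> : ip g (tr phi) = (coup P phi u - diel P (psi T) phi) / T.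
  by rewrite -[coup P phi u]opprK -opprD e opprK mulrAC divff ?mul1r// gt_eqF.
rewrite normrM normfV [`|T|]gtr0_norm// /c mulrAC ler_pM2r ?invr_gt0// mulrDl.
by apply: le_trans (ler_normB _ _) _; apply: lerD.
Qed.

(** Banach-Steinhaus tests with all of L^2, while the pointwise bound holds for zero mean; this
    symmetric projection mediates between the two. *)
Definition zero_mean (f : X -> R^o) : X -> R^o :=
  f - (ip f (fun=> 1) / ip (fun=> 1) (fun=> 1)) *: ((fun=> 1) : X -> R^o).

Lemma zero_mean_L2 f : L2 f -> L2 (zero_mean f).
Proof. by move=> Lf; apply: (subspaceB sL) => //; apply: (subspaceZ sL). Qed.

Lemma zero_mean_L20 f : L2 f -> L20 (zero_mean f).
Proof.
move=> Lf; apply/L20E; split; first exact: zero_mean_L2.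
have Lc := subspaceZ sL (ip f (fun=> 1) / ip (fun=> 1) (fun=> 1)) one_L2.
rewrite (sipBl iP Lf Lc one_L2) (sipZl iP _ one_L2 one_L2).
(* If the boundary has measure 0, the quotient is 0 by convention and every mean vanishes. *)
have [n0|n0] := eqVneq (ip (fun=> 1) (fun=> 1)) 0; last by rewrite divfK// subrr.
rewrite n0 mulr0 subr0 (sip_sym iP)//; apply: (snorm0P iP) => //.
by rewrite /snorm n0 sqrtr0.
Qed.

Lemma zero_mean_sym f g : L2 f -> L2 g -> ip (zero_mean f) g = ip f (zero_mean g).
Proof.
move=> Lf Lg.
have Lc h := subspaceZ sL (ip h (fun=> 1) / ip (fun=> 1) (fun=> 1)) one_L2.
rewrite (sipBl iP Lf (Lc f) Lg) (sipBr iP Lg (Lc g) Lf).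
rewrite (sipZl iP _ one_L2 Lg) (sipZr iP _ one_L2 Lf).
by rewrite (sip_sym iP (fun=> 1) g)//; ring.
Qed.

(* Banach-Steinhaus stands in for a Poincare inequality, so the constant does not
   depend on the discrete spaces. *)
Lemma trace_bound S : is_S P S -> exists2 C, 0 <= C &
  forall g phi, L20 g -> H1G P phi -> `|ip g (tr phi)| <= C * (nrm g * gradn phi).
Proof.
move=> SP.
(* Only the zero-mean parts of the traces can be bounded against arbitrary [f]; by [zero_mean_sym]
   the projection passes to [f]. Pairing with a zero-mean [g] does not see the difference. *)
pose H : set (X -> R^o) := [set h | exists phi, [/\ H1G P phi, gradn phi <= 1 & h = zero_mean (tr phi)]].
have HL : H `<=` L2.
  by move=> _ [phi [Hphi _ ->]]; apply: zero_mean_L2; apply: tr_L2; exact: H1G_H1.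
have [|C CP] := L2_banach_steinhaus mGam HL.
  move=> f Lf; have [C CP] := trace_pointwise SP (zero_mean_L20 Lf).
  exists `|C| => _ [phi [Hphi p1 ->]].
  rewrite -zero_mean_sym//; last by apply: tr_L2; exact: H1G_H1.
  apply: le_trans (CP _ Hphi) _; apply: le_trans (ler_norm _) _.
  by rewrite normrM ler_piMr// ger0_norm// snorm_ge0.
exists `|C| => // g phi Lg0 Hphi; have Lg := Lg0.1; have Hphi1 := H1G_H1 Hphi.
(* Such a [phi] cannot be normalised, but the pointwise bound already forces the pairing to
   vanish. *)
have [p0|p0] := eqVneq (gradn phi) 0.
  by have [C' CP'] := trace_pointwise SP Lg0; have := CP' _ Hphi; rewrite p0 !mulr0.
have pp : 0 < gradn phi by rewrite lt_neqAle eq_sym p0 snorm_ge0.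
pose phi' := (gradn phi)^-1 *: phi.
have Hphi' : H1G P phi' by exact: (subspaceZ (H1G_linsub one_H1)).
have Hphi1' := H1G_H1 Hphi'.
have g1 : gradn phi' <= 1.
  have e := snormZ (ipv_semi mu mOm) (gradn phi)^-1 (H1_L2v Hphi1).
  rewrite {1}/gradn -[phi'.2]/((gradn phi)^-1 *: phi.2) e ger0_norm ?invr_ge0 ?(ltW pp)//.
  by rewrite -/(gradn phi) mulVf.
have Lt' := tr_L2 Hphi1'.
have hC : nrm (zero_mean (tr phi')) <= `|C|.
  by apply: le_trans (ler_norm _); apply: CP; exists phi'.
have e1 : ip g (tr phi) = gradn phi * ip g (tr phi').
  rewrite /phi' (bbZr (tr_bdd one_H1) _ Hphi1 Lg) mulrA mulfV ?mul1r//.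
have e2 : ip g (tr phi') = ip g (zero_mean (tr phi')).
  have Lc := subspaceZ sL (ip (tr phi') (fun=> 1) / ip (fun=> 1) (fun=> 1)) one_L2.
  rewrite (sipBr iP Lt' Lc Lg) (sipZr iP _ one_L2 Lg).
  by have /L20E[_ ->] := Lg0; rewrite mulr0 subr0.
rewrite e1 e2 normrM gtr0_norm//.
have -> : `|C| * (nrm g * gradn phi) = gradn phi * (`|C| * nrm g) by ring.
rewrite ler_pM2l//; apply: le_trans (sip_CS iP Lg (zero_mean_L2 Lt')) _.
rewrite mulrC -!nrmE; apply: ler_wpM2r; first exact: sqrtr_ge0.
exact: hC.
Qed.

End TraceBound.

(** * The abstract error estimate *)

Section ControlEstimate.
Context {R : realType} {V W : lmodType R}.
Variables (Bz : set V) (bz : V -> V -> R) (Bx : set V) (bx : V -> V -> R)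
  (Bu : set W) (bu : W -> W -> R).
Hypotheses (zP : semi_ip Bz bz) (xP : semi_ip Bx bx) (uP : semi_ip Bu bu).
Hypothesis zx : Bz `<=` Bx.
Let sz := sip_sub zP.
Let sx := sip_sub xP.
Let su := sip_sub uP.

(** Covers the continuous and the discrete operators alike. Controls and adjoint traces live in the
    same module, with the product of the control norm on [Bz] and that of the adjoint identity on
    [Bx]. *)
Record adjoint_pair (S : V -> W) (Ra : W -> V) : Prop := AdjointPair {
  adj_in : forall z, Bz z -> Bu (S z);
  adj_out : forall f, Bu f -> Bx (Ra f);
  adjE : forall z f, Bz z -> Bu f -> bu f (S z) = bx z (Ra f) }.

Definition qcost (S : V -> W) (ud : W) (alpha : R) (z : V) : R :=
  2^-1 * bu (S z - ud) (S z - ud) + alpha / 2 * bz z z.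

(* Only the adjoint identity is used: it makes [S] linear modulo the kernel of
   the seminorm of [bu]. *)
Lemma adj_lin S Ra a z y f : adjoint_pair S Ra -> Bz z -> Bz y -> Bu f ->
  bu f (S (a *: z + y)) = a * bu f (S z) + bu f (S y).
Proof.
move=> sr Hz Hy Hf; rewrite !(adjE sr)//; last exact: sz.2.
by rewrite (sip_linl xP)//; [exact: zx|exact: zx|exact: (adj_out sr)].
Qed.

(** Pairing [S z - S y] with itself allows one factor to be replaced by [S (z - y)], after which one
    power of the norm cancels. *)
Lemma adj_diff_le S Ra c z y : adjoint_pair S Ra ->
  (forall v, Bz v -> snorm bu (S v) <= c * snorm bz v) ->
  Bz z -> Bz y -> snorm bu (S z - S y) <= c * snorm bz (z - y).
Proof.
move=> sr Sc Hz Hy.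
have [Sz Sy] := (adj_in sr Hz, adj_in sr Hy).
have Hd := subspaceB su Sz Sy; have Hzy := subspaceB sz Hz Hy.
have e : bu (S z - S y) (S z - S y) = bu (S z - S y) (S (z - y)).
  have -> : z - y = -1 *: y + z by rewrite scaleN1r addrC.
  by rewrite (adj_lin _ sr Hy Hz Hd) mulN1r [RHS]addrC (sipBr uP Sz Sy Hd).
have := sip_CSr uP Hd (adj_in sr Hzy); rewrite -e -(sqr_snorm uP Hd) expr2.
have [-> _|n0] := eqVneq (snorm bu (S z - S y)) 0.
  by apply: le_trans (Sc _ Hzy); exact: snorm_ge0.
rewrite ler_pM2l; last by rewrite lt_neqAle eq_sym n0 snorm_ge0.
by move=> h; apply: le_trans h (Sc _ Hzy).
Qed.

Lemma first_order_ge0 (L Q : R) : 0 <= Q ->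
  (forall s, 0 < s -> s <= 1 -> 0 <= s * L + s ^+ 2 * Q) -> 0 <= L.
Proof.
move=> Q0 h; rewrite leNgt; apply/negP => L0.
have Q1 : 0 < Q + 1 - L by lra.
(* A step length of at most 1 at which the quadratic term stays below the linear one. *)
have s0 : 0 < - L / (Q + 1 - L) by rewrite divr_gt0// oppr_gt0.
have s1 : - L / (Q + 1 - L) <= 1 by rewrite ler_pdivrMr// mul1r; lra.
have := h _ s0 s1; set s := - L / _; rewrite expr2 -mulrA -mulrDr pmulr_rge0//.
have : s * Q <= - L * (Q / (Q + 1 - L)) by rewrite /s mulrAC mulrA.
have : Q / (Q + 1 - L) < 1 by rewrite ltr_pdivrMr// mul1r; lra.
have L0' : 0 < - L by lra.
rewrite -(ltr_pM2l L0') mulr1; lra.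
Qed.

(** Along the segment from [z] to [y] the cost is a quadratic polynomial with minimum at the start,
    so its slope there is non-negative. *)
Lemma variational_inequality S Ra ud alpha (A : set V) z y :
  adjoint_pair S Ra -> Bu ud -> 0 <= alpha -> A `<=` Bz ->
  (forall v w s, A v -> A w -> 0 <= s -> s <= 1 -> A (s *: (w - v) + v)) ->
  A z -> A y -> (forall v, A v -> qcost S ud alpha z <= qcost S ud alpha v) ->
  0 <= bu (S z - ud) (S y - S z) + alpha * bz z (y - z).
Proof.
move=> sr Hud al0 AB cA Az Ay zmin.
have [Hz Hy] := (AB _ Az, AB _ Ay); have Hyz := subspaceB sz Hy Hz.
have [Sz Sy] := (adj_in sr Hz, adj_in sr Hy).
have HF := subspaceB su Sz Hud; have HD := subspaceB su Sy Sz.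
set F := S z - ud in HF *; set De := S y - S z in HD *.
apply: (@first_order_ge0 _ (2^-1 * bu De De + alpha / 2 * bz (y - z) (y - z))).
  rewrite addr_ge0// mulr_ge0// ?(sip_ge0 uP)// ?(sip_ge0 zP)//.
  by rewrite divr_ge0.
move=> s s0 s1; have Aw := cA _ _ s Az Ay (ltW s0) s1.
have Hw := AB _ Aw; have Sw := adj_in sr Hw.
have HG := subspaceB su Sw Hud.
(* Against every [f], the residual at the intermediate point acts like [F + s *: De]; this is the
   linearity that [adj_lin] offers. *)
have key f : Bu f -> bu f (S (s *: (y - z) + z) - ud) = bu f F + s * bu f De.
  move=> Hf; rewrite (sipBr uP)// (adj_lin _ sr)//.
  have -> : bu f (S (y - z)) = bu f De.
    have -> : y - z = -1 *: z + y by rewrite scaleN1r addrC.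
    by rewrite (adj_lin _ sr Hz Hy Hf) mulN1r [LHS]addrC (sipBr uP Sy Sz Hf).
  by rewrite /F (sipBr uP)//; ring.
have := zmin _ Aw; rewrite /qcost -subr_ge0.
set w := s *: (y - z) + z in Hw Sw HG key *.
have -> : bu (S w - ud) (S w - ud) = bu F F + 2 * s * bu F De + s ^+ 2 * bu De De.
  rewrite key// (sip_sym uP _ F)// (sip_sym uP _ De)// !key//.
  by rewrite (sip_sym uP De F)//; ring.
have -> : bz w w = bz z z + 2 * s * bz z (y - z) + s ^+ 2 * bz (y - z) (y - z).
  have Hsyz := subspaceZ sz s Hyz.
  rewrite {1}/w (sipDl zP Hsyz Hz Hw) /w (sipDr zP Hsyz Hz Hsyz) (sipDr zP Hsyz Hz Hz).
  rewrite !(sipZl zP s Hyz)// !(sipZr zP s Hyz)//.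
  by rewrite (sip_sym zP (y - z) z Hyz Hz); ring.
rewrite -/F => h; apply: le_trans h _; rewrite le_eqVlt; apply/orP; left; apply/eqP.
by field.
Qed.

(** For [e <= s] nothing is to be shown; otherwise [s ^+ 2 <= s * e], and a factor [e] can be
    divided out. *)
Lemma quadratic_absorb (al c e s : R) : 0 < al -> 0 <= c -> 0 <= e -> 0 <= s ->
  al * e ^+ 2 <= c * (s ^+ 2 + s * e) -> e <= (1 + 2 * c / al) * s.
Proof.
move=> al0 c0 e0 s0 h.
have [es|se] := leP e s.
  apply: le_trans es _; rewrite ler_peMl// lerDl.
  by rewrite divr_ge0 ?mulr_ge0// ltW.
have ep : 0 < e by apply: le_lt_trans se.
have h2 : al * e <= 2 * c * s.
  rewrite -(ler_pM2r ep).
  have -> : al * e * e = al * e ^+ 2 by ring.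
  apply: le_trans h _; have : s ^+ 2 <= s * e by rewrite expr2 ler_wpM2l// ltW.
  by move=> h; have := ler_wpM2l c0 h; nra.
have h3 : e <= 2 * c / al * s.
  by rewrite mulrAC ler_pdivlMr// mulrC.
apply: le_trans h3 _; have -> : (1 + 2 * c / al) * s = s + 2 * c / al * s by ring.
by rewrite lerDr.
Qed.

(** [p] and [bp] stand for the projections of the control and of the adjoint trace, which enter only
    through admissibility and two orthogonality relations. [T] is the norm of the embedding of
    controls and [cS] the bound of the discrete operator. *)
Theorem control_estimate S Ra Sh Rh ud alpha (A Ah : set V) z zh p bp T cS :
  adjoint_pair S Ra -> adjoint_pair Sh Rh -> Bu ud -> 0 < alpha -> 0 <= T -> 0 <= cS ->
  (forall v, Bz v -> snorm bx v <= T * snorm bz v) ->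
  (forall v, Bz v -> snorm bu (Sh v) <= cS * snorm bz v) ->
  A `<=` Bz -> Ah `<=` A ->
  (forall v w s, A v -> A w -> 0 <= s -> s <= 1 -> A (s *: (w - v) + v)) ->
  (forall v w s, Ah v -> Ah w -> 0 <= s -> s <= 1 -> Ah (s *: (w - v) + v)) ->
  A z -> (forall v, A v -> qcost S ud alpha z <= qcost S ud alpha v) ->
  Ah zh -> (forall v, Ah v -> qcost Sh ud alpha zh <= qcost Sh ud alpha v) ->
  Ah p -> bz zh (p - z) = 0 ->
  Bx bp -> bx (p - z) bp = 0 ->
  snorm bz (z - zh) <= (1 + 2 * (cS ^+ 2 + cS + 2 * T) / alpha) *
    (snorm bz (z - p) + snorm bu (S z - Sh z) + snorm bx (Ra (S z - ud) - Rh (S z - ud)) +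
     snorm bx (Ra (S z - ud) - bp)).
Proof.
move=> sr shr Hud al0 T0 cS0 xT ShS AB AhA cA cAh Az zmin Ahh zhmin Ahp zh0 Hbp bp0; set f := S z - ud.
have AhB v : Ah v -> Bz v by move=> /AhA /AB.
have Hz := AB _ Az; have Hzh := AhB _ Ahh; have Hp := AhB _ Ahp.
have v1 := variational_inequality sr Hud (ltW al0) AB cA Az (AhA _ Ahh) zmin.
have v2 := variational_inequality shr Hud (ltW al0) AhB cAh Ahh Ahp zhmin.
have [Sz Szh] := (adj_in sr Hz, adj_in sr Hzh).
have [Shz Shzh] := (adj_in shr Hz, adj_in shr Hzh); have Shp := adj_in shr Hp.
have Hf : Bu f := subspaceB su Sz Hud.
have [Rf Rhf] := (adj_out sr Hf, adj_out shr Hf).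
set e := snorm bz (z - zh); set de := snorm bz (z - p).
set a := snorm bu _; set b := snorm bx _; set g := snorm bx _.
have de0 : 0 <= de by exact: snorm_ge0. have a0 : 0 <= a by exact: snorm_ge0.
have b0 : 0 <= b by exact: snorm_ge0. have g0 : 0 <= g by exact: snorm_ge0.
have e0 : 0 <= e by exact: snorm_ge0.
have Hzzh := subspaceB sz Hz Hzh; have Hpz := subspaceB sz Hp Hz; have Hpzh := subspaceB sz Hp Hzh.
have ezz : bz (z - zh) (z - zh) = e ^+ 2 by rewrite (sqr_snorm zP).
have npz : snorm bz (p - z) = de by rewrite (snorm_distC zP Hp Hz).
have npzh : snorm bz (p - zh) <= e + de.
  have -> : p - zh = (p - z) + (z - zh) by rewrite addrA subrK.
  by apply: le_trans (snormD zP Hpz Hzzh) _; rewrite npz addrC.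
set A1 := Sh zh - Sh z; set B1 := Sh p - Sh z; set C1 := Sh z - S z; set D1 := Sh p - Sh zh.
have HA1 := subspaceB su Shzh Shz : Bu A1; have HB1 := subspaceB su Shp Shz : Bu B1.
have HC1 := subspaceB su Shz Sz : Bu C1; have HD1 := subspaceB su Shp Shzh : Bu D1.
have D1E : D1 = B1 - A1 by rewrite /B1 /A1 opprB addrA subrK.
have FhE : Sh zh - ud = A1 + (C1 + f) by rewrite /A1 /C1 /f (addrA (Sh z - S z)) subrK addrA subrK.
(* As [D1 = B1 - A1], the product contains minus the square of [A1], which absorbs the unknown
   discrete error and leaves the projection error in [B1]. *)
have t1 : bu A1 D1 <= cS ^+ 2 * de ^+ 2.
  rewrite D1E (sipBr uP)//.
  have nB : snorm bu B1 <= cS * de by rewrite -npz; exact: (adj_diff_le shr ShS).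
  have h1 := sip_CSr uP HA1 HB1; rewrite -(sqr_snorm uP HA1).
  have nA0 : 0 <= snorm bu A1 by exact: snorm_ge0.
  have nB0 : 0 <= snorm bu B1 by exact: snorm_ge0.
  have h2 : snorm bu B1 ^+ 2 <= (cS * de) ^+ 2 by rewrite ler_sqr// nnegrE mulr_ge0.
  rewrite -exprMn; have := sqr_ge0 (snorm bu A1 - snorm bu B1).
  by have := sqr_ge0 (snorm bu B1); nra.
have t2 : bu C1 D1 <= a * (cS * (e + de)).
  apply: le_trans (sip_CSr uP HC1 HD1) _.
  rewrite (snorm_distC uP Shz Sz); apply: ler_wpM2l => //.
  apply: le_trans (adj_diff_le shr ShS Hp Hzh) _; exact: ler_wpM2l.
have t3 : bu f D1 = bx (p - zh) (Rh f).
  rewrite /D1 (sipBr uP)// !(adjE shr)// (sipBl xP)//; exact: zx.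
have t4 : bu f (S zh - S z) = bx (zh - z) (Ra f).
  rewrite (sipBr uP)// !(adjE sr)// (sipBl xP)//; exact: zx.
have Hbr := subspaceB sx Rf Rhf. have Hbg := subspaceB sx Rf Hbp.
have t5 : bx (p - zh) (Rh f) <= bx (p - zh) (Ra f) + T * (e + de) * b.
  have -> : bx (p - zh) (Rh f) = bx (p - zh) (Ra f) - bx (p - zh) (Ra f - Rh f).
    by rewrite (sipBr xP)//; [ring|exact: zx].
  rewrite lerD2l; apply: le_trans (ler_norm _) _; rewrite normrN.
  apply: le_trans (sip_CS xP (zx Hpzh) Hbr) _; apply: ler_wpM2r => //.
  apply: le_trans (xT _ Hpzh) _; exact: ler_wpM2l.
(* [zh] cancels in the sum; what remains is [p - z], against which [bp] can be subtracted. *)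
have t6 : bx (zh - z) (Ra f) + bx (p - zh) (Ra f) <= T * de * g.
  have -> : bx (zh - z) (Ra f) + bx (p - zh) (Ra f) = bx (p - z) (Ra f - bp).
    rewrite (sipBr xP)//; last exact: zx.
    rewrite bp0 subr0 !(sipBl xP)//; try exact: zx.
    by ring.
  apply: le_trans (sip_CSr xP (zx Hpz) Hbg) _; apply: ler_wpM2r => //.
  by rewrite -npz; exact: xT.
(* The sum of the two variational inequalities, with [bz zh p] replaced by [bz zh z] through
   [zh0]. *)
have t7 : alpha * e ^+ 2 <= bu f (S zh - S z) + bu (Sh zh - ud) D1.
  have -> : alpha * e ^+ 2 = - (alpha * bz z (zh - z)) - alpha * bz zh (p - zh).
    have h0 : bz zh (p - zh) = bz zh z - bz zh zh.
      have : bz zh p = bz zh z by apply/eqP; rewrite -subr_eq0 -(sipBr zP)// zh0.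
      by rewrite (sipBr zP)// => ->.
    rewrite -ezz h0 (sipBl zP)// !(sipBr zP)// (sip_sym zP zh z)//; ring.
  by move: v1 v2; rewrite -/f -/D1; lra.
have t8 : bu (Sh zh - ud) D1 = bu A1 D1 + (bu C1 D1 + bu f D1).
  have HCf := subspaceD su HC1 Hf.
  by rewrite FhE (sipDl uP HA1 HCf HD1) (sipDl uP HC1 Hf HD1).
apply: quadratic_absorb => //.
- by rewrite !addr_ge0 ?sqr_ge0// mulr_ge0.
- by rewrite !addr_ge0.
apply: le_trans t7 _; rewrite t8 t4 t3.
set s := de + a + b + g.
have d_s : de <= s by rewrite /s; lra. have a_s : a <= s by rewrite /s; lra.
have b_s : b <= s by rewrite /s; lra. have g_s : g <= s by rewrite /s; lra.
have s0 : 0 <= s by exact: le_trans de0 d_s.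
have u1 : cS ^+ 2 * de ^+ 2 <= cS ^+ 2 * s ^+ 2.
  by apply: ler_wpM2l; [exact: sqr_ge0|rewrite ler_sqr].
have u2 : a * (cS * (e + de)) <= s * (cS * (e + s)).
  by apply: ler_pM => //; [rewrite mulr_ge0// addr_ge0|rewrite ler_wpM2l// lerD2l].
have u3 : T * (e + de) * b <= T * (e + s) * s.
  by apply: ler_pM => //; [rewrite mulr_ge0// addr_ge0|rewrite ler_wpM2l// lerD2l].
have u4 : T * de * g <= T * s * s.
  by apply: ler_pM => //; [rewrite mulr_ge0|rewrite ler_wpM2l].
have e_s : 0 <= cS ^+ 2 * (s * e) by rewrite mulr_ge0 ?sqr_ge0// mulr_ge0.
have e_s2 : 0 <= T * (s * e) by rewrite mulr_ge0// mulr_ge0.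
(* [cS ^+ 2] comes from [t1], [cS] from [t2], and one [T] each from [t5] and [t6]. *)
have -> : (cS ^+ 2 + cS + 2 * T) * (s ^+ 2 + s * e) =
  cS ^+ 2 * s ^+ 2 + s * (cS * (e + s)) + T * (e + s) * s + T * s * s
  + cS ^+ 2 * (s * e) + T * (s * e) by ring.
by move: t1 t2 t5 t6 u1 u2 u3 u4 e_s e_s2; clear; lra.
Qed.
End ControlEstimate.

(** * The operators as adjoint pairs and the uniform bound of S_h *)

Lemma Rint_le_cst (R : realType) (T : R) (h : R -> R) m : 0 < T -> contI T h ->
  (forall t, `[0, T]%classic t -> h t <= m) ->
  \int[lebesgue_measure]_(t in `[0, T]) h t <= T * m.
Proof.
move=> T0 hC hm; have mI : @measurable _ (measurableTypeR R) `[0, T]%classic.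
  exact: measurable_itv.
have -> : T * m = \int[lebesgue_measure]_(t in `[0, T]) m.
  rewrite Rintegral_cst// mulrC; congr (_ * _).
  transitivity (fine (lebesgue_measure (`[0, T]%classic : set R))); last by [].
  by rewrite lebesgue_measure_itv/= lte_fin T0 oppr0 addr0.
apply: le_Rintegral => //; first exact: contI_integrable.
by apply: contI_integrable => //; exact: contI_cst.
Qed.

(** [F] is the squared norm of the discrete state, which reappears under a root on the right; one
    root of it is cancelled. *)
Lemma sqrt_absorb (R : rcfType) (c a b F Z : R) : 0 <= c -> 0 <= a -> 0 <= b -> 0 <= F ->
  F <= c * (Num.sqrt (a * Z) * Num.sqrt (b * F)) ->
  Num.sqrt F <= c * (Num.sqrt a * Num.sqrt b) * Num.sqrt Z.
Proof.
move=> c0 a0 b0 F0; rewrite sqrtrM// sqrtrM// -{1}(sqr_sqrtr F0).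
set x := Num.sqrt F; set y := Num.sqrt Z.
have x0 : 0 <= x by exact: sqrtr_ge0.
have -> : c * (Num.sqrt a * y * (Num.sqrt b * x)) = c * (Num.sqrt a * Num.sqrt b) * y * x by ring.
have [->|n0] := eqVneq x 0; first by rewrite !mulr_ge0 ?sqrtr_ge0.
by rewrite expr2 ler_pM2r// lt_neqAle eq_sym n0.
Qed.

Section Assembly.
Context {R : realType} {d : nat} (P : piezo R d).
Local Notation X := 'rV[R]_d.
Local Notation mu := (pz_mu P).
Local Notation Om := (pz_Om P).
Local Notation sg := (pz_sg P).
Local Notation tr := (pz_tr P).
Local Notation T := (pz_T P).
Local Notation Gam := (bdry Om).
Local Notation N1 := (normH1 mu Om).
Local Notation N1v := (normH1v mu Om).
Local Notation I := (`[0, T]%classic : set R).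
Local Notation L2 := (L2 sg Gam).
Local Notation ip := (ip sg Gam).
Local Notation nrm := (nrm sg Gam).
Local Notation Zs := (Zspace T sg Gam).
Local Notation ipZ := (ipZ T sg Gam).
Hypothesis one_H1 : H1 mu Om (cstf 1).
Let mOm := Om_measurable P.
Let mGam := Gam_measurable P.
Let oOm : open Om := @Om_open _ _ P.
Let bOm : bounded_set Om := @Om_bounded _ _ P.
Let one_L2 : L2 (fun=> 1) := one_L2Gam one_H1.
Let iP := ip_semi sg mGam.
Let sL := L2_linsub sg mGam.
Let T0 := pz_T_gt0 P.
Let mI : @measurable _ (measurableTypeR R) I. Proof. exact: measurable_itv. Qed.
Let zP := ipZ_semi T0 mGam one_L2.

(** Continuity in time instead of square integrability: controls, adjoint traces and their
    projections are all continuous, and products along continuous functions are integrable. *)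
Definition Xspace : set (R -> X -> R^o) := [set y | is_C0 T (L2 : set (X -> R^o)) nrm y].
Definition ipX (y w : R -> X -> R^o) : R := \int[lebesgue_measure]_(t in I) ip (y t) (w t).
Definition ipU (u w : R -> vfield R d) : R :=
  \int[lebesgue_measure]_(t in I) ip_rho P (u t).1 (w t).1.

Lemma ipX_semi : semi_ip Xspace ipX.
Proof. exact: (is_C0_semi iP (ltW T0) iP (semi_ip_bdd iP)). Qed.

Lemma ipU_semi : semi_ip (Uspace P : set (R -> vfield R d)) ipU.
Proof.
have sD := H1D_linsub one_H1.
have HD : H1D P `<=` H1v mu Om by move=> u; exact: H1D_H1v.
have aP := semi_ipW sD HD (ipH1v_semi oOm bOm (H1_L2 one_H1)).
have rP := semi_ipW sD HD (ip_rhov_semi one_H1).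
exact: (is_C0_semi aP (ltW T0) rP (bdd_bilinW sD sD HD HD (ip_rhov_bdd one_H1))).
Qed.

Lemma normXE y : Xspace y -> normX T sg Gam y = snorm ipX y.
Proof.
move=> yC; congr Num.sqrt; apply: eq_Rintegral => t /set_mem It.
by rewrite nrmE (sqr_snorm iP)//; have [] := yC t It.
Qed.

(** The abstract estimate measures states in L^2_rho, the final one in H^1; [M] converts. *)
Lemma normU_ge : exists2 M, 0 <= M & forall u, Uspace P u -> snorm ipU u <= M * normU P u.
Proof.
have [M M0 hM] := norm_rho_le_H1v P; exists M => // u uC.
have Hu t : I t -> H1v mu Om (u t) by move=> It; have [/H1D_H1v] := uC t It.
have uC' : is_C0 T (H1v mu Om) N1v u by apply: is_C0_sub uC => t _; exact: H1D_H1v.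
have vP := ipH1v_semi oOm bOm (H1_L2 one_H1).
have c1 : contI T (fun t => ip_rho P (u t).1 (u t).1).
  exact: (contI_bilin (ip_rhov_bdd one_H1) uC' uC').
have c2 : contI T (fun t => N1v (u t) ^+ 2).
  have c3 := contI_bilin (semi_ip_bdd vP) uC' uC'.
  by apply: contI_ext c3 => t It; rewrite -(sqr_snorm vP (Hu t It)).
rewrite -[M]ger0_norm// -sqrtr_sqr -sqrtrM ?sqr_ge0//; apply: ler_wsqrtr.
have i1 := contI_integrable (lexx 0) (lexx T) c1.
have i2 := contI_integrable (lexx 0) (lexx T) c2.
rewrite -RintegralZl//; apply: le_Rintegral => //; first exact: (integrableZl mI _ i2).
move=> t It; rewrite -(sqr_snorm (ip_rho_semi P)); last exact: H1v_L2v (Hu t It).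
by rewrite -exprMn ler_sqr ?nnegrE ?snorm_ge0 ?mulr_ge0 ?sqrtr_ge0//; apply: hM; exact: Hu.
Qed.

Lemma ipX_le_ipZ v : Zs v -> snorm ipX v <= T * snorm ipZ v.
Proof.
move=> Hv; rewrite -[X in X * _]ger0_norm ?(ltW T0)// -sqrtr_sqr -sqrtrM ?sqr_ge0//.
apply: ler_wsqrtr.
have vC := Z_C0 T0 mGam one_L2 Hv.
have c1 := contI_bilin (semi_ip_bdd iP) vC vC.
rewrite expr2 -mulrA; apply: (Rint_le_cst T0 c1) => t It.
exact: (Z_bound T0 mGam one_L2 Hv It).
Qed.

Lemma tr_C0 xi : is_C0 T (H1 mu Om) N1 xi -> Xspace (fun t => tr (xi t)).
Proof.
move=> xC t It; have [Hx xt] := xC t It; split; first exact: tr_L2.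
have [_ _ [c cP] _] := pz_tr_trace P.
have sI : \forall s \near within I (nbhs t), I s by apply: withinT.
have c0 : c * N1 (xi s - xi t) @[s --> within I (nbhs t)] --> (0 : R).
  by rewrite -[X in _ --> X](mulr0 c); apply: cvgMr.
apply: (squeeze_cvgr _ (cvg_cst 0) c0); apply: filterS sI => s Is.
have [Hs _] := xC s Is; rewrite sqrtr_ge0/=.
have sH := H1P_linsub one_H1.
have Hd := subspaceB sH Hs Hx.
apply: le_trans (cP _ Hd).
have Lt := tr_L2 Hx; have Ls := tr_L2 Hs; have Ld := tr_L2 Hd.
have Lst := subspaceB sL Ls Lt.
rewrite (nrm0_eq mGam Lst Ld)//; apply: (nrm_ae_eq mGam Lst Ld).
have e : xi s - xi t = -1 *: xi t + xi s by rewrite scaleN1r addrC.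
have := tr_lin (-1) Hx Hs; rewrite -e scaleN1r.
rewrite (addrC (- tr (xi t))).
by apply: ae_mono => x h Gx; rewrite (h Gx).
Qed.

(** The adjoint operators are prescribed only at times in the interval, so they equal a trace only
    there. *)
Lemma Xspace_ext y w : (forall t, I t -> y t = w t) -> Xspace y -> Xspace w.
Proof.
move=> yw yC t It; have [Ly yt] := yC t It; rewrite -yw//; split => //.
have sI : \forall s \near within I (nbhs t), I s by apply: withinT.
apply: cvg_trans yt; apply: near_eq_cvg; apply: filterS sI => s Is /=.
by rewrite yw.
Qed.

Lemma adjoint_pair_S S Rop : is_S P S -> is_R P Rop ->
  adjoint_pair Zs Xspace ipX (Uspace P : set (R -> vfield R d)) ipU S Rop.
Proof.
move=> SP RP; split.
- by move=> z /SP[psi [[u' [u'' [[uC _ _ _] _]]] _]].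
- move=> f /RP[p [xi [[p' [p'' [xi' [_ _ [xiC _ _] _ _]]]] e _]]].
  apply: (@Xspace_ext (fun t => tr (xi t))); last exact: tr_C0.
  by move=> t It; rewrite e.
- move=> z f Hz Hf; have [psi [sS _]] := SP z Hz; have [p [xi [sR e _]]] := RP f Hf.
  rewrite /ipU (adjoint_R one_H1 (Z_C0 T0 mGam one_L2 Hz) sS Hf sR).
  by apply: eq_Rintegral => t /set_mem It; rewrite e.
Qed.

Lemma adjoint_pair_Sh Vh Wh Sh Rh : galerkin_spaces P Vh Wh ->
  is_Sh P Vh Wh Sh -> is_Rh P Vh Wh Rh ->
  adjoint_pair Zs Xspace ipX (Uspace P : set (R -> vfield R d)) ipU Sh Rh.
Proof.
move=> gal SP RP; have [_ VD _ WH _] := gal; split.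
- move=> z /SP[psi [[u' [u'' [[[uC _ _] _] _ _ _]]] _]].
  by apply: is_C0_sub uC => t _; exact: VD.
- move=> f /RP[p [xi [[p' [p'' [_ xiC _ _]]] e _]]].
  apply: (@Xspace_ext (fun t => tr (xi t))); last first.
    by apply: tr_C0; apply: is_C0_sub xiC => t _ [/WH].
  by move=> t It; rewrite e.
- move=> z f Hz Hf; have [psi [sS _]] := SP z Hz; have [p [xi [sR e _]]] := RP f Hf.
  rewrite /ipU (adjoint_Rh gal (Z_C0 T0 mGam one_L2 Hz) sS Hf sR).
  by apply: eq_Rintegral => t /set_mem It; rewrite e.
Qed.

Lemma Sh_bound S : is_S P S -> exists2 c, 0 <= c & forall Vh Wh Sh Rh,
  galerkin_spaces P Vh Wh -> is_Sh P Vh Wh Sh -> is_Rh P Vh Wh Rh ->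
  forall z, Zs z -> snorm ipU (Sh z) <= c * snorm ipZ z.
Proof.
move=> SP; have [C C0 CP] := trace_bound one_H1 SP.
have [k0 k00 kP] := diel_coercive P.
have C1 : 0 <= T * C by rewrite mulr_ge0// ltW.
(* [T] from integration in time, [C] from the trace bound, the root of [T] from [Z_bound], and the
   last root from the energy estimate divided by the coercivity constant. *)
exists (T * C * (Num.sqrt T * Num.sqrt (4 * T / k0))).
  exact: (mulr_ge0 C1 (mulr_ge0 (sqrtr_ge0 _) (sqrtr_ge0 _))).
have k4 : 0 <= 4 * T / k0 by rewrite divr_ge0 ?mulr_ge0// ltW.
move=> Vh Wh Sh Rh gal ShP RhP z Hz.
have [shr1 shr2 shr3] := adjoint_pair_Sh gal ShP RhP.
have Hf : Uspace P (Sh z) by exact: shr1.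
have [p [xi [sR e _]]] := RhP (Sh z) Hf.
have en := energy_Rh gal Hf sR.
have [p' [p'' [_ xiC _ _]]] := sR.
have [_ _ _ WH _] := gal.
apply: (sqrt_absorb C1 (ltW T0) k4 (sip_ge0 ipU_semi Hf)).
have zC := Z_C0 T0 mGam one_L2 Hz.
have c1 := contI_bilin (semi_ip_bdd iP) zC (shr2 _ Hf).
rewrite {1}(shr3 _ _ Hz Hf) -(mulrA T); apply: (Rint_le_cst T0 c1) => t It.
rewrite (e t It); have [[Wxi Gxi] _] := xiC t It.
apply: le_trans (ler_norm _) _; apply: le_trans (CP _ _ (Hz.1.1 t It) Gxi) _.
apply: (ler_wpM2l C0); apply: ler_pM; [exact: sqrtr_ge0|exact: sqrtr_ge0| |].
  by apply: ler_wsqrtr; exact: (Z_bound T0 mGam one_L2 Hz It).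
apply: ler_wsqrtr; have h := le_trans (kP _ (WH _ Wxi)) (en t It).
by rewrite mulrAC ler_pdivlMr// mulrC.
Qed.

Lemma costE S ud alpha z : (forall z, Zs z -> Uspace P (S z)) -> Uspace P ud -> Zs z ->
  cost P S ud alpha z = qcost ipZ ipU S ud alpha z.
Proof.
move=> SU Hud Hz; have uP := ipU_semi; have Hd := subspaceB (sip_sub uP) (SU z Hz) Hud.
rewrite /cost /qcost; congr (_ * _ + _ * _).
  apply: eq_Rintegral => t /set_mem It.
  rewrite (sqr_snorm (ip_rho_semi P))//.
  by have [/H1D_H1v /H1v_L2v] := Hd t It.
by rewrite (normZE T0 mGam one_L2 Hz) (sqr_snorm zP).
Qed.

Lemma Zad_convex za zb v w s : Zad P za zb v -> Zad P za zb w -> 0 <= s -> s <= 1 ->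
  Zad P za zb (s *: (w - v) + v).
Proof.
move=> [Hv bv] [Hw bw] s0 s1; split.
  by apply: (sip_sub zP).2 => //; exact: (subspaceB (sip_sub zP)).
move=> t It; apply: filterS2 (bv t It) (bw t It) => x hv hw Gx.
have /andP[v1 v2] := hv Gx; have /andP[w1 w2] := hw Gx.
rewrite -[(s *: (w - v) + v) t x]/(s * (w t x - v t x) + v t x).
by apply/andP; split; nra.
Qed.

Lemma Zh_convex n (K : 'I_n -> set X) v w s : Zh P K v -> Zh P K w -> Zh P K (s *: (w - v) + v).
Proof.
move=> [Hv bv] [Hw bw]; split.
  by apply: (sip_sub zP).2 => //; exact: (subspaceB (sip_sub zP)).
have sP := P0_linsub P K.
move=> t It; apply: sP.2; last exact: bv.
by apply: (subspaceB sP); [exact: bw|exact: bv].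
Qed.

End Assembly.

(** * The estimate for given discrete spaces and the behaviour of the constant *)

Section MainEstimate.
Context {R : realType} {d : nat} (P : piezo R d).
Local Notation X := 'rV[R]_d.
Local Notation mu := (pz_mu P).
Local Notation Om := (pz_Om P).
Local Notation sg := (pz_sg P).
Local Notation T := (pz_T P).
Local Notation Gam := (bdry Om).
Local Notation L2 := (L2 sg Gam).
Local Notation Zs := (Zspace T sg Gam).
Local Notation ipZ := (ipZ T sg Gam).
Local Notation nZ := (normZ T sg Gam).
Local Notation nX := (normX T sg Gam).
Hypothesis one_H1 : H1 mu Om (cstf 1).
Let mGam := Gam_measurable P.
Let T0 := pz_T_gt0 P.
Let one_L2 : L2 (fun=> 1) := one_L2Gam one_H1.
Let zP := ipZ_semi T0 mGam one_L2.
Let xP := @ipX_semi R d P.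
Let uP := ipU_semi one_H1.

(** [c] and [M] are parameters, so that they can be fixed before the discrete spaces are chosen. The
    factor [1 + M] leaves room for passing from the L^2_rho norm of the state error to its H^1
    norm. *)
Lemma control_bound S Rop (ud : R -> vfield R d) za zb c M alpha Vh Wh n (K : 'I_n -> set X) Pi
    Sh Rh z zh :
  is_S P S -> is_R P Rop -> Uspace P ud ->
  0 <= c -> 0 <= M -> (forall v, Zs v -> snorm (ipU P) (Sh v) <= c * snorm ipZ v) ->
  (forall u, Uspace P u -> snorm (ipU P) u <= M * normU P u) ->
  0 < alpha -> galerkin_spaces P Vh Wh -> is_L2proj P K Pi ->
  is_Sh P Vh Wh Sh -> is_Rh P Vh Wh Rh ->
  is_minimizer (Zad P za zb) (cost P S ud alpha) z ->
  is_minimizer (Zh P K `&` Zad P za zb) (cost P Sh ud alpha) zh ->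
  nZ (z - zh) <= (1 + 2 * (c ^+ 2 + c + 2 * T) / alpha) * (1 + M) *
    (nZ (z - (fun t => Pi (z t))) + normU P (S z - Sh z)
     + nX (Rop (S z - ud) - Rh (S z - ud))
     + nX (Rop (S z - ud) - (fun t => Pi (Rop (S z - ud) t)))).
Proof.
move=> SP RP Hud c0 M0 Shc hM al0 gal PiP ShP RhP [Az zmin] [Azh zhmin].
have sr := adjoint_pair_S one_H1 SP RP.
have shr := adjoint_pair_Sh one_H1 gal ShP RhP.
have zx : Zs `<=` @Xspace R d P by move=> v; exact: (Z_C0 T0 mGam one_L2).
have AB : Zad P za zb `<=` Zs by move=> v [].
have Hz := AB _ Az; have Hzh := AB _ Azh.2.
have sz := sip_sub zP; have sx := sip_sub xP; have su := sip_sub uP.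
have [Sz Shz] := (adj_in sr Hz, adj_in shr Hz).
set f := S z - ud; have Hf : Uspace P f := subspaceB su Sz Hud.
set p := fun t => Pi (z t); set bp := fun t => Pi (Rop f t).
have Hp : Zs p by exact: (Pi_Z one_L2 PiP Hz).
have Hb := adj_out sr Hf; have Hbp : Xspace P bp by exact: (Pi_C0 PiP Hb).
(* At each time [bp] is piecewise constant, hence orthogonal to the projection error of [z]. *)
have orth : ipX P (p - z) bp = 0.
  rewrite (sipBl xP (zx _ Hp) (zx _ Hz) Hbp).
  apply/eqP; rewrite subr_eq0; apply/eqP; apply: eq_Rintegral => t /set_mem It.
  have [Lz _] := zx _ Hz t It; have [Lb _] := Hb t It.
  by apply: (Pi_orth PiP) => //; exact: (Pi_P0 PiP).
have est := control_estimate zP xP uP zx sr shr Hud al0 (ltW T0) c0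
  (ipX_le_ipZ one_H1) Shc (A := Zad P za zb) (Ah := Zh P K `&` Zad P za zb) AB
  (fun v vA => vA.2) (fun v w s => Zad_convex one_H1 (s:=s))
  (fun v w s hv hw s0 s1 => conj (Zh_convex one_H1 s hv.1 hw.1)
     (Zad_convex one_H1 hv.2 hw.2 s0 s1)) Az _ Azh _
  (conj (Pi_Zh one_L2 PiP Hz) (Pi_Zad one_L2 PiP Az)) (Zh_orth one_L2 PiP Hz Azh.1)
  Hbp orth.
have qS v : Zad P za zb v -> cost P S ud alpha v = qcost ipZ (ipU P) S ud alpha v.
  by move=> /AB; exact: (costE one_H1 _ (adj_in sr) Hud).
have qSh v : Zad P za zb v -> cost P Sh ud alpha v = qcost ipZ (ipU P) Sh ud alpha v.
  by move=> /AB; exact: (costE one_H1 _ (adj_in shr) Hud).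
have {}est := est _ _; rewrite -/f -/p -/bp in est.
have nzE v w : Zs v -> Zs w -> nZ (v - w) = snorm ipZ (v - w).
  by move=> Hv Hw; apply: (normZE T0 mGam one_L2); exact: (subspaceB sz).
have nxE v w : Xspace P v -> Xspace P w -> nX (v - w) = snorm (ipX P) (v - w).
  by move=> Hv Hw; apply: normXE; exact: (subspaceB sx).
rewrite (nzE _ _ Hz Hzh) (nzE _ _ Hz Hp) (nxE _ _ Hb (adj_out shr Hf)) (nxE _ _ Hb Hbp).
apply: le_trans (est _ _) _.
- by move=> v Av; rewrite -(qS _ Az) -(qS _ Av); exact: zmin.
- move=> v Av; rewrite -(qSh _ Azh.2) -(qSh _ Av.2); exact: zhmin.
rewrite -(mulrA (1 + _)); apply: ler_wpM2l.
  rewrite addr_ge0// divr_ge0 ?(ltW al0)// mulr_ge0// !addr_ge0 ?sqr_ge0//.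
  by rewrite mulr_ge0// ltW.
have hMu := hM _ (subspaceB su Sz Shz).
have a0 := @snorm_ge0 _ _ ipZ (z - p); have b0 := @snorm_ge0 _ _ (ipX P) (Rop f - Rh f).
have g0 := @snorm_ge0 _ _ (ipX P) (Rop f - bp); have u0 : 0 <= normU P (S z - Sh z) by exact: sqrtr_ge0.
have := mulr_ge0 M0 a0; have := mulr_ge0 M0 b0; have := mulr_ge0 M0 g0.
by move: hMu u0; clear; lra.
Qed.

End MainEstimate.

Theorem theorem4p5 (R : realType) (d : nat) (P : piezo R d)
    (S : (R -> 'rV[R]_d -> R^o) -> R -> vfield R d)
    (Rop : (R -> vfield R d) -> R -> 'rV[R]_d -> R^o)
    (ud : R -> vfield R d) (za zb : R) :
  is_S P S -> is_R P Rop ->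
  Uspace P ud -> normH1v (pz_mu P) (pz_Om P) (ud 0) = 0 ->
  za <= 0 -> 0 <= zb ->
  exists C : R -> R,
    (exists M : R, \forall alpha \near 0^'+, `|C alpha| <= M * alpha^-1) /\
    forall (alpha : R) (Vh : set (vfield R d)) (Wh : set (sfield R d))
      (n : nat) (K : 'I_n -> set 'rV[R]_d)
      (Pi : ('rV[R]_d -> R^o) -> 'rV[R]_d -> R^o)
      (Sh : (R -> 'rV[R]_d -> R^o) -> R -> vfield R d)
      (Rh : (R -> vfield R d) -> R -> 'rV[R]_d -> R^o)
      (z zh : R -> 'rV[R]_d -> R^o),
    0 < alpha ->
    galerkin_spaces P Vh Wh -> boundary_mesh P K -> is_L2proj P K Pi ->
    is_Sh P Vh Wh Sh -> is_Rh P Vh Wh Rh ->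
    is_minimizer (Zad P za zb) (cost P S ud alpha) z ->
    is_minimizer (Zh P K `&` Zad P za zb) (cost P Sh ud alpha) zh ->
    let f := S z - ud in
    let beta := Rop f in
    let nZ := normZ (pz_T P) (pz_sg P) (bdry (pz_Om P)) in
    let nX := normX (pz_T P) (pz_sg P) (bdry (pz_Om P)) in
    nZ (z - zh) <=
      C alpha * (nZ (z - (fun t => Pi (z t))) + normU P (S z - Sh z)
                 + nX (Rop f - Rh f) + nX (beta - (fun t => Pi (beta t)))).
Proof.
move=> SP RP Hud _ _ _.
(* Without constants in H^1 there are no Galerkin spaces at all. *)
have [one_H1|none] := pselect (H1 (pz_mu P) (pz_Om P) (cstf 1)); last first.
  exists (fun=> 0); split.
    by exists 0; apply: nearW => a; rewrite normr0 mul0r.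
  by move=> alpha Vh Wh n K Pi Sh Rh z zh _ /galerkin_one_H1.
have [c c0 ShB] := Sh_bound one_H1 SP; have [M M0 hM] := normU_ge one_H1.
pose k := 2 * (c ^+ 2 + c + 2 * pz_T P).
have k0 : 0 <= k.
  by rewrite mulr_ge0// !addr_ge0 ?sqr_ge0// mulr_ge0// ltW// pz_T_gt0.
exists (fun alpha => (1 + k / alpha) * (1 + M)); split.
  (* For [alpha <= 1] one has [1 + k / alpha <= (1 + k) / alpha]. *)
  exists ((1 + k) * (1 + M)); near=> alpha.
  have al0 : 0 < alpha by near: alpha; exact: nbhs_right_gt.
  have al1 : alpha <= 1 by near: alpha; exact: nbhs_right_le.
  have M1 : 0 <= 1 + M by rewrite addr_ge0.
  rewrite ger0_norm; last by rewrite mulr_ge0// addr_ge0// divr_ge0// ltW.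
  rewrite [leRHS]mulrAC; apply: ler_wpM2r => //.
  by rewrite mulrDl lerD2r mul1r -invr1 lef_pV2 ?posrE.
move=> alpha Vh Wh n K Pi Sh Rh z zh al0 gal _ PiP ShP RhP zmin zhmin.
exact: (control_bound one_H1 SP RP Hud c0 M0 (ShB _ _ _ _ gal ShP RhP) hM al0 gal PiP ShP RhP zmin zhmin).
Unshelve. all: by end_near.
Qed.
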